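(* Let $f_1$ and $f_2$ be the weight-$4$ cusp forms $$f_1(\tau)=\frac{\eta(4\tau)^{16}}{\eta(2\tau)^4\eta(8\tau)^4},\qquad f_2(\tau)=\eta(2\tau)^4\eta(4\tau)^4 .$$ Their critical $L$-values satisfy $$L(f_1,3)=\frac{\pi}{2}L(f_2,2)=\frac{\pi^2}{8}L(f_1,1),$$ and $$L(f_2,3)=\frac{\pi}{4}L(f_1,2)=\frac{\pi^2}{4}L(f_2,1).$$
   Context: With $q=e^{2\pi i\tau}$, $\eta(\tau)=q^{1/24}\prod_{n\ge1}(1-q^n)$ is the Dedekind eta function (with $q^{1/24}=e^{2\pi i\tau/24}$). For a cusp form $f(\tau)=\sum_{n\ge1}a_nq^n$, its $L$-function is $L(f,s)=\sum_{n\ge1}a_nn^{-s}$, understood by analytic continuation where the series does not converge absolutely; equivalently, for each positive integer $s$, $$L(f,s)=\frac{(2\pi)^s}{\Gamma(s)}\int_0^\infty f(it)\,t^{s-1}\,dt .$$ *)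

(* Defs.v *)
From mathcomp Require Import all_boot all_order all_algebra.
From mathcomp Require Import complex.
From mathcomp Require Import all_classical all_reals all_analysis.
Import Order.TTheory GRing.Theory Num.Theory.
Import numFieldNormedType.Exports.

Set Implicit Arguments.
Unset Strict Implicit.
Unset Printing Implicit Defensive.

Local Open Scope classical_set_scope.
Local Open Scope ring_scope.
Local Open Scope complex_scope.

Definition cexp (R : realType) (z : R[i]) : R[i] :=
  (expR (complex.Re z))%:C * (cos (complex.Im z) +i* sin (complex.Im z)).

Definition qparam (R : realType) (tau : R[i]) : R[i] :=
  cexp ('i * (2 * pi)%:C * tau).

(* Meaningful for [tau] in the upper half-plane, where the product converges. The
   topology of the complex numbers is carried by the alias [R[i]^o]. *)
Definition eta (R : realType) (tau : R[i]) : R[i] :=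
  cexp ('i * (2 * pi)%:C * tau / 24)
  * (limn (fun N : nat =>
      \prod_(1 <= n < N.+1) (1 - qparam tau ^+ n) : R[i]^o) : R[i]).

Definition f1 (R : realType) (tau : R[i]) : R[i] :=
  eta (4 * tau) ^+ 16 / (eta (2 * tau) ^+ 4 * eta (8 * tau) ^+ 4).

Definition f2 (R : realType) (tau : R[i]) : R[i] :=
  eta (2 * tau) ^+ 4 * eta (4 * tau) ^+ 4.

Definition Cintegral (R : realType) (D : set R) (g : R -> R[i]) : R[i] :=
  Rintegral (@lebesgue_measure R) D (fun t => complex.Re (g t))
  +i* Rintegral (@lebesgue_measure R) D (fun t => complex.Im (g t)).

(* The value L(f, s) of the L-function of a cusp form at a positive integer
   [s], through the Mellin transform along the imaginary axis, which gives the
   analytic continuation of the Dirichlet series; [(s.-1)`!] is Gamma(s). *)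
Definition Lvalue (R : realType) (f : R[i] -> R[i]) (s : nat) : R[i] :=
  ((2 * pi) ^+ s / (s.-1)`!%:R)%:C
  * Cintegral `]0, +oo[ (fun t => f ('i * t%:C) * t%:C ^+ s.-1).

(* Main.v *)
From HB Require Import structures.
Require Import Defs.
From mathcomp Require Import all_boot all_order all_algebra.
From mathcomp Require Import complex.
From mathcomp Require Import all_classical all_reals all_analysis.
From mathcomp Require Import measurable_realfun.
From mathcomp Require Import ring lra zify.
Import Order.TTheory GRing.Theory Num.Theory.
Import numFieldNormedType.Exports.

(** Everything is a nonnegative integral over the half-line. On the imaginary
    axis put q = exp(-pi t) with t = 4 t0, and let A, B, C be the squares of the
    theta constants theta_3, theta_4, theta_2 at nome q. The product formulas
    give f1(i t0) = C A^2 B / 4 and f2(i t0) = C A B^2 / 4, so the six L-values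
    are the moments of order 0, 1, 2 in t of C A^2 B and C A B^2.

    The moduli X = C^2/B^2 and k = C^2/A^2 are decreasing functions of t, onto
    ]0, oo[ and ]0, 1[. Three classical facts turn the moments into integrals of
    elliptic integrals: C^2 = A^2 - B^2 ([thC_sqr]); the periods attached to
    (A^2, B^2) and (A^2, C^2) are pi and pi t ([ellint_AB], [ellint_AC]); and
    X' = - pi A^2 C^2 / B^2, k' = - pi B^2 C^2 / A^2, which comes from
    [theta_dlog]. Up to one constant and powers of 4, the moments for f1 and for
    f2 become
      X_n = int_0^oo G^(2-n) H^n dX / sqrt X  and
      Y_n = int_0^1 K'^(2-n) K^n dk / sqrt k,
    where G, H are the two periods [ellG], [ellH] at X, and K, K' stand for
    [ellint 1 k], [ellint 1 (1 - k)] ([theta_integral_X], [theta_integral_K]).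

    The theorem then says X_0 = X_2 = 2 Y_1 and X_1 = Y_2 = 2 Y_0.
    - X_0 = X_2 is the substitution X -> 1/X ([moment_HH_GG]).
    - X_1 = Y_2 and X_0 = 2 Y_1 come from writing G and H as integrals over
      ]0, X[ and ]X, oo[, exchanging the order of integration, and recognizing
      complete elliptic integrals again ([unfold_product], [moment_GH],
      [moment_GG]).
    - Y_2 = 2 Y_0 is Landen's transformation ([ellint_square_moments]).

    The theta identities are proved by one device, [nome_doubling]: a function
    of q that is invariant under q -> q^2 and has a limit at 0 is constant. It
    applies once the values of A, B, C at q^2 are known ([thA_double],
    [thB_double], [thC_double]), and these follow from the triple product and
    from counting representations by sums of two squares ([theta_sqr]). All
    integrals take values in the extended reals, and the final relations are
    proportionalities, hence survive taking finite parts. *)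

Set Implicit Arguments.
Unset Strict Implicit.
Unset Printing Implicit Defensive.
Local Open Scope classical_set_scope.
Local Open Scope ring_scope.

Notation mreal R := (measurableTypeR R).

(** * Change of variables for nonnegative integrals on the half-line *)

Section change_of_variables.
Context {R : realType}.
Notation mu := (@lebesgue_measure R).
Variables phi dphi : R -> R.
Hypothesis phiD : forall x : R, 0 < x -> is_derive x (1:R) phi (dphi x).
Hypothesis dphiC : forall x : R, 0 < x -> {for x, continuous dphi}.
Hypothesis dphi0 : forall x : R, 0 < x -> 0 < dphi x.

Lemma cov_cont (x : R) : 0 < x -> {for x, continuous phi}.
Proof.
move=> x0; apply: differentiable_continuous; apply/derivable1_diffP.
by have [] := phiD x0.
Qed.

Lemma cov_within_phi (a b : R) : 0 < a -> {within `[a, b], continuous phi}.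
Proof.
move=> a0; apply: continuous_in_subspaceT => x; rewrite inE/= in_itv/= => /andP[ax _].
exact: (cov_cont (lt_le_trans a0 ax)).
Qed.

Lemma cov_within_dphi (a b : R) : 0 < a -> {within `[a, b], continuous dphi}.
Proof.
move=> a0; apply: continuous_in_subspaceT => x; rewrite inE/= in_itv/= => /andP[ax _].
exact: (dphiC (lt_le_trans a0 ax)).
Qed.

Lemma cov_FTC (a b : R) : 0 < a -> a <= b ->
  (\int[mu]_(x in `[a, b]) (dphi x)%:E = (phi b - phi a)%:E)%E.
Proof.
move=> a0; rewrite le_eqVlt => /predU1P[<-|ab].
  by rewrite set_itv1 integral_set1 subrr.
rewrite (@continuous_FTC2 _ dphi phi)//.
- exact: cov_within_dphi.
- split.
  + move=> x; rewrite in_itv/= => /andP[ax _].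
    by have [] := phiD (lt_trans a0 ax).
  + exact/cvg_at_right_filter/(cov_cont a0).
  + exact/cvg_at_left_filter/(cov_cont (lt_trans a0 ab)).
- move=> x; rewrite in_itv/= => /andP[ax _].
  by rewrite derive1E; have := phiD (lt_trans a0 ax) => h; rewrite derive_val.
Qed.

Lemma cov_lt (a b : R) : 0 < a -> a < b -> phi a < phi b.
Proof.
move=> a0 ab.
have [] := @MVT _ phi dphi a b ab.
- by move=> x; rewrite in_itv/= => /andP[ax _]; exact: (phiD (lt_trans a0 ax)).
- exact: cov_within_phi.
- move=> x; rewrite in_itv/= => /andP[ax _] h.
  by rewrite -subr_gt0 h mulr_gt0 ?subr_gt0// dphi0// (lt_trans a0 ax).
Qed.

Lemma cov_le (a b : R) : 0 < a -> a <= b -> phi a <= phi b.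
Proof.
by move=> a0; rewrite le_eqVlt => /predU1P[->//|ab]; exact/ltW/cov_lt.
Qed.

Lemma cov_le_mono (a b : R) : 0 < a -> 0 < b -> (phi a <= phi b) = (a <= b).
Proof.
move=> a0 b0; case: (leP a b) => ab; first exact: cov_le.
by apply/negbTE; rewrite -ltNge cov_lt.
Qed.

Lemma cov_IVT (a b y : R) : 0 < a -> a <= b -> phi a <= y <= phi b ->
  exists2 c, a <= c <= b & phi c = y.
Proof.
move=> a0 ab yab.
have [] := @IVT _ phi a b y ab (@cov_within_phi a b a0).
  by case/andP: yab => h1 h2; rewrite minEle maxEle cov_le// h1.
by move=> c; rewrite in_itv/= => h1 h2; exists c.
Qed.

Variables (a b : R).
Hypotheses (a0 : 0 < a) (ab : a <= b).

Let sub0 : `[a, b] `<=` `]0, +oo[.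
Proof.
by move=> x /=; rewrite !in_itv/= andbT => /andP[ax _]; exact: lt_le_trans ax.
Qed.

Let mphi : measurable_fun `[a, b] phi.
Proof.
apply: (measurable_funS _ sub0) => //; apply: open_continuous_measurable_fun => //.
by move=> x; rewrite inE/= in_itv/= andbT => /cov_cont.
Qed.

Let mdphi : measurable_fun `[a, b] dphi.
Proof.
apply: (measurable_funS _ sub0) => //; apply: open_continuous_measurable_fun => //.
by move=> x; rewrite inE/= in_itv/= andbT => /dphiC.
Qed.

Let ab0 x : x \in `[a, b] -> 0 < x.
Proof. by rewrite in_itv/= => /andP[ax _]; exact: lt_le_trans ax. Qed.

Let nu (S : set (measurableTypeR R)) : \bar R := (\int[mu]_(x in `[a, b] `&` phi @^-1` S) (dphi x)%:E)%E.

Let mpre S : measurable S -> measurable (`[a, b] `&` phi @^-1` S).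
Proof. by move=> mS; exact: mphi. Qed.

Let nu0 : nu set0 = 0%E.
Proof. by rewrite /nu preimage_set0 setI0 integral_set0. Qed.

Let nu_ge0 S : (0 <= nu S)%E.
Proof.
by apply: integral_ge0 => x [/ab0 x0 _]; rewrite lee_fin ltW// dphi0.
Qed.

Let nu_sigma : semi_sigma_additive (nu : set (measurableTypeR R) -> \bar R).
Proof.
move=> F mF tF mUF; apply: cvg_toP.
  by apply: ereal_nondecreasing_is_cvgn => m n mn; exact: lee_sum_nneg_natr.
rewrite /nu preimage_bigcup setI_bigcupr ge0_integral_bigcup//=.
- by move=> k; apply: mpre; exact: mF.
- rewrite -setI_bigcupr; apply: (measurable_funS _ (@subIsetl _ _ _)) => //.
  exact/measurable_EFinP.
- by move=> x [n _ [/ab0 x0 _]]; rewrite lee_fin ltW// dphi0.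
- apply: trivIset_setIl.
  by move=> i j _ _ [x [Fi Fj]]; apply: tF => //; exists (phi x).
Qed.

(** By the fundamental theorem of calculus the image by [phi] of the measure with
    density [dphi] gives the right mass to every ray, and rays form a
    generating pi-system. *)
Let nu_lebesgue S : measurable S -> mu (S `&` `[phi a, phi b]) = nu S.
Proof.
move=> mS; have mK : measurable (`[phi a, phi b] : set R) by [].
pose m2 : {measure set (measurableTypeR R) -> \bar R} :=
  HB.pack nu (isMeasure.Build _ (measurableTypeR R) R nu nu0 nu_ge0 nu_sigma).
rewrite -[LHS]/(mrestr mu mK S) -[RHS]/(m2 S).
have := @measure_unique _ R (measurableTypeR R) (@RGenCInfty.G R)
  (fun n => `[- n%:R, +oo[%classic).
move=> /(_ _ _ _ _ (mrestr mu mK) m2) H.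
apply: H => //.
- exact: RGenCInfty.measurableE.
- move=> _ _ [x ->] [y ->]; exists (Num.max x y).
  apply/seteqP; split => z /=; rewrite !in_itv/= !andbT ge_max.
    by move=> [-> ->].
  by case/andP.
- by move=> i; exists (- i%:R).
- apply/seteqP; split=> // x _; exists (Num.trunc `|x|).+1 => //=.
  rewrite in_itv/= andbT lerNl; apply: ltW.
  by apply: le_lt_trans (truncnS_gt _); rewrite -normrN ler_norm.
- move=> _ [u ->]; change (mu (`[u, +oo[ `&` `[phi a, phi b]) = nu `[u, +oo[).
  rewrite /nu; case: (ltP (phi b) u) => ub.
    rewrite [X in mu X](_ : _ = set0) ?measure0; last first.
      apply/seteqP; split=> // z /=; rewrite !in_itv/= andbT => -[uz /andP[_ zb]].
      by have := le_lt_trans (le_trans uz zb) ub; rewrite ltxx.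
    rewrite [X in integral _ X _](_ : _ = set0) ?integral_set0//.
    apply/seteqP; split=> // z [/= zab]; rewrite /= in_itv/= andbT => uz.
    have z0 := ab0 zab; move: zab; rewrite in_itv/= => /andP[az zb].
    by have := le_lt_trans (le_trans uz (cov_le z0 zb)) ub; rewrite ltxx.
  have [c /andP[ac cb] cu] : exists2 c, a <= c <= b & phi c = Num.max u (phi a).
    by apply: cov_IVT => //; rewrite le_max lexx orbT/= ge_max ub cov_le.
  have c0 := lt_le_trans a0 ac.
  rewrite (_ : _ `&` _ = `[phi c, phi b]%classic); last first.
    apply/seteqP; split=> z /=; rewrite !in_itv/= !andbT cu ge_max.
      by move=> [-> /andP[-> ->]].
    by case/andP=> /andP[-> ->] ->.
  rewrite (_ : _ `&` _ = `[c, b]%classic); last first.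
    apply/seteqP; split=> z /=; rewrite !in_itv/= !andbT.
      move=> [/andP[az zb] uz]; rewrite zb andbT.
      rewrite -cov_le_mono// ?(lt_le_trans a0 az)// cu ge_max uz/=.
      exact: cov_le.
    move=> /andP[cz zb]; rewrite zb andbT (le_trans ac cz); split=> //.
    by apply: (@le_trans _ _ (phi c)); [rewrite cu le_max lexx|exact: cov_le].
  rewrite cov_FTC// lebesgue_measure_itv/= lte_fin.
  case: ltP => // h.
  have /eqP -> : phi c == phi b by rewrite eq_le h cov_le.
  by rewrite subrr.
- move=> k; apply: (@le_lt_trans _ _ (mu `[phi a, phi b])).
    by apply: le_measure; rewrite ?inE//; exact: measurableI.
  by rewrite lebesgue_measure_itv/=; case: ifP => _; rewrite -?EFinB ltry.
Qed.

Import HBNNSimple.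

(** The case of an indicator is [nu_lebesgue]; monotone convergence along simple
    approximations does the rest. *)
Lemma cov_segment (f : R -> \bar R) : measurable_fun `[phi a, phi b] f ->
  (forall y : R, phi a <= y <= phi b -> (0 <= f y)%E) ->
  (\int[mu]_(y in `[phi a, phi b]) f y =
   \int[mu]_(x in `[a, b]) (f (phi x) * (dphi x)%:E))%E.
Proof.
move=> mf f0; have mK : measurable (`[phi a, phi b] : set R) by [].
pose f_ := @nnsfun_approx _ (measurableTypeR R) R _ mK _ mf.
have phiK x : x \in `[a, b] -> phi a <= phi x <= phi b.
  move=> xab; have x0 := ab0 xab; move: xab; rewrite in_itv/= => /andP[ax xb].
  by rewrite !cov_le.
have f_cvg y : phi a <= y <= phi b -> EFin (f_ n y) @[n --> \oo] --> f y.
  by move=> yK; apply: cvg_nnsfun_approx => //=; rewrite ?in_itv//= => z; rewrite in_itv; exact: f0.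
transitivity (limn (fun n => \int[mu]_(y in `[phi a, phi b]) (f_ n y)%:E)%E).
  rewrite -monotone_convergence//.
  - apply: eq_integral => y; rewrite inE/= in_itv/= => yD.
    by apply/esym/cvg_lim => //; exact: f_cvg.
  - move=> n; apply/measurable_EFinP. apply: measurable_funS (@measurable_funPT _ _ _ _ (f_ n)) => //.
  - by move=> n y _; rewrite lee_fin.
  - by move=> y _ m n mn; rewrite lee_fin; exact/lefP/nd_nnsfun_approx.
have mphi_ n : measurable_fun `[a, b] (fun x => f_ n (phi x) * dphi x).
  apply: measurable_funM => //; apply: (measurableT_comp _ mphi).
  exact: (@measurable_funPT _ _ _ _ (f_ n)).
have mI (S : set R) : measurable S ->
    measurable_fun `[a, b] (fun x => \1_S (phi x) : R).
  by move=> mS; apply: (measurableT_comp _ mphi); exact: measurable_indic.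
transitivity (limn (fun n => \int[mu]_(x in `[a, b]) (f_ n (phi x) * dphi x)%:E)%E); last first.
  rewrite -monotone_convergence//.
  - apply: eq_integral => x; rewrite inE/= => xD; apply/cvg_lim => //.
    under eq_fun do rewrite EFinM.
    apply: cvgeZr; rewrite ?fin_numE//; exact/f_cvg/phiK.
  - by move=> n; apply/measurable_EFinP; exact: mphi_.
  - by move=> n x xab; rewrite lee_fin mulr_ge0// ltW// dphi0// ab0.
  - move=> x xab m n mn; rewrite lee_fin ler_wpM2r//; first by rewrite ltW// dphi0// ab0.
    by have /lefP := @nd_nnsfun_approx _ (measurableTypeR R) R _ mK _ mf m n mn; exact.
congr (limn _); apply/funext => n.
have mr (r : R) : measurable (f_ n @^-1` [set r] : set (measurableTypeR R)) by [].
under eq_integral do rewrite fimfunE -fsumEFin//.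
under [RHS]eq_integral do rewrite fimfunE mulr_fsuml -fsumEFin//.
rewrite ge0_integral_fsum//; last 2 first.
- by move=> y; exact/measurable_EFinP/measurable_funTS/measurable_funM.
- by move=> y x _; rewrite nnfun_muleindic_ge0.
rewrite ge0_integral_fsum//; last 2 first.
- move=> y; apply/measurable_EFinP; apply: measurable_funM => //.
  by apply: measurable_funM => //; apply: mI; exact: mr.
- move=> y x xab; rewrite EFinM mule_ge0 ?nnfun_muleindic_ge0//.
  by rewrite lee_fin ltW// dphi0// ab0.
apply: eq_fsbigr => r _; rewrite integralZl_indic_nnsfun// integral_indic//.
have [r0|r0] := ltP r 0.
  rewrite preimage_nnfun0// set0I measure0 mule0 integral0_eq// => x _.
  by rewrite indic0 mulr0 mul0r.
transitivity (r%:E * nu (f_ n @^-1` [set r]))%E.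
  by congr (_ * _)%E; apply: nu_lebesgue; exact: mr.
rewrite /nu.
under [RHS]eq_integral do rewrite -mulrA EFinM.
rewrite ge0_integralZl_EFin//; last 2 first.
- by move=> x xab; rewrite lee_fin mulr_ge0// ltW// dphi0// ab0.
- apply/measurable_EFinP; apply: measurable_funM => //.
  apply: mI; exact: mr.
congr (_ * _)%E; rewrite integral_mkcondr; apply: eq_integral => x _.
rewrite patchE /= indicE; case: ifPn => h.
  by rewrite mem_set ?mul1r//; move: h; rewrite inE.
by rewrite memNset ?mul0r// => h'; move/negP: h; rewrite inE.
Qed.

End change_of_variables.

(** Both sides are increasing limits of the segment case along
    [1/(n+1), n+1], whether or not the integrals are finite. *)
Lemma ge0_cov_increasing {R : realType} (phi dphi : R -> R) (J : set R)
    (f : R -> \bar R) :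
  (forall x : R, 0 < x -> is_derive x (1:R) phi (dphi x)) ->
  (forall x : R, 0 < x -> {for x, continuous dphi}) ->
  (forall x : R, 0 < x -> 0 < dphi x) ->
  phi @` `]0, +oo[ = J ->
  measurable_fun J f -> (forall y, J y -> (0 <= f y)%E) ->
  (\int[@lebesgue_measure R]_(y in J) f y =
   \int[@lebesgue_measure R]_(x in `]0%R, +oo[) (f (phi x) * (dphi x)%:E))%E.
Proof.
move=> phiD dphiC dphi0 <- mf f0.
pose a n : R := n.+1%:R^-1; pose b n : R := n.+1%:R.
have a0 n : 0 < a n by rewrite invr_gt0.
have ab n : a n <= b n.
  by rewrite (@le_trans _ _ 1)// /a /b ?invf_le1// ler1n.
have b0 n : 0 < b n by rewrite ltr0n.
have aS n m : (n <= m)%N -> a m <= a n by move=> nm; rewrite /a lef_pV2 ?posrE// ler_nat.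
have bS n m : (n <= m)%N -> b n <= b m by move=> nm; rewrite /b ler_nat.
have cover (x : R) : 0 < x -> exists n, a n <= x <= b n.
  move=> x0; exists (maxn (Num.trunc x^-1) (Num.trunc x)); apply/andP; split.
    rewrite -[leRHS]invrK lef_pV2// ?posrE ?invr_gt0//.
    by apply: (le_trans (ltW (truncnS_gt _))); rewrite ler_nat ltnS leq_maxl.
  by apply: (le_trans (ltW (truncnS_gt _))); rewrite ler_nat ltnS leq_maxr.
have I0 n x : `[a n, b n]%classic x -> 0 < x.
  by rewrite /= in_itv/= => /andP[ax _]; exact: lt_le_trans ax.
have KJ n : `[phi (a n), phi (b n)] `<=` phi @` `]0, +oo[.
  move=> y; rewrite /= in_itv/= => yK.
  have [c /andP[ac _] cy] := cov_IVT phiD dphi0 (a0 n) (ab n) yK.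
  by exists c => //; rewrite /= in_itv/= andbT (lt_le_trans _ ac).
have EI : `]0, +oo[%classic = \bigcup_n `[a n, b n]%classic.
  apply/seteqP; split=> x /=; rewrite ?in_itv/= ?andbT.
    by move=> /cover[n xn]; exists n.
  by move=> [n _ /I0].
have EJ : phi @` `]0, +oo[ = \bigcup_n `[phi (a n), phi (b n)]%classic.
  apply/seteqP; split=> y; last by move=> [n _ /KJ].
  move=> [x]; rewrite /= in_itv/= andbT => x0 <-.
  have [n /andP[ax xb]] := cover x x0; exists n => //=; rewrite in_itv/=.
  by rewrite !(cov_le phiD dphi0)// (lt_le_trans _ ax).
have mJ : measurable (phi @` `]0, +oo[).
  by rewrite EJ; apply: bigcup_measurable => n _; exact: measurable_itv.
have mfK n : measurable_fun `[phi (a n), phi (b n)] f.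
  by apply: measurable_funS mf => //; exact: KJ.
have cphi x : 0 < x -> {for x, continuous phi} by exact: cov_cont.
have mI n : measurable_fun `[a n, b n] (fun x => f (phi x) * (dphi x)%:E)%E.
  have sub : `[a n, b n] `<=` `]0, +oo[.
    by move=> x /I0; rewrite /= in_itv/= andbT.
  apply: emeasurable_funM.
    apply: (@measurable_comp _ _ _ _ _ _ `[phi (a n), phi (b n)]) => //.
      move=> _ [x + <-]; rewrite /= !in_itv/= => /andP[ax xb].
      by rewrite !(cov_le phiD dphi0)// (lt_le_trans _ ax).
    apply: (measurable_funS _ sub) => //; apply: open_continuous_measurable_fun => //.
    by move=> x; rewrite inE/= in_itv/= andbT => /cphi.
  apply/measurable_EFinP.
  apply: (measurable_funS _ sub) => //; apply: open_continuous_measurable_fun => //.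
  by move=> x; rewrite inE/= in_itv/= andbT => /dphiC.
have cvg1 := @ge0_nondecreasing_set_cvg_integral _ (measurableTypeR R) R
  (fun n => `[phi (a n), phi (b n)]%classic) f lebesgue_measure.
have cvg2 := @ge0_nondecreasing_set_cvg_integral _ (measurableTypeR R) R
  (fun n => `[a n, b n]%classic) (fun x => f (phi x) * (dphi x)%:E)%E lebesgue_measure.
rewrite EJ EI.
apply: (cvg_unique _ (cvg1 _ _ _ _)) => //.
- apply/nondecreasing_seqP => n; rewrite subsetEset => x /=; rewrite !in_itv/=.
  move=> /andP[ax xb]; rewrite (le_trans _ ax)/=; last exact/(cov_le phiD dphi0)/aS.
  by rewrite (le_trans xb)//; exact/(cov_le phiD dphi0)/bS.
- by move=> n x /KJ/f0.
have -> : (fun i => (\int[lebesgue_measure]_(x in `[phi (a i), phi (b i)]) f x)%E) =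
   (fun i => (\int[lebesgue_measure]_(x in `[a i, b i]) (f (phi x) * (dphi x)%:E))%E).
  apply/funext => n; apply: (cov_segment phiD dphiC dphi0 (a0 n) (ab n) (mfK n)).
  by move=> y yK; apply: f0; apply: (@KJ n); rewrite /= in_itv.
apply: cvg2 => //.
- apply/nondecreasing_seqP => n; rewrite subsetEset => x /=; rewrite !in_itv/=.
  move=> /andP[ax xb]; rewrite (le_trans _ ax)/=; last exact: aS.
  by rewrite (le_trans xb)//; exact: bS.
- move=> n x /I0 x0; apply: mule_ge0; last by rewrite lee_fin ltW// dphi0.
  by apply: f0; exists x => //=; rewrite in_itv/= andbT.
Qed.

Lemma ge0_integral_opp {R : realType} (J : set R) (f : R -> \bar R) :
  measurable J -> measurable_fun J f -> (forall y, J y -> (0 <= f y)%E) ->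
  (\int[@lebesgue_measure R]_(y in J) f y =
   \int[@lebesgue_measure R]_(y in -%R @` J) f (- y)%R)%E.
Proof.
move=> mJ mf f0.
transitivity (\int[pushforward lebesgue_measure
    (-%R : measurableTypeR R -> measurableTypeR R)]_(y in J) f y)%E.
  by apply: eq_measure_integral => A mA _; apply/esym/lebesgue_measureN.
rewrite ge0_integral_pushforward//; last by move=> y; rewrite inE => /f0.
congr integral; apply/seteqP; split=> y /=.
  by move=> h; exists (- y) => //; rewrite opprK.
by move=> [x Jx <-]; rewrite opprK.
Qed.

Lemma ge0_cov_decreasing {R : realType} (phi dphi : R -> R) (J : set R)
    (f : R -> \bar R) :
  (forall x : R, 0 < x -> is_derive x (1:R) phi (- dphi x)) ->
  (forall x : R, 0 < x -> {for x, continuous dphi}) ->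
  (forall x : R, 0 < x -> 0 < dphi x) ->
  phi @` `]0, +oo[ = J ->
  measurable J -> measurable_fun J f -> (forall y, J y -> (0 <= f y)%E) ->
  (\int[@lebesgue_measure R]_(y in J) f y =
   \int[@lebesgue_measure R]_(x in `]0%R, +oo[) (f (phi x) * (dphi x)%:E))%E.
Proof.
move=> phiD dphiC dphi0 EJ mJ mf f0.
have EJ' : (fun x => - phi x) @` `]0, +oo[ = -%R @` J.
  by rewrite -EJ; apply/seteqP; split => [_ [x x0 <-]|_ [_ [x x0 <-] <-]];
    [exists (phi x) => //; exists x|exists x].
have D' (x : R) : 0 < x -> is_derive x (1:R) (fun x => - phi x) (dphi x).
  move=> x0; have := phiD x x0 => h.
  by apply: is_derive_eq; rewrite opprK.
rewrite ge0_integral_opp// (ge0_cov_increasing D' dphiC dphi0 EJ').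
- by apply: eq_integral => x _; rewrite opprK.
- apply: (@measurable_comp _ _ _ _ _ _ J) => //.
  by move=> _ [_ [x Jx <-] <-]; rewrite opprK.
- by move=> _ [x Jx <-]; rewrite opprK; exact: f0.
Qed.

(** [phi] may miss part of the half-line as long as [f] vanishes there. This fits
    integrands containing [rsqrt], which cut themselves off where a radicand
    becomes negative. *)
Lemma cov_pos_increasing {R : realType} (phi dphi : R -> R) (f : R -> \bar R) :
  (forall x : R, 0 < x -> is_derive x (1:R) phi (dphi x)) ->
  (forall x : R, 0 < x -> {for x, continuous dphi}) ->
  (forall x : R, 0 < x -> 0 < dphi x) ->
  (forall x : R, 0 < x -> 0 < phi x) ->
  measurable_fun setT f -> (forall y, (0 <= f y)%E) ->
  (forall y : R, 0 < y -> (exists2 x, 0 < x & phi x = y) \/ f y = 0%E) ->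
  (\int[@lebesgue_measure R]_(y in `]0%R, +oo[) f y =
   \int[@lebesgue_measure R]_(x in `]0%R, +oo[) (f (phi x) * (dphi x)%:E))%E.
Proof.
move=> D C P Q mf f0 S.
rewrite -(ge0_cov_increasing D C P erefl)//; last exact: measurable_funTS.
rewrite integral_mkcond [RHS]integral_mkcond; apply: eq_integral => y _.
rewrite !patchE; case: ifPn; rewrite ?inE ?notin_setE/= in_itv/= andbT => y0.
  case: ifPn; rewrite ?inE ?notin_setE => // h; case: (S y y0) => // -[x x0 xy].
  by exfalso; apply: h; exists x => //=; rewrite in_itv/= andbT.
case: ifPn; rewrite ?inE ?notin_setE => // -[x /=]; rewrite in_itv/= andbT => x0 xy.
by exfalso; apply: y0; rewrite -xy Q.
Qed.

Lemma cov_pos_decreasing {R : realType} (phi dphi : R -> R) (f : R -> \bar R) :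
  (forall x : R, 0 < x -> is_derive x (1:R) phi (- dphi x)) ->
  (forall x : R, 0 < x -> {for x, continuous dphi}) ->
  (forall x : R, 0 < x -> 0 < dphi x) ->
  (forall x : R, 0 < x -> 0 < phi x) ->
  measurable_fun setT f -> (forall y, (0 <= f y)%E) ->
  (forall y : R, 0 < y -> (exists2 x, 0 < x & phi x = y) \/ f y = 0%E) ->
  (\int[@lebesgue_measure R]_(y in `]0%R, +oo[) f y =
   \int[@lebesgue_measure R]_(x in `]0%R, +oo[) (f (phi x) * (dphi x)%:E))%E.
Proof.
move=> D C P Q mf f0 S.
have mJ : measurable (phi @` `]0, +oo[).
  have D' (x : R) : 0 < x -> is_derive x (1:R) (fun x => - phi x) (dphi x).
    move=> x0; have := D x x0 => h.
    by apply: is_derive_eq; rewrite opprK.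
  apply: is_interval_measurable => _ _ [x + <-] [y + <-] z.
  rewrite /= !in_itv/= !andbT => x0 y0 /andP[xz zy].
  have yx : y <= x by rewrite -(cov_le_mono D' P)// lerN2 (le_trans xz).
  have [|c /andP[yc _] cz] := @cov_IVT _ _ _ D' P y x (- z) y0 yx.
    by rewrite !lerN2 xz zy.
  exists c; first by rewrite in_itv/= andbT (lt_le_trans y0).
  by apply: oppr_inj.
rewrite -(ge0_cov_decreasing D C P erefl)//; last exact: measurable_funTS.
rewrite integral_mkcond [RHS]integral_mkcond; apply: eq_integral => y _.
rewrite !patchE; case: ifPn; rewrite ?inE ?notin_setE/= in_itv/= andbT => y0.
  case: ifPn; rewrite ?inE ?notin_setE => // h; case: (S y y0) => // -[x x0 xy].
  by exfalso; apply: h; exists x => //=; rewrite in_itv/= andbT.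
case: ifPn; rewrite ?inE ?notin_setE => // -[x /=]; rewrite in_itv/= andbT => x0 xy.
by exfalso; apply: y0; rewrite -xy Q.
Qed.

(** Homographies with nonnegative coefficients cover nearly all the
    substitutions below; the sign of the determinant decides between the
    increasing and the decreasing case. *)
Lemma cov_mobius {R : realType} (a b c d : R) (f : R -> \bar R) :
  0 <= a -> 0 <= b -> 0 <= c -> 0 <= d -> a * d != b * c ->
  measurable_fun setT f -> (forall y, (0 <= f y)%E) ->
  (forall y : R, 0 < y -> (exists2 x, 0 < x & (a * x + b) / (c * x + d) = y) \/ f y = 0%E) ->
  (\int[@lebesgue_measure R]_(y in `]0%R, +oo[) f y =
   \int[@lebesgue_measure R]_(x in `]0%R, +oo[)
     (f ((a * x + b) / (c * x + d))%R * (`|a * d - b * c| / (c * x + d) ^+ 2)%:E))%E.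
Proof.
move=> a0 b0 c0 d0 det mf f0 S.
have pos (u v x : R) : 0 <= u -> 0 <= v -> (u != 0) || (v != 0) -> 0 < x -> 0 < u * x + v.
  move=> u0 v0 /orP[h|h] x0.
    by rewrite ltr_wpDr// mulr_gt0// lt_neqAle eq_sym h.
  by rewrite ltr_wpDl ?mulr_ge0 ?(ltW x0)// lt_neqAle eq_sym h.
have ab : (a != 0) || (b != 0).
  apply: contraR det; rewrite negb_or !negbK => /andP[/eqP-> /eqP->].
  by rewrite !mul0r.
have cd : (c != 0) || (d != 0).
  apply: contraR det; rewrite negb_or !negbK => /andP[/eqP-> /eqP->].
  by rewrite !mulr0.
have n0 x : 0 < x -> 0 < a * x + b by exact: pos.
have m0 x : 0 < x -> 0 < c * x + d by exact: pos.
pose phi x : R := (a * x + b) / (c * x + d).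
have D (x : R) : 0 < x -> is_derive x (1:R) phi ((a * d - b * c) / (c * x + d) ^+ 2).
  move=> x0; have mx := lt0r_neq0 (m0 x x0).
  have hV : is_derive x (1:R) (fun x => (c * x + d)^-1) (- (c * x + d) ^- 2 *: c).
    have h : is_derive x (1:R) (fun x => c * x + d) c.
      by apply: is_derive_eq; rewrite /GRing.scale/=; ring.
    have dh : derivable (fun x => c * x + d) x 1 by exact: ex_derive.
    apply: DeriveDef; first exact: derivableV.
    by rewrite deriveV// derive_val.
  have hN : is_derive x (1:R) (fun x => a * x + b) a.
    by apply: is_derive_eq; rewrite /GRing.scale/=; ring.
  rewrite /phi; apply: is_derive_eq; rewrite /GRing.scale/=.
  by field.
have C k (x : R) : 0 < x -> {for x, continuous (fun x => k / (c * x + d) ^+ 2)}.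
  move=> x0; apply: cvgM; first exact: cvg_cst.
  apply: cvgV; first by rewrite expf_neq0// lt0r_neq0// m0.
  apply: (@continuous_comp _ _ _ (fun x => c * x + d) (fun x => x ^+ 2)).
    apply: cvgD; last exact: cvg_cst.
    by apply: cvgM; [exact: cvg_cst|exact: cvg_id].
  exact: exprn_continuous.
have P (x : R) : 0 < x -> 0 < phi x by move=> x0; rewrite divr_gt0 ?n0 ?m0.
have [dt|dt] := ltP 0 (a * d - b * c).
  rewrite (ger0_norm (ltW dt)).
  apply: (cov_pos_increasing D (C (a * d - b * c)) _ P mf f0 S).
  by move=> x x0; rewrite divr_gt0// exprn_gt0// m0.
rewrite (ler0_norm dt).
apply: (cov_pos_decreasing _ (C (- (a * d - b * c))) _ P mf f0 S).
- by move=> x x0; rewrite mulNr opprK; exact: D.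
- move=> x x0; rewrite divr_gt0// ?exprn_gt0 ?m0//.
  by rewrite oppr_gt0 lt_neqAle dt subr_eq0 det.
Qed.

(** * Tonelli's theorem on the quarter-plane *)

Section positive_integrals.
Context {R : realType}.
Notation mu := (@lebesgue_measure R).
Notation mR := (measurableTypeR R).
Notation I := (`]0%R, +oo[%classic : set R).

Let F0 (F : R -> R -> \bar R) : mR * mR -> \bar R :=
  (fun z => F z.1 z.2) \_ (I `*` I).

Let mF0 (F : R -> R -> \bar R) :
  measurable_fun setT (fun z : mR * mR => F z.1 z.2) ->
  measurable_fun setT (F0 F).
Proof.
move=> mF; apply/(measurable_restrictT _ _).1; last exact: measurable_funTS.
exact: measurableX.
Qed.

Let F0E F x : (\int[mu]_(y in I) F0 F (x, y) = ((fun x => \int[mu]_(y in I) F x y) \_ I) x)%E.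
Proof.
rewrite patchE; case: ifPn => xI.
  apply: eq_integral => y yI; rewrite /F0 patchE mem_set//.
  by split; rewrite /=; [move: xI|move: yI]; rewrite inE.
rewrite integral0_eq// => y _; rewrite /F0 patchE memNset// => -[/= h _].
by move/negP: xI; rewrite inE.
Qed.

Lemma measurable_integral_pos (F : R -> R -> \bar R) :
  measurable_fun setT (fun z : mR * mR => F z.1 z.2) ->
  (forall x y, (0 <= F x y)%E) ->
  measurable_fun setT (fun x : mR => \int[mu]_(y in I) F x y)%E.
Proof.
move=> mF F_ge0.
pose G : mR * mR -> \bar R := (fun z => F z.1 z.2) \_ (setT `*` I).
rewrite (_ : (fun x => _) = fubini_F mu G).
  apply: measurable_fun_fubini_tonelli_F.
    apply/(measurable_restrictT _ _).1; last exact: measurable_funTS.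
    exact: measurableX.
  by move=> z; apply: erestrict_ge0 => ? _.
apply/funext => x; rewrite /fubini_F [LHS]integral_mkcond; apply: eq_integral => y _.
rewrite /G !patchE/=; congr (if _ then _ else _).
by apply/idP/idP; rewrite !inE/=; [split|case].
Qed.

Lemma tonelli_pos (F : R -> R -> \bar R) :
  measurable_fun setT (fun z : mR * mR => F z.1 z.2) ->
  (forall x y, (0 <= F x y)%E) ->
  (\int[mu]_(x in I) \int[mu]_(y in I) F x y =
   \int[mu]_(y in I) \int[mu]_(x in I) F x y)%E.
Proof.
move=> mF F_ge0.
have H := @fubini_tonelli _ _ mR mR R mu mu (F0 F) (mF0 mF).
rewrite [LHS]integral_mkcond [RHS]integral_mkcond.
have E1 x : (((fun x => \int[mu]_(y in I) F x y) \_ I) x = \int[mu]_y F0 F (x, y))%E.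
  rewrite -F0E [LHS]integral_mkcond; apply: eq_integral => y _.
  rewrite patchE; case: ifPn => // yI; rewrite /F0 patchE memNset// => -[_ /= h].
  by move/negP: yI; rewrite inE.
have E2 y : (((fun y => \int[mu]_(x in I) F x y) \_ I) y = \int[mu]_x F0 F (x, y))%E.
  rewrite patchE; case: ifPn => yI.
    rewrite [LHS]integral_mkcond; apply: eq_integral => x _.
    rewrite /F0 !patchE; congr (if _ then _ else _).
    by apply/idP/idP; rewrite !inE/=; [split => //; move: yI; rewrite inE|case].
  rewrite integral0_eq// => x _; rewrite /F0 patchE memNset// => -[_ /= h].
  by move/negP: yI; rewrite inE.
under eq_integral do rewrite E1.
under [RHS]eq_integral do rewrite E2.
apply: H => z; exact: erestrict_ge0.
Qed.

End positive_integrals.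

(** * Elliptic integrals *)

Section rsqrt.
Context {R : realType}.
Implicit Types x y : R.

(** Zero at nonpositive arguments: a product of [rsqrt]s is supported where all
    the radicands are positive, so integrals over intervals bounded by branch
    points can be written over the whole half-line. *)
Definition rsqrt y : R := (Num.sqrt y)^-1.

Lemma rsqrt_ge0 y : 0 <= rsqrt y. Proof. by rewrite invr_ge0 sqrtr_ge0. Qed.

Lemma rsqrt_gt0 y : 0 < y -> 0 < rsqrt y.
Proof. by move=> y0; rewrite invr_gt0 sqrtr_gt0. Qed.

Lemma rsqrt_sqr y : 0 <= y -> rsqrt y ^+ 2 = y^-1.
Proof. by move=> y0; rewrite /rsqrt exprVn sqr_sqrtr. Qed.

Lemma rsqrt_le0 y : y <= 0 -> rsqrt y = 0.
Proof. by move=> y0; rewrite /rsqrt ler0_sqrtr// invr0. Qed.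

Lemma rsqrtM x y : 0 <= x -> rsqrt (x * y) = rsqrt x * rsqrt y.
Proof. by move=> x0; rewrite /rsqrt sqrtrM// invfM. Qed.

Lemma rsqrt1 : rsqrt 1 = 1.
Proof. by rewrite /rsqrt sqrtr1 invr1. Qed.

Lemma le_rsqrt x y : 0 < x -> x <= y -> rsqrt y <= rsqrt x.
Proof.
move=> x0 xy; rewrite /rsqrt lef_pV2 ?posrE ?sqrtr_gt0//; last exact: lt_le_trans xy.
exact: ler_wsqrtr.
Qed.

Lemma measurable_rsqrt : measurable_fun setT rsqrt.
Proof.
rewrite (_ : rsqrt = (fun x => Num.sqrt x `^ (-1))); last first.
  apply/funext => x; rewrite powRN powRr1 ?sqrtr_ge0//.
apply: (measurableT_comp (measurable_powR _)).
by apply: continuous_measurable_fun; exact: sqrt_continuous.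
Qed.

Lemma measurable_rsqrt_comp d (T : measurableType d) (f : T -> R) :
  measurable_fun setT f -> measurable_fun setT (fun t => rsqrt (f t)).
Proof. exact: (measurableT_comp measurable_rsqrt). Qed.

Lemma eq_sqr_ge0 x y : 0 <= x -> 0 <= y -> x ^+ 2 = y ^+ 2 -> x = y.
Proof. by move=> x0 y0 /eqP; rewrite eqrXn2// => /eqP. Qed.

End rsqrt.

(** Measurability of algebraic expressions in [rsqrt]. *)
Ltac msolve := repeat lazymatch goal with
  | |- measurable_fun _ (fun x => EFin (@?f x)) => apply/measurable_EFinP
  | |- measurable_fun _ (fun x => rsqrt (@?f x)) => apply: measurable_rsqrt_comp
  | |- measurable_fun _ (fun x => @GRing.mul _ (@?f x) (@?g x)) => apply: measurable_funM
  | |- measurable_fun _ (fun x => @Algebra.add _ (@?f x) (@Algebra.opp _ (@?g x))) => apply: measurable_funB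
  | |- measurable_fun _ (fun x => @Algebra.add _ (@?f x) (@?g x)) => apply: measurable_funD
  | |- measurable_fun _ (fun x => @GRing.exp _ (@?f x) _) => apply: measurable_funX
  | |- measurable_fun _ rsqrt => exact: measurable_rsqrt
  | |- measurable_fun _ (@Algebra.add _ ?c) => apply: (@measurable_funD _ _ _ _ (cst c) id)
  | |- measurable_fun _ (@GRing.mul _ ?c) => apply: (@measurable_funM _ _ _ _ (cst c) id)
  | |- measurable_fun _ fst => exact: measurable_fst
  | |- measurable_fun _ snd => exact: measurable_snd
  | |- measurable_fun _ id => exact: measurable_id
  | |- measurable_fun _ (cst _) => exact: measurable_cst
  | |- measurable_fun _ (fun x => x.1) => exact: measurable_fst
  | |- measurable_fun _ (fun x => x.2) => exact: measurable_snd
  | |- measurable_fun _ (fun x => x) => exact: measurable_id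
  | |- measurable_fun _ (fun x => ?c) => exact: measurable_cst
  | |- _ => assumption
  end.

(** Positivity of algebraic expressions in [rsqrt]. *)
Ltac posgoal := repeat match goal with
  | |- is_true (0 <= _ * _) => apply: mulr_ge0
  | |- is_true (0 <= _ + _) => apply: addr_ge0
  | |- is_true (0 <= _^-1) => rewrite invr_ge0
  | |- is_true (0 <= _ ^+ _) => apply: exprn_ge0
  | |- is_true (0 <= rsqrt _) => exact: rsqrt_ge0
  | |- is_true (0 <= _) => first [assumption | apply: ltW; assumption | done]
  | |- is_true (0 < _ * _) => apply: mulr_gt0
  | |- is_true (0 < _ + _) => apply: addr_gt0
  | |- is_true (0 < _^-1) => rewrite invr_gt0
  | |- is_true (0 < _ ^+ _) => apply: exprn_gt0
  | |- is_true (0 < rsqrt _) => apply: rsqrt_gt0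
  | |- is_true (0 < _) => first [assumption | done]
  end.

Section ellint.
Context {R : realType}.
Notation mu := (@lebesgue_measure R).
Notation mR := (mreal R).
Notation I := (`]0%R, +oo[%classic : set R).
Implicit Types a b c k : R.

(** Twice the integral of du / sqrt ((u^2 + a) (u^2 + b)), that is pi divided by
    the arithmetic-geometric mean of sqrt a and sqrt b. In the variable w = u^2
    the classical substitutions become homographies. *)
Definition ellint a b : \bar R :=
  (\int[mu]_(w in I) (rsqrt w * rsqrt (w + a) * rsqrt (w + b))%:E)%E.

Lemma ellint_ge0 a b : (0 <= ellint a b)%E.
Proof.
by apply: integral_ge0 => w _; rewrite lee_fin !mulr_ge0// rsqrt_ge0.
Qed.

Lemma ellintC a b : ellint a b = ellint b a.
Proof. by apply: eq_integral => w _; rewrite mulrAC. Qed.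

Lemma measurable_ellint (f g : R -> R) :
  measurable_fun setT (f : mR -> R) -> measurable_fun setT (g : mR -> R) ->
  measurable_fun setT (fun x : mR => ellint (f x) (g x)).
Proof.
move=> mf mg.
apply: (measurable_integral_pos
  (F := fun x w => (rsqrt w * rsqrt (w + f x) * rsqrt (w + g x))%:E)).
  have mf1 : measurable_fun setT (fun z : mR * mR => f z.1).
    by apply: (measurableT_comp mf); exact: measurable_fst.
  have mg1 : measurable_fun setT (fun z : mR * mR => g z.1).
    by apply: (measurableT_comp mg); exact: measurable_fst.
  by msolve.
by move=> x w; rewrite lee_fin !mulr_ge0// rsqrt_ge0.
Qed.

Lemma eq_integral_pos (f g : R -> \bar R) : (forall x, 0 < x -> f x = g x) ->
  (\int[mu]_(x in I) f x = \int[mu]_(x in I) g x)%E.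
Proof.
by move=> fg; apply: eq_integral => x; rewrite inE/= in_itv/= andbT => /fg->.
Qed.

Lemma ellint_scale c a b : 0 < c -> ellint (c * a) (c * b) = ((rsqrt c)%:E * ellint a b)%E.
Proof.
move=> c0; rewrite {1}/ellint (@cov_mobius _ c 0 0 1)//.
- rewrite /ellint -ge0_integralZl//; last 3 first.
  + by apply: measurable_funTS; msolve.
  + by move=> w _; rewrite lee_fin !mulr_ge0// rsqrt_ge0.
  + by rewrite lee_fin rsqrt_ge0.
  apply: eq_integral => w _.
  rewrite !mul0r !add0r !addr0 !mulr1 subr0 expr1n !divr1 -!mulrDr.
  rewrite !rsqrtM ?(ltW c0)// -!EFinM (gtr0_norm c0).
  have E : rsqrt c ^+ 2 * c = 1 by rewrite rsqrt_sqr ?(ltW c0)// mulVf// gt_eqF.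
  congr EFin; rewrite -[RHS]mulr1 -E; ring.
- exact: ltW.
- by rewrite mulr1 mul0r gt_eqF.
- by msolve.
- by move=> w; rewrite lee_fin !mulr_ge0// rsqrt_ge0.
- move=> y y0; left; exists (y / c); first exact: divr_gt0.
  by field; rewrite gt_eqF.
Qed.

Lemma cov_mobiusR (a b c d : R) (g : R -> R) :
  0 <= a -> 0 <= b -> 0 <= c -> 0 <= d -> a * d != b * c ->
  measurable_fun setT (g : mR -> R) -> (forall y, 0 <= g y) ->
  (forall y : R, 0 < y -> (exists2 x, 0 < x & (a * x + b) / (c * x + d) = y) \/ g y = 0) ->
  (\int[mu]_(y in I) (g y)%:E =
   \int[mu]_(x in I)
     (g ((a * x + b) / (c * x + d)) * (`|a * d - b * c| / (c * x + d) ^+ 2))%:E)%E.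
Proof.
move=> a0 b0 c0 d0 det mg g0 S.
rewrite (@cov_mobius _ a b c d (EFin \o g))//; first exact/measurable_EFinP.
by move=> y /S[h|h]; [left|right; rewrite /= h].
Qed.

Let rsqrt3_ge0 x y z : 0 <= rsqrt x * rsqrt y * rsqrt z :> R.
Proof. by rewrite !mulr_ge0// rsqrt_ge0. Qed.

(** The four integrals that follow join consecutive branch points of an elliptic
    curve; a homography sends each to the standard form. Here p = x/(v + 1). *)
Lemma ellint_below (x : R) : 0 < x ->
  (\int[mu]_(p in I) (rsqrt p * rsqrt (1 + p) * rsqrt (x - p))%:E =
   ellint (1 + x) 1)%E.
Proof.
move=> x0; rewrite (@cov_mobiusR 0 x 1 1)// ?(ltW x0)//.
- apply: eq_integral_pos => v v0; congr EFin; have v1 : v + 1 != 0 by lra.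
  rewrite !mul0r add0r !mul1r sub0r normrN mulr1 (gtr0_norm x0).
  apply: eq_sqr_ge0; rewrite ?mulr_ge0 ?invr_ge0 ?rsqrt_ge0 ?sqr_ge0 ?(ltW x0)//.
  rewrite !exprMn (_ : x - x / (v + 1) = x * v / (v + 1)); last by field.
  rewrite (_ : 1 + x / (v + 1) = (v + (1 + x)) / (v + 1)); last by field.
  have h1 : 0 < v + 1 by lra.
  have h2 : 0 < v + (1 + x) by lra.
  rewrite !rsqrt_sqr ?divr_ge0 ?mulr_ge0 ?(ltW x0) ?(ltW v0) ?(ltW h1) ?(ltW h2)//.
  by field; rewrite v1 !gt_eqF.
- by rewrite mul0r mulr1 eq_sym gt_eqF.
- by msolve.
- move=> y y0; have [yx|xy] := ltP y x; last by right; rewrite (@rsqrt_le0 _ (x - y)) ?subr_le0 ?mulr0.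
  left; exists ((x - y) / y); first by rewrite divr_gt0 ?subr_gt0.
  by field; apply/andP; split; lra.
Qed.

Lemma ellint_above (x : R) : 0 < x ->
  (\int[mu]_(p in I) (rsqrt p * rsqrt (1 + p) * rsqrt (p - x))%:E =
   ellint (1 + x) x)%E.
Proof.
move=> x0; rewrite (@cov_mobiusR 1 x 0 1)// ?(ltW x0)//.
- apply: eq_integral_pos => v v0; congr EFin.
  rewrite !mul0r !mul1r !add0r mulr0 subr0 normr1 expr1n !divr1 mulr1 addrK.
  by rewrite (addrC 1 (v + x)) -(addrA v x 1) (addrC x 1) mulrC mulrA mulrAC.
- by rewrite mulr1 mulr0 oner_neq0.
- by msolve.
- move=> y y0; have [yx|xy] := ltP x y; last by right; rewrite (@rsqrt_le0 _ (y - x)) ?subr_le0 ?mulr0.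
  left; exists (y - x); first by rewrite subr_gt0.
  by rewrite mul0r add0r mul1r divr1 subrK.
Qed.

Lemma ellint_between (k : R) : 0 < k -> k < 1 ->
  (\int[mu]_(x in I) (rsqrt x * rsqrt (x - k) * rsqrt (1 - x))%:E = ellint 1 k)%E.
Proof.
move=> k0 k1; rewrite (@cov_mobiusR 1 k 1 1)// ?(ltW k0)//.
- apply: eq_integral_pos => w w0; congr EFin; have w1 : w + 1 != 0 by lra.
  rewrite !mul1r mulr1 ger0_norm; last by lra.
  apply: eq_sqr_ge0; rewrite ?mulr_ge0 ?invr_ge0 ?rsqrt_ge0 ?sqr_ge0//; first by lra.
  rewrite !exprMn (_ : (w + k) / (w + 1) - k = w * (1 - k) / (w + 1)); last by field.
  rewrite (_ : 1 - (w + k) / (w + 1) = (1 - k) / (w + 1)); last by field.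
  have h1 : 0 < w + 1 by lra.
  have h2 : 0 < w + k by lra.
  have h3 : 0 < 1 - k by lra.
  rewrite !rsqrt_sqr ?divr_ge0 ?mulr_ge0 ?(ltW w0) ?(ltW h1) ?(ltW h2) ?(ltW h3)//.
  by field; rewrite !gt_eqF.
- by rewrite !mulr1 gt_eqF.
- by msolve.
- move=> y y0; have [yk|yk] := leP y k.
    by right; rewrite (@rsqrt_le0 _ (y - k)) ?subr_le0 ?mulr0 ?mul0r.
  have [y1|y1] := leP 1 y.
    by right; rewrite (@rsqrt_le0 _ (1 - y)) ?subr_le0 ?mulr0 ?mul0r.
  left; exists ((y - k) / (1 - y)); first by rewrite divr_gt0 ?subr_gt0.
  have h1 : 1 - y != 0 by lra.
  have h2 : 1 - k != 0 by lra.
  by field; rewrite h1 /=; apply/eqP; lra.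
Qed.

Lemma ellint_between_ge1 (k : R) : 1 <= k ->
  (\int[mu]_(x in I) (rsqrt x * rsqrt (x - k) * rsqrt (1 - x))%:E = 0)%E.
Proof.
move=> k1; apply: integral0_eq => x _; congr EFin.
have [xk|xk] := leP x k; first by rewrite (@rsqrt_le0 _ (x - k)) ?subr_le0 ?mulr0 ?mul0r.
by rewrite (@rsqrt_le0 _ (1 - x)) ?mulr0// subr_le0 (le_trans k1)// ltW.
Qed.

Lemma ellint_beyond (k : R) : 0 < k -> k < 1 ->
  (\int[mu]_(x in I) (rsqrt x * rsqrt (x - k) * rsqrt (x - 1))%:E = ellint 1 (1 - k))%E.
Proof.
move=> k0 k1; rewrite (@cov_mobiusR 1 1 0 1)//.
- apply: eq_integral_pos => v v0; congr EFin.
  rewrite !mul0r !mul1r !add0r subr0 normr1 expr1n !divr1 mulr1 addrK.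
  by rewrite -(addrA v 1 (- k)) mulrC mulrA.
- by rewrite mulr1 mulr0 oner_neq0.
- by msolve.
- move=> y y0; have [yx|xy] := ltP 1 y; last by right; rewrite (@rsqrt_le0 _ (y - 1)) ?subr_le0 ?mulr0.
  left; exists (y - 1); first by rewrite subr_gt0.
  by rewrite mul0r add0r mul1r divr1 subrK.
Qed.

End ellint.

(** * Relations between moments of elliptic integrals *)

Section moments.
Context {R : realType}.
Notation mu := (@lebesgue_measure R).
Notation mR := (mreal R).
Notation I := (`]0%R, +oo[%classic : set R).
Implicit Types a b c k : R.

Let rsqrt3_ge0 (x y z : R) : 0 <= rsqrt x * rsqrt y * rsqrt z.
Proof. by rewrite !mulr_ge0// rsqrt_ge0. Qed.

Lemma cov_scale c (f : R -> \bar R) : 0 < c ->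
  measurable_fun setT (f : mR -> \bar R) -> (forall y, (0 <= f y)%E) ->
  (\int[mu]_(y in I) f y = \int[mu]_(x in I) (f (c * x)%R * c%:E))%E.
Proof.
move=> c0 mf f0; rewrite (@cov_mobius _ c 0 0 1)//.
- apply: eq_integral_pos => x x0.
  by rewrite addr0 mul0r add0r divr1 mulr1 mul0r subr0 expr1n divr1 gtr0_norm.
- exact: ltW.
- by rewrite mulr1 mul0r gt_eqF.
- move=> y y0; left; exists (y / c); first exact: divr_gt0.
  by rewrite mul0r add0r divr1 addr0 mulrC divfK ?gt_eqF.
Qed.

Lemma cov_inversion c (f : R -> \bar R) : 0 < c ->
  measurable_fun setT (f : mR -> \bar R) -> (forall y, (0 <= f y)%E) ->
  (\int[mu]_(y in I) f y = \int[mu]_(x in I) (f (c / x)%R * (c / x ^+ 2)%:E))%E.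
Proof.
move=> c0 mf f0; rewrite (@cov_mobius _ 0 c 1 0)//.
- apply: eq_integral_pos => x x0.
  by rewrite mul0r add0r mul1r addr0 mulr1 mul0r sub0r normrN gtr0_norm.
- exact: ltW.
- by rewrite mul0r mulr1 lt_eqF.
- move=> y y0; left; exists (c / y); first exact: divr_gt0.
  by field; rewrite !gt_eqF.
Qed.

Lemma ellint_1scale k : 0 < k -> ellint 1 k = ((rsqrt k)%:E * ellint 1 k^-1)%E.
Proof.
move=> k0; rewrite -ellint_scale// mulr1 mulfV ?gt_eqF//; exact: ellintC.
Qed.

(** Only e = -1 and e = 1 occur. For 0 < k < 1 the integrand is then supported on
    ]k, 1[ and on ]1, oo[ respectively. *)
Definition chord (e k : R) : \bar R :=
  (\int[mu]_(x in I) (rsqrt x * rsqrt (x - k) * rsqrt (e * (x - 1)))%:E)%E.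

Lemma chord_ge0 e k : (0 <= chord e k)%E.
Proof. by apply: integral_ge0 => x _; rewrite lee_fin. Qed.

Lemma measurable_chord e : measurable_fun setT (chord e : mR -> \bar R).
Proof.
apply: (measurable_integral_pos
  (F := fun k x => (rsqrt x * rsqrt (x - k) * rsqrt (e * (x - 1)))%:E)).
  by msolve.
by move=> x w; rewrite lee_fin.
Qed.

Lemma chord_scale e k r : 0 < r ->
  (\int[mu]_(x in I) (rsqrt x * rsqrt (x - k * r) * rsqrt (e * (x - r)))%:E
   = (rsqrt r)%:E * chord e k)%E.
Proof.
move=> r0; rewrite (@cov_scale r)//; last 2 first.
- by msolve.
- by move=> y; rewrite lee_fin.
rewrite /chord -ge0_integralZl//; last 3 first.
- by apply: measurable_funTS; msolve.
- by move=> x _; rewrite lee_fin.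
- by rewrite lee_fin rsqrt_ge0.
apply: eq_integral => x _.
have -> : r * x - k * r = r * (x - k) by ring.
have -> : e * (r * x - r) = r * (e * (x - 1)) by ring.
rewrite !(rsqrtM _ (ltW r0)) -!EFinM; congr EFin.
have E : rsqrt r ^+ 2 * r = 1 by rewrite rsqrt_sqr ?(ltW r0)// mulVf// gt_eqF.
rewrite -[RHS]mulr1 -E; ring.
Qed.

(** With G the integral in p, restricted to p < x by the last factor, and with
    the second factor an integral in r, Tonelli makes x the inner variable.
    Scaling x by r and putting p = k r separates the triple integral: the
    x-integral depends on k alone, and the r-integral is [ellint 1 k]. *)
Lemma unfold_product e :
  (\int[mu]_(x in I) ((rsqrt x)%:E *
     ((\int[mu]_(p in I) (rsqrt p * rsqrt (1 + p) * rsqrt (x - p))%:E) *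
      (\int[mu]_(r in I) (rsqrt r * rsqrt (1 + r) * rsqrt (e * (x - r)))%:E)))
   = \int[mu]_(k in I) ((rsqrt k)%:E * (chord e k * ellint 1 k)))%E.
Proof.
pose A x p : R := rsqrt p * rsqrt (1 + p) * rsqrt (x - p).
pose B x r : R := rsqrt r * rsqrt (1 + r) * rsqrt (e * (x - r)).
have A0 x p : 0 <= A x p by exact: rsqrt3_ge0.
have B0 x p : 0 <= B x p by exact: rsqrt3_ge0.
have s0 x : 0 <= rsqrt x :> R by exact: rsqrt_ge0.
pose GA x := (\int[mu]_(p in I) (A x p)%:E)%E.
have GA0 x : (0 <= GA x)%E by apply: integral_ge0 => p _; rewrite lee_fin.
have mA : measurable_fun setT (fun z : mR * mR => (A z.1 z.2)%:E) by rewrite /A; msolve.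
have mGA : measurable_fun setT (GA : mR -> \bar R).
  by apply: (measurable_integral_pos (F := fun x p => (A x p)%:E)) => // x p; rewrite lee_fin.
have mB : measurable_fun setT (fun z : mR * mR => (B z.1 z.2)%:E) by rewrite /B; msolve.
transitivity (\int[mu]_(x in I) \int[mu]_(r in I) ((rsqrt x * B x r)%:E * GA x))%E.
  apply: eq_integral => x _.
  rewrite ge0_integralZr//; last 2 first.
  - by apply: measurable_funTS; rewrite /B; msolve.
  - by move=> r _; rewrite lee_fin mulr_ge0.
  under eq_integral do rewrite EFinM.
  rewrite ge0_integralZl//; last 3 first.
  - by apply: measurable_funTS; rewrite /B; msolve.
  - by move=> r _; rewrite lee_fin.
  - by rewrite lee_fin.
  by rewrite -muleA; congr (_ * _)%E; rewrite muleC.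
rewrite (tonelli_pos (F := fun x r => ((rsqrt x * B x r)%:E * GA x)%E)); last 2 first.
- apply: emeasurable_funM; first by rewrite /B; msolve.
  by apply: (measurableT_comp mGA); exact: measurable_fst.
- by move=> x r; rewrite mule_ge0// lee_fin mulr_ge0.
pose phi k r : R := rsqrt k * (rsqrt r * rsqrt (1 + r) * rsqrt (1 + k * r)).
have phi0 k r : 0 <= phi k r by rewrite mulr_ge0.
transitivity (\int[mu]_(r in I) \int[mu]_(k in I) ((phi k r)%:E * chord e k))%E.
  apply: eq_integral_pos => r r0.
  transitivity (\int[mu]_(x in I) \int[mu]_(p in I) (rsqrt x * B x r * A x p)%:E)%E.
    apply: eq_integral => x _; under [RHS]eq_integral do rewrite EFinM.
    rewrite ge0_integralZl//.
    - by apply: measurable_funTS; rewrite /A; msolve.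
    - by move=> p _; rewrite lee_fin.
    - by rewrite lee_fin mulr_ge0.
  have mF : measurable_fun setT (fun z : mR * mR => (rsqrt z.1 * B z.1 r * A z.1 z.2)%:E).
    by rewrite /A /B; msolve.
  rewrite (tonelli_pos (F := fun x p => (rsqrt x * B x r * A x p)%:E))//; last first.
    by move=> x p; rewrite lee_fin !mulr_ge0.
  rewrite (@cov_scale r)//; last 2 first.
  - apply: (measurable_integral_pos (F := fun p x => (rsqrt x * B x r * A x p)%:E)).
      by rewrite /A /B; msolve.
    by move=> x p; rewrite lee_fin !mulr_ge0.
  - by move=> p; apply: integral_ge0 => x _; rewrite lee_fin !mulr_ge0.
  apply: eq_integral_pos => k k0.
  transitivity (((rsqrt r * rsqrt (1 + r) * (rsqrt (k * r) * rsqrt (1 + k * r)))%:E *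
    ((rsqrt r)%:E * chord e k)) * r%:E)%E.
    rewrite -chord_scale// -ge0_integralZl//; last 3 first.
    - by apply: measurable_funTS; msolve.
    - by move=> x _; rewrite lee_fin.
    - by rewrite lee_fin !mulr_ge0.
    congr (_ * _)%E; apply: eq_integral => x _.
    by rewrite -EFinM /A /B (mulrC r k); congr EFin; ring.
  rewrite !muleA -!EFinM muleAC -EFinM; congr (_%:E * _)%E.
  rewrite rsqrtM ?(ltW k0)// /phi.
  have E : rsqrt r ^+ 2 * r = 1 by rewrite rsqrt_sqr ?(ltW r0)// mulVf// gt_eqF.
  rewrite -[RHS]mulr1 -E; ring.
rewrite (tonelli_pos (F := fun r k => ((phi k r)%:E * chord e k)%E)); last 2 first.
- apply: emeasurable_funM; first by rewrite /phi; msolve.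
  by apply: (measurableT_comp (measurable_chord e)); exact: measurable_snd.
- by move=> r k; rewrite mule_ge0 ?chord_ge0// lee_fin.
apply: eq_integral_pos => k k0.
rewrite ge0_integralZr//; last 3 first.
- by apply: measurable_funTS; rewrite /phi; msolve.
- by move=> r _; rewrite lee_fin.
- exact: chord_ge0.
rewrite /phi; under eq_integral do rewrite EFinM.
rewrite ge0_integralZl//; last 3 first.
- by apply: measurable_funTS; msolve.
- by move=> r _; rewrite lee_fin.
- by rewrite lee_fin.
rewrite -muleA; congr (_ * _)%E; rewrite muleC; congr (_ * _)%E.
rewrite ellint_1scale// /ellint -ge0_integralZl//; last 3 first.
- by apply: measurable_funTS; msolve.
- by move=> w _; rewrite lee_fin.
- by rewrite lee_fin.
apply: eq_integral => r _; rewrite -EFinM; congr EFin.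
rewrite (_ : 1 + k * r = k * (r + k^-1)); last by field; rewrite gt_eqF.
rewrite rsqrtM ?(ltW k0)// (addrC 1 r); ring.
Qed.

End moments.

Section symmetric_moments.
Context {R : realType}.
Notation mu := (@lebesgue_measure R).
Notation mR := (mreal R).
Notation I := (`]0%R, +oo[%classic : set R).
Implicit Types a b c k : R.

Lemma integral_pos_sub (J : set R) (f : R -> \bar R) : J `<=` I ->
  (\int[mu]_(x in J) f x = \int[mu]_(x in I) (f \_ J) x)%E.
Proof. by move=> JI; rewrite -integral_mkcondr setIidr. Qed.

Lemma inversion_halves c (F : R -> \bar R) : 0 < c ->
  measurable_fun setT (F : mR -> \bar R) -> (forall y, (0 <= F y)%E) ->
  (forall v : R, 0 < v -> (F (c ^+ 2 / v)%R * (c ^+ 2 / v ^+ 2)%:E)%E = F v) ->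
  (\int[mu]_(v in `]c, +oo[) F v = \int[mu]_(v in `]0%R, c[) F v)%E.
Proof.
move=> c0 mF F0 FE.
have c20 : 0 < c ^+ 2 by rewrite exprn_gt0.
rewrite integral_pos_sub; last first.
  by move=> x /=; rewrite !in_itv/= !andbT; exact: lt_trans.
rewrite [RHS]integral_pos_sub; last first.
  by move=> x /=; rewrite !in_itv/= andbT => /andP[].
rewrite (cov_inversion c20); last 2 first.
- by apply/(measurable_restrictT _ _).1 => //; exact: measurable_funTS.
- by move=> y; exact: erestrict_ge0.
apply: eq_integral_pos => v v0; rewrite !patchE.
have -> : (c ^+ 2 / v \in `]c, +oo[%classic) = (v \in `]0, c[%classic).
  apply/idP/idP; rewrite !inE/= !in_itv/= andbT v0/= expr2 ltr_pdivlMr//.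
    by rewrite ltr_pM2l.
  by move=> h; rewrite ltr_pM2l.
by case: ifPn => _; rewrite ?mul0e// FE.
Qed.

Lemma integral_pos_halves c (F : R -> \bar R) : 0 < c ->
  measurable_fun setT (F : mR -> \bar R) -> (forall y, (0 <= F y)%E) ->
  (\int[mu]_(v in I) F v = \int[mu]_(v in `]0%R, c[) F v + \int[mu]_(v in `]c, +oo[) F v)%E.
Proof.
move=> c0 mF F0.
rewrite (@integral_itv_obnd_cbnd _ c); last exact: measurable_funTS.
rewrite -ge0_integral_setU//=.
- congr integral; rewrite -itv_bndbnd_setU// ?bnd_simp//; exact: ltW.
- exact: measurable_funTS.
- apply/disj_setPS => x /= []; rewrite !in_itv/= andbT => /andP[_ xc] cx.
  by move: (lt_le_trans xc cx); rewrite ltxx.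
Qed.

(** Invariance of F(v) dv under v -> c^2/v exchanges the two sides of the fixed
    point c. *)
Lemma inversion_double c (F : R -> \bar R) : 0 < c ->
  measurable_fun setT (F : mR -> \bar R) -> (forall y, (0 <= F y)%E) ->
  (forall v : R, 0 < v -> (F (c ^+ 2 / v)%R * (c ^+ 2 / v ^+ 2)%:E)%E = F v) ->
  (\int[mu]_(v in I) F v = 2%:E * \int[mu]_(v in `]0%R, c[) F v)%E.
Proof.
move=> c0 mF F0 FE; rewrite (@integral_pos_halves c)// inversion_halves//.
by rewrite -mule2n mule_natl.
Qed.

(** The two periods of w (w + 1 + x) (w + 1) and w (w + 1 + x) (w + x); they are
    proportional to theta_4^2 and t theta_4^2 when x = X(t). *)
Definition ellG (x : R) := ellint (1 + x) 1.
Definition ellH (x : R) := ellint (1 + x) x.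

Lemma measurable_ellG : measurable_fun setT (ellG : mR -> \bar R).
Proof. by apply: measurable_ellint; msolve. Qed.
Lemma measurable_ellH : measurable_fun setT (ellH : mR -> \bar R).
Proof. by apply: measurable_ellint; msolve. Qed.

Lemma ellH_inv x : 0 < x -> (ellH x^-1 = (rsqrt x^-1)%:E * ellG x)%E.
Proof.
move=> x0; rewrite /ellH /ellG -ellint_scale ?invr_gt0//.
by rewrite mulr1 mulrDr mulr1 mulVf ?gt_eqF// addrC.
Qed.

Lemma measurable_rsqrtE (f : R -> \bar R) : measurable_fun setT (f : mR -> \bar R) ->
  measurable_fun setT ((fun x => (rsqrt x)%:E * f x)%E : mR -> \bar R).
Proof. by move=> mf; apply: emeasurable_funM => //; msolve. Qed.

Lemma mule_gather a b b' c (g h : \bar R) :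
  (a%:E * ((b%:E * g) * (b'%:E * h)) * c%:E = (a * b * b' * c)%:E * (g * h))%E.
Proof.
rewrite muleACA -(EFinM b b') (muleA a%:E) -EFinM -(muleA _ (g * h)%E).
by rewrite (muleC (g * h)%E) (muleA _ c%:E) -EFinM -!mulrA.
Qed.

(** The inversion x -> 1/x exchanges the two periods up to [rsqrt x]. *)
Lemma moment_HH_GG :
  (\int[mu]_(x in I) ((rsqrt x)%:E * (ellH x * ellH x)) =
   \int[mu]_(x in I) ((rsqrt x)%:E * (ellG x * ellG x)))%E.
Proof.
rewrite (@cov_inversion _ 1)//; last 2 first.
- by apply: measurable_rsqrtE; apply: emeasurable_funM; exact: measurable_ellH.
- by move=> y; rewrite !mule_ge0 ?ellint_ge0// lee_fin rsqrt_ge0.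
apply: eq_integral_pos => x x0; rewrite div1r ellH_inv//.
rewrite mule_gather; congr (_%:E * _)%E.
have V0 : 0 < x^-1 by rewrite invr_gt0.
have s0 := ltW (rsqrt_gt0 V0).
have s1 := ltW (rsqrt_gt0 x0).
rewrite ?mulrA; apply: eq_sqr_ge0 => //; first by rewrite !mulr_ge0// invr_ge0 sqr_ge0.
rewrite !exprMn !rsqrt_sqr ?(ltW x0) ?(ltW V0)//.
by field; rewrite gt_eqF.
Qed.

(** Here p < x < r, so k = p/r stays below 1 and the inner integral runs between
    two finite branch points. *)
Lemma moment_GH :
  (\int[mu]_(x in I) ((rsqrt x)%:E * (ellG x * ellH x)) =
   \int[mu]_(k in `]0%R, 1%R[) ((rsqrt k)%:E * (ellint 1 k * ellint 1 k)))%E.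
Proof.
transitivity (\int[mu]_(k in I) ((rsqrt k)%:E * (chord (-1) k * ellint 1 k)))%E.
  rewrite -unfold_product; apply: eq_integral_pos => x x0.
  rewrite (ellint_below x0) /ellG /ellH; congr (_ * (_ * _))%E.
  rewrite -ellint_above//; apply: eq_integral => p _.
  by rewrite mulN1r opprB.
rewrite [RHS]integral_pos_sub; last by move=> x /=; rewrite !in_itv/= andbT => /andP[].
apply: eq_integral_pos => k k0; rewrite patchE.
have E : chord (-1) k = (\int[mu]_(x in I) (rsqrt x * rsqrt (x - k) * rsqrt (1 - x))%:E)%E.
  by apply: eq_integral => x _; rewrite mulN1r opprB.
case: ifPn; rewrite ?inE ?notin_setE/= in_itv/= k0/= => k1.
  by rewrite E ellint_between.
by rewrite E ellint_between_ge1 ?mul0e ?mule0// leNgt; apply/negP.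
Qed.

Lemma chord1_inv k : 0 < k -> (chord 1 k = (rsqrt k)%:E * chord 1 k^-1)%E.
Proof.
move=> k0; rewrite -chord_scale//; apply: eq_integral => x _.
by rewrite mulVf ?gt_eqF// !mul1r mulrAC.
Qed.

(** Here p and r are both below x. Exchanging p and r is k -> 1/k, hence the
    factor 2. *)
Lemma moment_GG :
  (\int[mu]_(x in I) ((rsqrt x)%:E * (ellG x * ellG x)) =
   2%:E * \int[mu]_(k in `]0%R, 1%R[) ((rsqrt k)%:E * (ellint 1 (1 - k) * ellint 1 k)))%E.
Proof.
transitivity (\int[mu]_(k in I) ((rsqrt k)%:E * (chord 1 k * ellint 1 k)))%E.
  rewrite -unfold_product; apply: eq_integral_pos => x x0.
  rewrite (ellint_below x0) /ellG; congr (_ * (_ * _))%E.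
  rewrite -(ellint_below x0); apply: eq_integral => p _.
  by rewrite mul1r.
have m1 : measurable_fun setT (ellint 1 : mR -> \bar R) by apply: measurable_ellint; msolve.
rewrite (@inversion_double 1 (fun k => ((rsqrt k)%:E * (chord 1 k * ellint 1 k))%E) ltr01).
- apply: (congr1 (mule 2%:E)); apply: eq_integral => k.
  rewrite inE/= in_itv/= => /andP[k0 k1].
  rewrite (_ : chord 1 k = ellint 1 (1 - k))// -(ellint_beyond k0 k1).
  by apply: eq_integral => x _; rewrite mul1r.
- apply: measurable_rsqrtE; apply: emeasurable_funM => //; exact: measurable_chord.
- move=> y; apply: mule_ge0; first by rewrite lee_fin rsqrt_ge0.
  by apply: mule_ge0; [exact: chord_ge0|exact: ellint_ge0].
- move=> v v0; rewrite expr1n div1r (chord1_inv v0) (ellint_1scale v0).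
  rewrite muleAC -EFinM -[RHS]mule1 [RHS]mule_gather; congr (_%:E * _)%E.
  have V0 : 0 < v^-1 by rewrite invr_gt0.
  have s0 := ltW (rsqrt_gt0 V0).
  have s1 := ltW (rsqrt_gt0 v0).
  apply: eq_sqr_ge0; rewrite ?mulr_ge0 ?invr_ge0 ?sqr_ge0//.
  rewrite !exprMn !rsqrt_sqr ?(ltW v0) ?(ltW V0)//.
  by field; rewrite gt_eqF.
Qed.

End symmetric_moments.

(** * Landen's transformation and bounds for elliptic integrals *)

Section landen.
Context {R : realType}.
Notation mu := (@lebesgue_measure R).
Notation mR := (mreal R).
Notation I := (`]0%R, +oo[%classic : set R).
Implicit Types a b c k : R.

Let rsqrt3_ge0 (x y z : R) : 0 <= rsqrt x * rsqrt y * rsqrt z.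
Proof. by rewrite !mulr_ge0// rsqrt_ge0. Qed.

Lemma integral_shift c (F : R -> \bar R) : 0 < c ->
  measurable_fun setT (F : mR -> \bar R) -> (forall y, (0 <= F y)%E) ->
  (\int[mu]_(v in `]c, +oo[) F v = \int[mu]_(y in I) F (y + c)%R)%E.
Proof.
move=> c0 mF F0.
rewrite integral_pos_sub; last first.
  by move=> x /=; rewrite !in_itv/= !andbT; exact: lt_trans.
rewrite (@cov_mobius _ 1 c 0 1)// ?(ltW c0)//; last 4 first.
- by rewrite mulr0 mulr1 oner_neq0.
- by apply/(measurable_restrictT _ _).1 => //; exact: measurable_funTS.
- by move=> y; exact: erestrict_ge0.
- move=> y y0; rewrite patchE; case: ifPn; last by right.
  rewrite inE/= in_itv/= andbT => cy; left; exists (y - c); rewrite ?subr_gt0//.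
  by rewrite mul1r mul0r add0r divr1 subrK.
apply: eq_integral_pos => v v0.
rewrite mul1r !mul0r add0r mulr1 mulr0 subr0 normr1 expr1n !divr1 mule1 patchE ifT//.
by rewrite inE/= in_itv/= andbT ltrDr.
Qed.

(** The involution w -> (a b)^2 / w permutes the branch points 0, -a^2, -b^2,
    oo. *)
Lemma ellint_sqr_inversion a b v : 0 < a -> 0 < b -> 0 < v ->
  let F w := rsqrt w * rsqrt (w + a ^+ 2) * rsqrt (w + b ^+ 2) in
  ((F ((a * b) ^+ 2 / v))%:E * ((a * b) ^+ 2 / v ^+ 2)%:E = (F v)%:E)%E.
Proof.
move=> a0 b0 v0 F; rewrite -EFinM /F; congr EFin.
have c0 : 0 < a * b by rewrite mulr_gt0.
have v1 := ltW v0.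
apply: eq_sqr_ge0; [by posgoal|by posgoal|].
have h1 : v + a ^+ 2 != 0 by rewrite gt_eqF// addr_gt0// exprn_gt0.
have h2 : v + b ^+ 2 != 0 by rewrite gt_eqF// addr_gt0// exprn_gt0.
have E1 : (a * b) ^+ 2 / v + a ^+ 2 = a ^+ 2 * (v + b ^+ 2) / v.
  by field; rewrite gt_eqF.
have E2 : (a * b) ^+ 2 / v + b ^+ 2 = b ^+ 2 * (v + a ^+ 2) / v.
  by field; rewrite gt_eqF.
rewrite E1 E2 !exprMn !rsqrt_sqr; [|by posgoal..].
by field; rewrite h1 h2 !gt_eqF.
Qed.

Lemma is_derive1V (f : R -> R) x df : is_derive x (1:R) f df -> f x != 0 ->
  is_derive x (1:R) (fun y => (f y)^-1) (- (f x) ^- 2 * df).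
Proof.
move=> h fx0; have dh : derivable f x 1 by exact: ex_derive.
apply: DeriveDef; first exact: derivableV.
by rewrite deriveV// derive_val.
Qed.

(** One step of the arithmetic-geometric mean. Folding the half-line at w = a b
    by the involution and shifting, the quadratic substitution
    y -> y^2 / (4 (y + a b)) becomes a bijection of ]0, oo[ and carries one
    integrand to the other. *)
Lemma ellint_landen a b : 0 < a -> 0 < b ->
  ellint (((a + b) / 2) ^+ 2) (a * b) = ellint (a ^+ 2) (b ^+ 2).
Proof.
move=> a0 b0; pose c := a * b; have c0 : 0 < c by rewrite mulr_gt0.
pose F w := rsqrt w * rsqrt (w + a ^+ 2) * rsqrt (w + b ^+ 2).
have mF : measurable_fun setT ((fun w => (F w)%:E) : mR -> \bar R) by rewrite /F; msolve.
have F0 w : (0 <= (F w)%:E)%E by rewrite lee_fin; exact: rsqrt3_ge0.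
have FE v : 0 < v -> ((F (c ^+ 2 / v))%:E * (c ^+ 2 / v ^+ 2)%:E = (F v)%:E)%E.
  by move=> v0; exact: ellint_sqr_inversion.
transitivity (\int[mu]_(w in I) (F w)%:E)%E => //.
rewrite (inversion_double c0)// -inversion_halves// integral_shift//.
rewrite /ellint.
pose phi y : R := y ^+ 2 / (4 * (y + c)).
pose dphi y : R := (y ^+ 2 + 2 * c * y) / (4 * (y + c) ^+ 2).
have dphi0 y : 0 < y -> 0 < dphi y.
  by move=> y0; rewrite divr_gt0 ?mulr_gt0 ?exprn_gt0 ?addr_gt0 ?mulr_gt0 ?exprn_gt0.
have phi0 y : 0 < y -> 0 < phi y.
  by move=> y0; rewrite divr_gt0 ?mulr_gt0 ?exprn_gt0 ?addr_gt0.
rewrite (@cov_pos_increasing _ phi dphi _ _ _ dphi0 phi0).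
- rewrite -ge0_integralZl//; last first.
    by apply: measurable_funTS; rewrite /F; msolve.
  apply: eq_integral_pos => y y0; rewrite -!EFinM; congr EFin.
  have yc : 0 < y + c by rewrite addr_gt0.
  have E1 : phi y + ((a + b) / 2) ^+ 2 = (y + c + a ^+ 2) * (y + c + b ^+ 2) / (4 * (y + c)).
    by rewrite /phi /c; field; rewrite gt_eqF.
  have E2 : phi y + a * b = (y + 2 * c) ^+ 2 / (4 * (y + c)).
    by rewrite /phi /c; field; rewrite gt_eqF.
  have h1 : 0 < y + c + a ^+ 2 by rewrite addr_gt0// exprn_gt0.
  have h2 : 0 < y + c + b ^+ 2 by rewrite addr_gt0// exprn_gt0.
  have h3 : 0 < y + 2 * c by rewrite addr_gt0// mulr_gt0.
  have h4 : 0 < phi y by exact: phi0.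
  have h5 : 0 < dphi y by exact: dphi0.
  apply: eq_sqr_ge0; rewrite /F; [by posgoal|by posgoal|].
  rewrite E1 E2 !exprMn !rsqrt_sqr; [|by posgoal..].
  by rewrite /phi /dphi; field; rewrite !gt_eqF.
- move=> y y0; have yc : y + c != 0 by rewrite gt_eqF// addr_gt0.
  have hV : is_derive y (1:R) (fun y => (4 * (y + c))^-1) (- (4 * (y + c)) ^- 2 * 4).
    apply: is_derive1V; last by rewrite mulf_neq0.
    by apply: is_derive_eq; rewrite /GRing.scale/=; ring.
  rewrite /phi; apply: is_derive_eq; rewrite /GRing.scale/= /dphi.
  by field.
- move=> y y0; apply: cvgM.
    apply: cvgD; first exact: exprn_continuous.
    by apply: cvgM; [exact: cvg_cst|exact: cvg_id].
  apply: cvgV; first by rewrite mulf_neq0// expf_neq0// gt_eqF// addr_gt0.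
  apply: cvgM; first exact: cvg_cst.
  apply: (@continuous_comp _ _ _ (fun x => x + c) (fun x => x ^+ 2)).
    by apply: cvgD; [exact: cvg_id|exact: cvg_cst].
  exact: exprn_continuous.
- by msolve.
- by move=> w; rewrite lee_fin.
(* 2 w + 2 s is the positive root of y^2 = 4 w (y + c). *)
- move=> w w0; left; pose s := Num.sqrt (w ^+ 2 + w * c).
  have s0 : 0 <= s by exact: sqrtr_ge0.
  have s2 : s ^+ 2 = w ^+ 2 + w * c.
    by rewrite sqr_sqrtr// addr_ge0 ?sqr_ge0// mulr_ge0// ltW.
  have h : 0 < 2 * w + 2 * s by rewrite ltr_wpDr ?mulr_gt0 ?mulr_ge0.
  exists (2 * w + 2 * s) => //.
  have h' : 2 * w + 2 * s + c != 0 by rewrite gt_eqF// addr_gt0.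
  rewrite /phi.
  have -> : (2 * w + 2 * s) ^+ 2 = w * (4 * (2 * w + 2 * s + c)).
    have -> : (2 * w + 2 * s) ^+ 2 = 4 * w ^+ 2 + 8 * w * s + 4 * s ^+ 2 by ring.
    by rewrite s2; ring.
  by field.
Qed.

Lemma cov_square (f : R -> \bar R) :
  measurable_fun setT (f : mR -> \bar R) -> (forall y, (0 <= f y)%E) ->
  (\int[mu]_(w in I) f w = \int[mu]_(u in I) (f (u ^+ 2)%R * (2 * `|u|)%:E))%E.
Proof.
move=> mf f0.
have D (x : R) : 0 < x -> is_derive x (1:R) (fun u => u ^+ 2) (2 * x).
  by move=> x0; apply: is_derive_eq; rewrite /GRing.scale/=; ring.
rewrite (cov_pos_increasing D)//.
- by apply: eq_integral_pos => u u0; rewrite gtr0_norm.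
- by move=> x x0; apply: cvgM; [exact: cvg_cst|exact: cvg_id].
- by move=> x x0; rewrite mulr_gt0.
- by move=> x x0; rewrite exprn_gt0.
- by move=> y y0; left; exists (Num.sqrt y); rewrite ?sqrtr_gt0// sqr_sqrtr// ltW.
Qed.

Lemma integral_inv_oneDsqr :
  (\int[mu]_(u in I) (2 * (1 + u ^+ 2)^-1)%:E = pi%:E)%E.
Proof.
have mf : measurable_fun I (fun u : R => 2 * (1 + u ^+ 2)^-1).
  apply: measurable_funM => //; apply: measurable_funTS.
  by apply: continuous_measurable_fun; exact: continuous_oneDsqrV.
rewrite integral_itv_obnd_cbnd; last exact/measurable_EFinP.
rewrite (@ge0_continuous_FTC2y _ _ (fun u => 2 * atan u) 0 pi).
- by rewrite atan0 mulr0 sube0.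
- by move=> x _; rewrite mulr_ge0// invr_ge0 addr_ge0// sqr_ge0.
- apply: continuous_subspaceT => x; apply: cvgM; first exact: cvg_cst.
  exact: continuous_oneDsqrV.
- rewrite [X in _ --> X](_ : pi = 2 * (pi / 2)); last by field.
  by apply: cvgM; [exact: cvg_cst|exact: cvgy_atan].
- move=> x x0; apply: derivableM => //; exact: derivable_atan.
- apply: cvg_at_right_filter; apply: cvgM; first exact: cvg_cst.
  exact: continuous_atan.
- move=> x x0; rewrite derive1E.
  have h : is_derive x (1:R) atan (1 + x ^+ 2)^-1.
    by apply: DeriveDef; [exact: derivable_atan|rewrite -derive1E derive1_atan].
  have h2 : is_derive x (1:R) (fun u => 2 * atan u) (2 * (1 + x ^+ 2)^-1).
    by apply: is_derive_eq; rewrite /GRing.scale/=; ring.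
  by rewrite derive_val.
Qed.

Lemma ellint11 : ellint 1 1 = pi%:E :> \bar R.
Proof.
rewrite /ellint cov_square; last 2 first.
- by msolve.
- by move=> w; rewrite lee_fin.
rewrite -integral_inv_oneDsqr; apply: eq_integral_pos => u u0.
rewrite -EFinM (gtr0_norm u0); congr EFin.
have h : 0 < 1 + u ^+ 2 by rewrite addr_gt0// exprn_gt0.
rewrite (addrC _ 1); apply: eq_sqr_ge0; [by posgoal|by posgoal|].
rewrite !exprMn !rsqrt_sqr; [|by posgoal..].
by field; rewrite !gt_eqF.
Qed.

(** With k = m^2 on the left and k = l^2 on the right, l = (1 - m)/(1 + m) is
    Landen's modulus: [ellint 1 (m^2)] is a multiple of [ellint 1 (1 - l^2)], and
    the Jacobian accounts for the factor 2. *)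
Lemma ellint_square_moments :
  (\int[mu]_(k in `]0%R, 1%R[) ((rsqrt k)%:E * (ellint 1 k * ellint 1 k)) =
   2%:E * \int[mu]_(k in `]0%R, 1%R[) ((rsqrt k)%:E *
      (ellint 1 (1 - k) * ellint 1 (1 - k))))%E.
Proof.
have JI : `]0, 1[ `<=` I by move=> x /=; rewrite !in_itv/= andbT => /andP[].
have m1 : measurable_fun setT (ellint 1 : mR -> \bar R) by apply: measurable_ellint; msolve.
have m2 : measurable_fun setT ((fun k => ellint 1 (1 - k)) : mR -> \bar R).
  by apply: measurable_ellint; msolve.
pose J : set R := `]0, 1[%classic.
have mJ : measurable (J : set mR) by exact: measurable_itv.
rewrite -ge0_integralZl//; last 2 first.
- by apply: measurable_funTS; apply: measurable_rsqrtE; apply: emeasurable_funM.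
- move=> x _; apply: mule_ge0; first by rewrite lee_fin rsqrt_ge0.
  by apply: mule_ge0; exact: ellint_ge0.
pose f : R -> \bar R := (fun k => (rsqrt k)%:E * (ellint 1 k * ellint 1 k))%E \_ J.
pose g : R -> \bar R :=
  (fun k => 2%:E * ((rsqrt k)%:E * (ellint 1 (1 - k) * ellint 1 (1 - k))))%E \_ J.
have mf : measurable_fun setT (f : mR -> \bar R).
  apply/(measurable_restrictT _ _).1 => //; apply: measurable_funTS.
  by apply: measurable_rsqrtE; apply: emeasurable_funM.
have mg : measurable_fun setT (g : mR -> \bar R).
  apply/(measurable_restrictT _ _).1 => //; apply: measurable_funTS.
  apply: emeasurable_funM; first exact: measurable_cst.
  by apply: measurable_rsqrtE; apply: emeasurable_funM.
have f0 y : (0 <= f y)%E.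
  apply: erestrict_ge0 => x _; apply: mule_ge0; first by rewrite lee_fin rsqrt_ge0.
  by apply: mule_ge0; exact: ellint_ge0.
have g0 y : (0 <= g y)%E.
  apply: erestrict_ge0 => x _; apply: mule_ge0; first by rewrite lee_fin.
  apply: mule_ge0; first by rewrite lee_fin rsqrt_ge0.
  by apply: mule_ge0; exact: ellint_ge0.
have fE k : 0 < k -> k < 1 -> f k = ((rsqrt k)%:E * (ellint 1 k * ellint 1 k))%E.
  by move=> k0 k1; rewrite /f patchE ifT// inE /J/= in_itv/= k0.
have gE k : 0 < k -> k < 1 ->
    g k = (2%:E * ((rsqrt k)%:E * (ellint 1 (1 - k) * ellint 1 (1 - k))))%E.
  by move=> k0 k1; rewrite /g patchE ifT// inE /J/= in_itv/= k0.
have out (h : R -> \bar R) (u : R) : 0 < u -> 1 <= u ->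
    ((h \_ J) (u ^+ 2)%R * (2 * `|u|)%:E)%E = 0%E.
  move=> u0 u1; rewrite patchE ifF ?mul0e//; apply/negbTE.
  by rewrite notin_setE /J/= in_itv/= => /andP[_]; rewrite ltNge exprn_ege1.
rewrite [LHS](integral_pos_sub _ JI) (integral_pos_sub _ JI) -/f -/g.
rewrite (cov_square mf f0) (cov_square mg g0).
have msq : measurable_fun setT ((fun u => u ^+ 2) : mR -> R) by msolve.
have mh (h : R -> \bar R) : measurable_fun setT (h : mR -> \bar R) ->
    measurable_fun setT ((fun u => h (u ^+ 2)%R * (2 * `|u|)%:E)%E : mR -> \bar R).
  move=> mh; apply: emeasurable_funM; first exact: (measurableT_comp mh msq).
  apply/measurable_EFinP; apply: measurable_funM; first exact: measurable_cst.
  by apply: continuous_measurable_fun; exact: norm_continuous.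
have h0 (h : R -> \bar R) : (forall y, (0 <= h y)%E) -> forall u : R,
    (0 <= h (u ^+ 2)%R * (2 * `|u|)%:E)%E.
  by move=> h0 u; apply: mule_ge0; rewrite // lee_fin mulr_ge0.
(* m = 1/(y + 1) and l = y/(y + 2), both as functions of y > 0, realize
   l = (1 - m)/(1 + m). *)
rewrite (@cov_mobius _ 0 1 1 1 (fun u => f (u ^+ 2)%R * (2 * `|u|)%:E)%E)//; last 4 first.
- by rewrite mul0r mulr1 eq_sym oner_neq0.
- exact: mh.
- exact: h0.
- move=> u u0; have [u1|u1] := leP 1 u; first by right; exact: out.
  left; exists ((1 - u) / u); first by rewrite divr_gt0// subr_gt0.
  by field; apply/andP; split; lra.
rewrite [in RHS](@cov_mobius _ 1 0 1 2 (fun u => g (u ^+ 2)%R * (2 * `|u|)%:E)%E)//; last 4 first.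
- by rewrite mulr1 mul1r; apply/eqP; lra.
- exact: mh.
- exact: h0.
- move=> u u0; have [u1|u1] := leP 1 u; first by right; exact: out.
  left; exists ((2 * u) / (1 - u)); first by rewrite divr_gt0 ?mulr_gt0 ?subr_gt0.
  by field; apply/andP; split; lra.
apply: eq_integral_pos => y y0.
have y1 : 0 < y + 1 by rewrite addr_gt0.
have y2 : 0 < y + 2 by rewrite addr_gt0.
pose m := (y + 1)^-1; pose l := y / (y + 2).
have m0 : 0 < m by rewrite invr_gt0.
have l0 : 0 < l by rewrite divr_gt0.
have m_lt1 : m < 1 by rewrite invf_lt1// ltrDr.
have l_lt1 : l < 1 by rewrite ltr_pdivrMr// mul1r ltrDl.
rewrite !mul0r !mul1r !add0r !addr0 normrN normr1 subr0 !div1r -/m -/l.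
rewrite (gtr0_norm m0) (gtr0_norm l0) (gtr0_norm (ltr0n R 2)).
rewrite fE ?exprn_gt0 ?exprn_ilt1 ?(ltW m0)//.
rewrite gE ?exprn_gt0 ?exprn_ilt1 ?(ltW l0)//.
pose c := ((1 + m) / 2) ^+ 2.
have m1_gt0 : 0 < 1 + m by rewrite addr_gt0.
have c0 : 0 < c by rewrite exprn_gt0// divr_gt0.
have E : ellint 1 (m ^+ 2) = ((rsqrt c)%:E * ellint 1 (1 - l ^+ 2))%E.
  rewrite -(expr1n _ 2) -ellint_landen// -/c mul1r -ellint_scale// expr1n mulr1.
  congr (ellint _ _); rewrite /c /m /l; field.
  by apply/andP; split; apply/eqP; lra.
rewrite E -muleA -EFinM mule_gather.
set G := (ellint 1 (1 - l ^+ 2) * ellint 1 (1 - l ^+ 2))%E.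
rewrite [in RHS](muleA 2%:E) -[in RHS]EFinM (muleAC _ G) -[in RHS]EFinM (muleAC _ G) -[in RHS]EFinM.
congr (_%:E * _)%E.
have -> : rsqrt (m ^+ 2) = m^-1 by rewrite /rsqrt sqrtr_sqr gtr0_norm.
have -> : rsqrt (l ^+ 2) = l^-1 by rewrite /rsqrt sqrtr_sqr gtr0_norm.
have -> : rsqrt c = 2 / (1 + m).
  by rewrite /rsqrt sqrtr_sqr gtr0_norm ?divr_gt0// invf_div.
rewrite /m /l; field.
by repeat (apply/andP; split); apply/eqP; lra.
Qed.

Lemma le_integral_pos (f g : R -> R) (J : set R) : J `<=` I -> measurable (J : set mR) ->
  measurable_fun setT (f : mR -> R) -> measurable_fun setT (g : mR -> R) ->
  (forall x, J x -> 0 <= f x <= g x) ->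
  (\int[mu]_(x in J) (f x)%:E <= \int[mu]_(x in J) (g x)%:E)%E.
Proof.
move=> JI mJ mf mg fg; apply: ge0_le_integral => //.
- by move=> x /fg/andP[? _]; rewrite lee_fin.
- by apply/measurable_EFinP; exact: measurable_funTS.
- by apply/measurable_EFinP; exact: measurable_funTS.
- by move=> x /fg/andP[_ ?]; rewrite lee_fin.
Qed.

Lemma le_ellint a b c : 0 < b -> b <= c -> (ellint a c <= ellint a b)%E.
Proof.
move=> b0 bc; rewrite /ellint; apply: (le_integral_pos (J := I)) => //.
- by msolve.
- by msolve.
- move=> w /=; rewrite in_itv/= andbT => w0; rewrite rsqrt3_ge0/=.
  apply: ler_wpM2l; first by rewrite mulr_ge0// rsqrt_ge0.
  by apply: le_rsqrt; rewrite ?addr_gt0// lerD2l.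
Qed.

Lemma ellint_diag b : 0 < b -> ellint b b = (rsqrt b * pi)%:E.
Proof. by move=> b0; rewrite EFinM -ellint11 -ellint_scale// mulr1. Qed.

Lemma ellint_near_diag a b : 0 < b -> b <= a ->
  ((rsqrt a * pi)%:E <= ellint a b <= (rsqrt b * pi)%:E)%E.
Proof.
move=> b0 ba; rewrite -!ellint_diag//; last exact: lt_le_trans ba.
by rewrite le_ellint//= ellintC le_ellint.
Qed.

(** For w > 0 one has w + c <= (c/b) (w + b). *)
Lemma ellint_ratio a b c : 0 < b -> b <= c -> 0 <= a ->
  ((rsqrt (c / b))%:E * ellint a b <= ellint a c)%E.
Proof.
move=> b0 bc a0; rewrite /ellint -ge0_integralZl//; last 3 first.
- by apply: measurable_funTS; msolve.
- by move=> w _; rewrite lee_fin.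
- by rewrite lee_fin rsqrt_ge0.
under eq_integral do rewrite -EFinM.
have c0 := lt_le_trans b0 bc.
apply: (le_integral_pos (J := I)) => //.
- by msolve.
- by msolve.
- move=> w /=; rewrite in_itv/= andbT => w0; rewrite mulr_ge0 ?rsqrt3_ge0 ?rsqrt_ge0//=.
  rewrite mulrCA; apply: ler_wpM2l; first by rewrite mulr_ge0// rsqrt_ge0.
  rewrite -rsqrtM; last by rewrite divr_ge0// ltW.
  apply: le_rsqrt; first by rewrite addr_gt0.
  rewrite mulrDr divfK ?gt_eqF// lerD2r ler_peMl ?(ltW w0)//.
  by rewrite ler_pdivlMr// mul1r.
Qed.

Lemma integral_inv_shift b d : 0 < b -> 0 < d ->
  (\int[mu]_(w in `]0%R, d[) ((w + b)^-1)%:E = (ln ((d + b) / b))%:E)%E.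
Proof.
move=> b0 d0.
have C (x : R) : 0 <= x -> {for x, continuous (fun w => (w + b)^-1)}.
  move=> x0; apply: cvgV; first by rewrite gt_eqF// ltr_wpDl.
  by apply: cvgD; [exact: cvg_id|exact: cvg_cst].
have D (x : R) : 0 <= x -> is_derive x (1:R) (fun w => ln (w + b)) (x + b)^-1.
  move=> x0; have xb : 0 < x + b by rewrite ltr_wpDl.
  have h := is_derive1_ln xb.
  have h2 : is_derive x (1:R) (fun w => w + b) 1.
    by apply: is_derive_eq; rewrite /GRing.scale/=; ring.
  have := @is_derive1_comp _ (@ln R) (fun w => w + b) x _ _ h h2.
  by rewrite mulr1.
have W : {within `[0, d], continuous (fun w => (w + b)^-1)}.
  apply: continuous_in_subspaceT => x; rewrite inE/= in_itv/= => /andP[x0 _].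
  exact: C.
have mf : measurable_fun `]0, d[ (fun w : R => (w + b)^-1).
  apply: open_continuous_measurable_fun; first exact: interval_open.
  by move=> x; rewrite inE/= in_itv/= => /andP[x0 _]; exact/C/ltW.
have Cln (x : R) : 0 <= x -> {for x, continuous (fun w => ln (w + b))}.
  move=> x0; apply: differentiable_continuous; apply/derivable1_diffP.
  by have [] := D x x0.
rewrite -(@integral_itv_bndoo _ 0 d _ true false); last exact/measurable_EFinP.
rewrite (@continuous_FTC2 _ _ (fun w => ln (w + b)))//.
- by rewrite add0r -EFinB ln_div// ?posrE// addr_gt0.
- split.
  + by move=> x; rewrite in_itv/= => /andP[/ltW x0 _]; have [] := D x x0.
  + exact/cvg_at_right_filter/Cln.
  + exact/cvg_at_left_filter/Cln/ltW.
- move=> x; rewrite in_itv/= => /andP[/ltW x0 _].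
  by rewrite derive1E; have h := D x x0; rewrite derive_val.
Qed.

(** Both bounds are (2/a) ln (1/b) up to o(ln b) when b -> 0 with a fixed. After
    folding at w = a b, the factor w + a^2 is nearly constant on ]0, a b[ and
    sqrt w sqrt (w + b^2) is compared with w + b^2; the error in the upper bound
    is controlled by sqrt (w + b^2) <= sqrt w + b and produces the term pi. *)
Lemma ellint_log_bounds a b : 0 < a -> 0 < b ->
  ((2 * rsqrt (a * b + a ^+ 2) * ln ((a + b) / b))%:E <= ellint (a ^+ 2) (b ^+ 2)
   <= (2 / a * (ln ((a + b) / b) + pi))%:E)%E.
Proof.
move=> a0 b0; have c0 : 0 < a * b by rewrite mulr_gt0.
pose F w := rsqrt w * rsqrt (w + a ^+ 2) * rsqrt (w + b ^+ 2).
have mF : measurable_fun setT (F : mR -> R) by rewrite /F; msolve.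
have F0 w : 0 <= F w by exact: rsqrt3_ge0.
have b20 : 0 < b ^+ 2 by rewrite exprn_gt0.
have a20 : 0 < a ^+ 2 by rewrite exprn_gt0.
pose J : set R := `]0, a * b[%classic.
have JI : J `<=` I by move=> x; rewrite /J/= !in_itv/= andbT => /andP[].
have mJ : measurable (J : set mR) by exact: measurable_itv.
have -> : ellint (a ^+ 2) (b ^+ 2) = (2%:E * \int[mu]_(w in J) (F w)%:E)%E.
  transitivity (\int[mu]_(w in I) (F w)%:E)%E => //.
  apply: (inversion_double c0) => //; first exact/measurable_EFinP.
  by move=> v v0; exact: ellint_sqr_inversion.
pose g w : R := (w + b ^+ 2)^-1.
have mg : measurable_fun J (g : mR -> R).
  apply: open_continuous_measurable_fun; first exact: interval_open.
  move=> x; rewrite inE /J/= in_itv/= => /andP[x0 _].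
  apply: cvgV; first by rewrite gt_eqF// addr_gt0.
  by apply: cvgD; [exact: cvg_id|exact: cvg_cst].
have gE (w : R) : 0 < w -> g w = rsqrt (w + b ^+ 2) ^+ 2.
  by move=> w0; rewrite rsqrt_sqr// addr_ge0// ltW.
have J0 w : J w -> 0 < w /\ w < a * b by rewrite /J/= in_itv/= => /andP.
have Ig : (\int[mu]_(w in J) (g w)%:E = (ln ((a + b) / b))%:E)%E.
  rewrite integral_inv_shift//; congr (ln _)%:E.
  by field; rewrite gt_eqF.
apply/andP; split.
- rewrite mulrAC -mulrA EFinM; apply: lee_wpmul2l; first by rewrite lee_fin.
  rewrite mulrC EFinM -Ig -ge0_integralZl//; last 3 first.
  + exact/measurable_EFinP.
  + by move=> w /J0[w0 _]; rewrite lee_fin invr_ge0 addr_ge0// ltW.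
  + by rewrite lee_fin rsqrt_ge0.
  apply: ge0_le_integral => //.
  + move=> w /J0[w0 _]; rewrite -EFinM lee_fin mulr_ge0 ?rsqrt_ge0//.
    by rewrite invr_ge0 addr_ge0// ltW.
  + by apply: measurable_funeM; exact/measurable_EFinP.
  + by apply/measurable_EFinP; exact: measurable_funTS.
  + move=> w /J0[w0 wc]; rewrite -EFinM lee_fin gE// /F expr2 mulrA.
    apply: ler_wpM2r; first exact: rsqrt_ge0.
    rewrite mulrC; apply: ler_pM; rewrite ?rsqrt_ge0//.
      by apply: le_rsqrt => //; rewrite lerDl ltW.
    by apply: le_rsqrt; rewrite ?addr_gt0// lerD2r ltW.
- rewrite -mulrA EFinM; apply: lee_wpmul2l; first by rewrite lee_fin.
  pose h w := rsqrt w * rsqrt (w + b ^+ 2) * rsqrt (w + b ^+ 2).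
  have mh : measurable_fun setT (h : mR -> R) by rewrite /h; msolve.
  have Ih : (\int[mu]_(w in I) (h w)%:E = (b^-1 * pi)%:E)%E.
    rewrite -[LHS]/(ellint (b ^+ 2) (b ^+ 2)) ellint_diag//.
    by rewrite /rsqrt sqrtr_sqr gtr0_norm.
  have -> : ((a^-1 * (ln ((a + b) / b) + pi))%:E =
     a^-1%:E * (\int[mu]_(w in J) (g w)%:E + b%:E * \int[mu]_(w in I) (h w)%:E))%E.
    by rewrite Ig Ih -EFinM mulrA divff ?gt_eqF// mul1r.
  have mgE : measurable_fun J ((fun w => (g w)%:E) : mR -> \bar R) by exact/measurable_EFinP.
  have mhJ : measurable_fun J (h : mR -> R) by exact: measurable_funTS.
  have mhE : measurable_fun J ((fun w => (h w)%:E) : mR -> \bar R) by exact/measurable_EFinP.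
  have g0 w : J w -> (0 <= (g w)%:E)%E.
    by move=> /J0[w0 _]; rewrite lee_fin invr_ge0 addr_ge0// ltW.
  have h0 w : (0 <= (h w)%:E)%E by rewrite lee_fin rsqrt3_ge0.
  have a1 : 0 <= a^-1 by rewrite invr_ge0 ltW.
  apply: (@le_trans _ _ (a^-1%:E * (\int[mu]_(w in J) (g w)%:E + b%:E * \int[mu]_(w in J) (h w)%:E))%E).
    rewrite -(ge0_integralZl mu mJ mhE) ?lee_fin ?(ltW b0)//.
    rewrite -(ge0_integralD mu mJ)//; last 2 first.
    - by move=> w _; rewrite mule_ge0// lee_fin ltW.
    - exact: measurable_funeM.
    have mS : measurable_fun J ((fun w => (g w)%:E + b%:E * (h w)%:E)%E : mR -> \bar R).
      by apply: emeasurable_funD => //; exact: measurable_funeM.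
    have S0 w : J w -> (0 <= (g w)%:E + b%:E * (h w)%:E)%E.
      by move=> Jw; rewrite adde_ge0 ?g0// mule_ge0// lee_fin ltW.
    rewrite -(ge0_integralZl mu mJ mS) ?lee_fin//.
    apply: ge0_le_integral => //.
    - by move=> w _; rewrite lee_fin.
    - by apply/measurable_EFinP; exact: measurable_funTS.
    - exact: measurable_funeM.
    - move=> w /J0[w0 _].
      rewrite -[X in (_ <= X)%E]/((a^-1 * (g w + b * h w))%:E) lee_fin gE// /h /F.
      have x0 : 0 < Num.sqrt w by rewrite sqrtr_gt0.
      have y0 : 0 < Num.sqrt (w + b ^+ 2) by rewrite sqrtr_gt0 addr_gt0.
      have yx : Num.sqrt (w + b ^+ 2) <= Num.sqrt w + b.
        rewrite -(@ler_pXn2r _ 2)// ?nnegrE ?addr_ge0 ?sqrtr_ge0 ?(ltW b0)//.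
        rewrite sqrrD !sqr_sqrtr ?addr_ge0 ?(ltW w0) ?(ltW b20)//.
        by rewrite lerD2r lerDl mulrn_wge0// mulr_ge0 ?sqrtr_ge0 ?(ltW b0).
      rewrite mulrAC mulrC; apply: ler_pM; rewrite ?mulr_ge0 ?rsqrt_ge0//.
        rewrite (_ : a^-1 = rsqrt (a ^+ 2)); last by rewrite /rsqrt sqrtr_sqr gtr0_norm.
        by apply: le_rsqrt => //; rewrite lerDr ltW.
      rewrite /rsqrt; move: (Num.sqrt w) (Num.sqrt (w + b ^+ 2)) x0 y0 yx => x y x0 y0 yx.
      rewrite -subr_ge0 (_ : _ - _ = (x + b - y) / (x * y ^+ 2)); last first.
        by field; rewrite !gt_eqF.
      by rewrite divr_ge0 ?subr_ge0// mulr_ge0 ?sqr_ge0 ?ltW.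
  apply: lee_wpmul2l; first by rewrite lee_fin.
  apply: leeD2l; apply: lee_wpmul2l; first by rewrite lee_fin ltW.
  apply: ge0_subset_integral => //.
  by apply/measurable_EFinP; exact: measurable_funTS.
Qed.

End landen.

(** * q-products and the finite triple product *)

Section qproducts.
Context {R : realType}.
Implicit Types q Q x y : R.

Definition qpoch q n : R := \prod_(1 <= i < n.+1) (1 - q ^+ i).

Lemma qpoch0 q : qpoch q 0 = 1. Proof. by rewrite /qpoch big_geq. Qed.

Lemma qpochS q n : qpoch q n.+1 = qpoch q n * (1 - q ^+ n.+1).
Proof. by rewrite /qpoch big_nat_recr. Qed.

Section unit_interval.
Variable q : R.
Hypotheses (q0 : 0 < q) (q1 : q < 1).

Lemma subr_exp_gt0 n : 0 < 1 - q ^+ n.+1.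
Proof. by rewrite subr_gt0 exprn_ilt1// ltW. Qed.

Lemma qpoch_gt0 n : 0 < qpoch q n.
Proof.
by elim: n => [|n IH]; rewrite ?qpoch0// qpochS mulr_gt0// subr_exp_gt0.
Qed.

Lemma qpoch_nincr : nonincreasing_seq (qpoch q).
Proof.
apply/nonincreasing_seqP => n; rewrite qpochS ler_piMr ?(ltW (qpoch_gt0 n))//.
by rewrite lerBlDr lerDl exprn_ge0// ltW.
Qed.

(** 1 - y >= exp (- y/(1 - y)) for each factor; the exponents are dominated by a
    geometric series. *)
Lemma qpoch_lower n : expR (- (q / (1 - q) ^+ 2)) <= qpoch q n.
Proof.
have d0 : 0 < 1 - q by rewrite subr_gt0.
suff H : expR (- (\sum_(1 <= i < n.+1) q ^+ i / (1 - q))) <= qpoch q n.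
  apply: le_trans H; rewrite ler_expR lerN2 -mulr_suml.
  rewrite expr2 invfM mulrA ler_pM2r ?invr_gt0// ler_pdivlMr//.
  have -> : (\sum_(1 <= i < n.+1) q ^+ i) * (1 - q) = q * (1 - q ^+ n).
    elim: n => [|n IH]; first by rewrite big_geq// mul0r expr0 subrr mulr0.
    by rewrite big_nat_recr//= mulrDl IH exprS; ring.
  by rewrite ler_piMr ?(ltW q0)// lerBlDr lerDl exprn_ge0// ltW.
elim: n => [|n IH]; first by rewrite big_geq// oppr0 expR0 qpoch0.
rewrite big_nat_recr//= opprD expRD qpochS; apply: ler_pM; rewrite ?expR_ge0//.
have e0 := subr_exp_gt0 n.
have le : q ^+ n.+1 / (1 - q ^+ n.+1) <= q ^+ n.+1 / (1 - q).
  rewrite ler_pM2l ?exprn_gt0// lef_pV2 ?posrE// lerD2l lerN2.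
  by rewrite -[leRHS]expr1 ler_wiXn2l// ltW.
apply: (@le_trans _ _ (expR (- (q ^+ n.+1 / (1 - q ^+ n.+1))))).
  by rewrite ler_expR lerN2.
rewrite expRN -[leRHS]invrK lef_pV2 ?posrE ?expR_gt0 ?invr_gt0//.
rewrite [leLHS](_ : _ = 1 + q ^+ n.+1 / (1 - q ^+ n.+1)); first exact: expR_ge1Dx.
by field; rewrite gt_eqF.
Qed.

Definition qinf : R := limn (qpoch q).

Lemma qpoch_cvg : qpoch q n @[n --> \oo] --> qinf.
Proof.
apply: nonincreasing_is_cvgn; first exact: qpoch_nincr.
by exists 0 => _ [n _ <-]; exact/ltW/qpoch_gt0.
Qed.

Lemma qinf_le n : qinf <= qpoch q n.
Proof. apply: nonincreasing_cvgn_ge; [exact: qpoch_nincr|exact: qpoch_cvg]. Qed.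

Lemma qinf_le1 : qinf <= 1. Proof. by rewrite -(qpoch0 q) qinf_le. Qed.

Lemma qinf_lower : expR (- (q / (1 - q) ^+ 2)) <= qinf.
Proof.
apply: limr_ge; first by apply/cvg_ex; exists qinf; exact: qpoch_cvg.
by apply: nearW => n; exact: qpoch_lower.
Qed.

Lemma qinf_gt0 : 0 < qinf.
Proof. exact: lt_le_trans (expR_gt0 _) qinf_lower. Qed.

End unit_interval.

Definition qbin q n k : R := qpoch q n / (qpoch q k * qpoch q (n - k)).

Lemma qbin_rec q n k : 0 < q -> q < 1 -> (k < n)%N ->
  qbin q n.+1 k.+1 = qbin q n k.+1 + q ^+ (n - k) * qbin q n k.
Proof.
move=> q0 q1 kn; rewrite /qbin subSS.
have [m E] : exists m, (n - k = m.+1)%N by exists (n - k).-1; lia.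
have -> : (n - k.+1 = m)%N by lia.
have -> : n = (m + k).+1 by lia.
have -> : ((m + k).+1 - k = m.+1)%N by lia.
have h i := lt0r_neq0 (qpoch_gt0 q0 q1 i).
have h' i := lt0r_neq0 (subr_exp_gt0 q0 q1 i).
rewrite [qpoch _ (m + k).+2]qpochS [qpoch _ k.+1]qpochS [qpoch _ m.+1]qpochS.
rewrite (_ : q ^+ (m + k).+2 = q ^+ m.+1 * q ^+ k.+1); last by rewrite -exprD; congr (_ ^+ _); lia.
by field; rewrite !h !h'.
Qed.

Lemma qbin0 q n : 0 < q -> q < 1 -> qbin q n 0 = 1.
Proof. by move=> q0 q1; rewrite /qbin subn0 qpoch0 mul1r divff// lt0r_neq0// qpoch_gt0. Qed.

Lemma qbinn q n : 0 < q -> q < 1 -> qbin q n n = 1.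
Proof. by move=> q0 q1; rewrite /qbin subnn qpoch0 mulr1 divff// lt0r_neq0// qpoch_gt0. Qed.

(** The q-binomial theorem, kept homogeneous so that [triple_product_finite] can
    take for y a power of q where the usual statement has negative powers. *)
Lemma rothe q x y n : 0 < q -> q < 1 ->
  \prod_(i < n) (y + x * q ^+ i) =
  \sum_(k < n.+1) qbin q n k * q ^+ 'C(k, 2) * x ^+ k * y ^+ (n - k).
Proof.
move=> q0 q1; elim: n => [|n IH].
  by rewrite big_ord0 big_ord1 qbin0// bin0n !expr0 !mulr1.
rewrite big_ord_recr/= IH mulrDr [RHS]big_ord_recl/= qbin0// bin0n !expr0 !mulr1 mul1r subn0.
rewrite [X in _ = _ + X]big_ord_recr/= /bump/= !add1n qbinn// subSS subnn expr0 mulr1 mul1r.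
under [X in _ = _ + (X + _)]eq_bigr => k _ do
  rewrite add1n qbin_rec// subSS mulrDl mulrDl mulrDl.
rewrite big_split/=.
rewrite [X in X * y + _]big_ord_recl [X in _ + X * (x * _)]big_ord_recr/=.
rewrite qbin0// bin0n !expr0 !mulr1 mul1r subn0 qbinn// subnn expr0 mulr1 mul1r.
rewrite !mulrDl !mulr_suml exprSr.
have -> : \sum_(i < n) qbin q n (bump 0 i) * q ^+ 'C(bump 0 i, 2) * x ^+ (bump 0 i) *
    y ^+ (n - bump 0 i) * y =
  \sum_(i < n) qbin q n i.+1 * q ^+ 'C(i.+1, 2) * x ^+ i.+1 * y ^+ (n - i).
  apply: eq_bigr => i _; rewrite /bump/= add1n -mulrA -exprSr; congr (_ * _ ^+ _).
  by have := ltn_ord i; lia.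
have -> : \sum_(i < n) qbin q n i * q ^+ 'C(i, 2) * x ^+ i * y ^+ (n - i) * (x * q ^+ n) =
  \sum_(i < n) q ^+ (n - i) * qbin q n i * q ^+ 'C(i.+1, 2) * x ^+ i.+1 * y ^+ (n - i).
  apply: eq_bigr => i _; rewrite binS bin1 exprD exprS.
  rewrite (_ : q ^+ n = q ^+ (n - i) * q ^+ i); last by rewrite -exprD subnK// ltnW.
  ring.
rewrite binS bin1 exprD exprS; ring.
Qed.

End qproducts.

Section triple_product.
Context {R : realType}.
Implicit Types q e : R.

(** The number of integers whose square is j^2. *)
Definition sqmult (j : nat) : R := if j == 0%N then 1 else 2.

Lemma bin2_sqr k : (2 * 'C(k, 2) + k = k * k)%N.
Proof. by elim: k => // k IH; rewrite binS bin1; lia. Qed.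

Lemma qbin_sym q n k : (k <= n)%N -> qbin q n (n - k) = qbin q n k.
Proof. by move=> kn; rewrite /qbin subKn// (mulrC (qpoch q (n - k))). Qed.

Lemma sign_sqr (b : bool) j : ((-1) ^+ b : R) ^+ (j * j) = (-1) ^+ b ^+ j.
Proof.
case: b; rewrite ?expr0 ?expr1n// expr1.
by rewrite -[LHS]signr_odd -[RHS]signr_odd oddM andbb.
Qed.

Lemma sign_addn (b : bool) j : ((-1) ^+ b : R) ^+ (j + j) = 1.
Proof. by rewrite exprD -exprMn -expr2 sqrr_sign expr1n. Qed.

(** The triple product truncated to n factors, at z = 1 or -1. Rothe's formula
    with 2 n factors yields the product up to the monomial c; the terms of index
    n + j and n - j are equal by the symmetry of [qbin], which produces the
    weight [sqmult j]. *)
Lemma triple_product_finite q (b : bool) n : 0 < q -> q < 1 ->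
  \prod_(i < n) (1 + (-1) ^+ b * q ^+ (2 * i).+1) ^+ 2 =
  \sum_(0 <= j < n.+1) sqmult j * qbin (q ^+ 2) (2 * n) (n + j) * ((-1) ^+ b * q) ^+ (j * j).
Proof.
move=> q0 q1; have q20 : 0 < q ^+ 2 by rewrite exprn_gt0.
have q21 : q ^+ 2 < 1 by rewrite exprn_ilt1// ltW.
set e : R := (-1) ^+ b.
have e_sqr j : e ^+ (j * j) = e ^+ j by exact: sign_sqr.
have e_add j : e ^+ (j + j) = 1 by exact: sign_addn.
have e0 : e != 0 by rewrite /e signr_eq0.
have e2 : e * e = 1 by rewrite -expr2 (e_add 1%N).
clearbody e; case: n => [|m].
  by rewrite big_ord0 big_nat1 /sqmult/= qbin0// !mul1r expr0.
(* In Rothe's product with y = q^(2 m + 1), the factor 1 + e q^(2 i + 1) occurs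
   twice, multiplied by e q^(2 (n - i - 1)) and by q^(2 m + 1); c is the product
   of these monomials over i. *)
set n := m.+1; pose D := (n * (2 * m).+1 + n * m)%N.
pose c := e ^+ n * q ^+ D.
have c0 : c != 0.
  by rewrite mulf_neq0 ?expf_neq0// ?gt_eqF.
apply: (mulfI c0).
pose G k := qbin (q ^+ 2) (2 * n) k * (q ^+ 2) ^+ 'C(k, 2) * e ^+ k *
   (q ^+ (2 * m).+1) ^+ (2 * n - k).
have GR j : (j <= n)%N -> G (n + j)%N = c * (qbin (q ^+ 2) (2 * n) (n + j) * (e * q) ^+ (j * j)).
  move=> jn; rewrite /G /c -!exprM exprMn e_sqr (exprD e).
  rewrite [RHS](_ : _ = qbin (q ^+ 2) (2 * n) (n + j) * (q ^+ D * q ^+ (j * j)) * (e ^+ n * e ^+ j)); last by ring.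
  rewrite mulrAC; congr (_ * _); rewrite -mulrA -!exprD; congr (_ * _ ^+ _).
  have := bin2_sqr (n + j); rewrite /D /n; nia.
have GL j : (j <= n)%N -> G (n - j)%N = c * (qbin (q ^+ 2) (2 * n) (n + j) * (e * q) ^+ (j * j)).
  move=> jn; rewrite /G /c -!exprM exprMn e_sqr.
  have -> : qbin (q ^+ 2) (2 * n) (n - j) = qbin (q ^+ 2) (2 * n) (n + j).
    by rewrite -qbin_sym; [congr (qbin _ _ _); lia|lia].
  have -> : e ^+ (n - j) = e ^+ n * e ^+ j.
    by rewrite -[in RHS](subnK jn) exprD -mulrA -exprD e_add mulr1.
  rewrite [RHS](_ : _ = qbin (q ^+ 2) (2 * n) (n + j) * (q ^+ D * q ^+ (j * j)) * (e ^+ n * e ^+ j)); last by ring.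
  rewrite mulrAC; congr (_ * _); rewrite -mulrA -!exprD; congr (_ * _ ^+ _).
  have := bin2_sqr (n - j); rewrite /D /n; nia.
transitivity (\sum_(0 <= k < (2 * n).+1) G k).
  rewrite [RHS]big_mkord -rothe// mul2n -addnn big_split_ord/=.
  rewrite [X in _ = X * _](reindex_inj rev_ord_inj)/=.
  rewrite -big_split/= /c.
  have -> : e ^+ n * q ^+ D = \prod_(i < n) (e * q ^+ (2 * (n - i.+1)) * q ^+ (2 * m).+1).
    rewrite 2!big_split/= !prodr_const card_ord prodrXr -mulrA -exprM -exprD.
    congr (_ * _ ^+ _); rewrite /D addnC (mulnC _ n); congr (_ + _)%N.
    rewrite -big_distrr/= -(big_mkord xpredT (fun i => n - i.+1)%N).
    rewrite big_nat_rev/= add0n big_nat_cond.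
    rewrite (eq_bigr (fun i => i)); last by move=> i /andP[/andP[_ h] _]; lia.
    by rewrite -big_nat_cond bin2_sum; have := bin2_sqr n; rewrite /n; nia.
  rewrite -big_split/=; apply: eq_bigr => i _.
  have E1 : q ^+ (2 * m).+1 = q ^+ (2 * (n - i.+1)) * q ^+ (2 * i).+1.
    by rewrite -exprD; congr (_ ^+ _); have := ltn_ord i; rewrite /n; lia.
  have E2 : (q ^+ 2) ^+ (n + i) = q ^+ (2 * m).+1 * q ^+ (2 * i).+1.
    by rewrite -exprM -exprD; congr (_ ^+ _); rewrite /n; lia.
  rewrite E2 -exprM.
  rewrite [X in _ = (X + _) * _]E1.
  rewrite (_ : q ^+ (2 * (n - i.+1)) * q ^+ (2 * i).+1 + e * q ^+ (2 * (n - i.+1)) =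
    e * q ^+ (2 * (n - i.+1)) * (1 + e * q ^+ (2 * i).+1)); last first.
    rewrite mulrDr mulr1 addrC; congr (_ + _).
    by rewrite mulrACA e2 mul1r.
  ring.
rewrite (big_cat_nat _ (n := n))//=; last by lia.
rewrite [X in _ + X](_ : _ = \sum_(0 <= j < n.+1) G (n + j)%N); last first.
  rewrite -[n in X in X = _]add0n big_addn (_ : ((2 * n).+1 - n)%N = n.+1); last by lia.
  by apply: eq_bigr => j _; rewrite addnC.
rewrite [X in X + _](_ : _ = \sum_(0 <= j < n) G (n - j.+1)%N); last first.
  by rewrite big_nat_rev/= add0n.
rewrite [X in _ + X]big_nat_recl//= addrCA -big_split/= mulr_sumr [RHS]big_nat_recl//=.
congr (_ + _); first by rewrite GR// /sqmult/= mul1r.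
rewrite big_nat_cond [RHS]big_nat_cond; apply: eq_bigr => j /andP[/andP[_ jn] _].
by rewrite GR// GL// /sqmult/=; ring.
Qed.

End triple_product.

(** * Limits of series and differentiation of power series *)

Section series.
Context {R : realType}.
Implicit Types (q x : R) (c w : R^nat).

(** Dominated convergence for series: split at an index J beyond which the tail of
    w is small. *)
Lemma tannery (c : nat -> R^nat) w (C l : R) :
  (forall n j, `|c n j| <= C) -> (forall j, c n j @[n --> \oo] --> l) ->
  cvgn (series (fun j => `|w j|)) ->
  \sum_(0 <= j < n.+1) c n j * w j @[n --> \oo] --> l * limn (series w).
Proof.
move=> cC cl wS.
have C0 : 0 <= C by exact: le_trans (cC 0%N 0%N).
have wS' : cvgn (series w) by exact: normed_cvg.
have H : \sum_(0 <= j < n.+1) (c n j - l) * w j @[n --> \oo] --> (0 : R).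
  apply/cvgrPdist_lt => e e0.
  pose K := C + `|l| + 1.
  have K0 : 0 < K by rewrite ltr_wpDl// addr_ge0.
  have e2 : 0 < e / 2 / K by rewrite !divr_gt0.
  have /cvgrPdist_lt /(_ _ e2) [J _ HJ] := wS.
  have HJ' := HJ J (leqnn J).
  have fin : \sum_(0 <= j < J) `|c n j - l| * `|w j| @[n --> \oo] --> (0 : R).
    elim: J {HJ HJ'} => [|J IH].
      by under eq_fun do rewrite big_geq//; exact: cvg_cst.
    have h : `|c n J - l| * `|w J| @[n --> \oo] --> (0 : R).
      have := cvgM (cvg_norm (cvgB (cl J) (@cvg_cst _ l nat \oo _)))
        (@cvg_cst _ `|w J| nat \oo _).
      rewrite subrr normr0 mul0r => H0; exact: H0.
    have -> : (fun n : nat => \sum_(0 <= j < J.+1) `|c n j - l| * `|w j|) =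
        (fun n => \sum_(0 <= j < J) `|c n j - l| * `|w j| + `|c n J - l| * `|w J|).
      by apply/funext => n; rewrite big_nat_recr.
    have H := cvgD IH h; rewrite addr0 in H; exact: H.
  have e20 : 0 < e / 2 by rewrite divr_gt0.
  move/cvgrPdist_lt : fin => /(_ _ e20) fin.
  near=> n.
  have Jn : (J <= n.+1)%N by apply: ltnW; near: n; exact: nbhs_infty_ge.
  rewrite sub0r normrN (big_cat_nat _ (n := J))//=.
  apply: (le_lt_trans (ler_normD _ _)).
  rewrite (splitr e).
  apply: ltr_leD.
    apply: le_lt_trans (ler_norm_sum _ _ _) _.
    have : `|0 - \sum_(0 <= j < J) `|c n j - l| * `|w j| | < e / 2 by near: n.
    rewrite sub0r normrN => h.
    apply: le_lt_trans h; apply: le_trans (ler_norm _).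
    by apply: ler_sum => j _; rewrite normrM.
  apply: le_trans (ler_norm_sum _ _ _) _.
  apply: (@le_trans _ _ (K * \sum_(J <= j < n.+1) `|w j|)).
    rewrite mulr_sumr; apply: ler_sum => j _; rewrite normrM ler_wpM2r//.
    apply: le_trans (ler_normB _ _) _; rewrite /K.
    by rewrite -addrA lerD// lerDl.
  rewrite mulrC -ler_pdivlMr//; apply/ltW; apply: le_lt_trans HJ'.
  apply: le_trans (ler_norm _).
  rewrite lerBrDr.
  have -> : \sum_(J <= j < n.+1) `|w j| + series (fun j => `|w j|) J = series (fun j => `|w j|) n.+1.
    by rewrite /series/= addrC -big_cat_nat.
  apply: nondecreasing_cvgn_le => //.
  apply/nondecreasing_seqP => k; rewrite /series/= big_nat_recr//= lerDl//.
have -> : (fun n => \sum_(0 <= j < n.+1) c n j * w j) =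
   (fun n => \sum_(0 <= j < n.+1) (c n j - l) * w j + l * series w n.+1).
  apply/funext => n; rewrite /series/= mulr_sumr -big_split/=.
  by apply: eq_bigr => j _; ring.
rewrite -[X in _ --> X]add0r; apply: cvgD => //.
apply: cvgM; first exact: cvg_cst.
by rewrite (cvg_shiftS (series w)).
Unshelve. all: by end_near. Qed.

(** The radius of convergence is at least 1, in a form visibly inherited by the
    formal derivative ([subexp_diffs]). *)
Definition subexp c := forall r, 0 < r < 1 -> exists M, forall m, `|c m| * r ^+ m <= M.

(** (n + 1) r^n is at most 1 + r + ... + r^n. *)
Lemma ler_natM_expr (r : R) n : 0 < r < 1 -> n.+1%:R * r ^+ n <= (1 - r)^-1.
Proof.
move=> /andP[r0 r1]; have d0 : 0 < 1 - r by rewrite subr_gt0.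
rewrite -[leRHS]mul1r ler_pdivlMr// .
apply: (@le_trans _ _ ((\sum_(0 <= i < n.+1) r ^+ i) * (1 - r))).
  rewrite ler_pM2r// mulr_natl -[X in _ *+ X](subn0 n.+1) -sumr_const_nat.
  rewrite big_nat_cond [leRHS]big_nat_cond; apply: ler_sum => i /andP[/andP[_ h] _].
  by rewrite ler_wiXn2l// ltW.
have -> : (\sum_(0 <= i < n.+1) r ^+ i) * (1 - r) = 1 - r ^+ n.+1.
  elim: n => [|n IH]; first by rewrite big_nat1 expr0 expr1 mul1r.
  by rewrite big_nat_recr//= mulrDl IH !exprS; ring.
by rewrite lerBlDr lerDl exprn_ge0// ltW.
Qed.

Lemma subexp_cvg c x : subexp c -> `|x| < 1 -> cvgn (series (fun n => `|c n * x ^+ n|)).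
Proof.
move=> sc x1; pose r := (1 + `|x|) / 2.
have xr : `|x| < r by rewrite /r ltr_pdivlMr//; have := x1; lra.
have r1 : r < 1 by rewrite /r ltr_pdivrMr//; have := x1; lra.
have r0 : 0 < r by exact: le_lt_trans xr.
have [M HM] : exists M, forall m, `|c m| * r ^+ m <= M by apply: sc; rewrite r0.
have t1 : `|x| / r < 1 by rewrite ltr_pdivrMr// mul1r.
have t0 : 0 <= `|x| / r by rewrite divr_ge0// ltW.
apply: (@series_le_cvg _ _ (fun n => M * (`|x| / r) ^+ n)) => //.
- by move=> n; rewrite mulr_ge0// ?exprn_ge0//; apply: le_trans (HM 0%N); rewrite mulr_ge0.
- move=> n; rewrite normrM normrX expr_div_n mulrA -[leLHS](mulfK (lt0r_neq0 (exprn_gt0 n r0))).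
  rewrite ler_pM2r ?invr_gt0 ?exprn_gt0// mulrAC ler_wpM2r ?exprn_ge0//.
- have := @is_cvg_geometric_series _ M (`|x| / r).
  by apply; rewrite ger0_norm.
Qed.

Lemma subexp_diffs c : subexp c -> subexp (pseries_diffs c).
Proof.
move=> sc r /andP[r0 r1]; pose s := Num.sqrt r.
have s0 : 0 < s by rewrite sqrtr_gt0.
have s2 : s ^+ 2 = r by rewrite sqr_sqrtr// ltW.
have s1 : s < 1 by rewrite -(@ltr_pXn2r _ 2)// ?nnegrE ?(ltW s0)// expr1n s2.
have [M' HM'] : exists M, forall m, `|c m| * s ^+ m <= M by apply: sc; rewrite s0.
exists ((1 - s)^-1 * (M' / s)) => m.
rewrite /pseries_diffs normrM normr_nat -s2 -exprM mul2n -addnn exprD.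
rewrite (_ : _ * _ = (m.+1%:R * s ^+ m) * (`|c m.+1| * s ^+ m)); last by ring.
apply: ler_pM; rewrite ?mulr_ge0 ?exprn_ge0 ?(ltW s0)//.
  by apply: ler_natM_expr; rewrite s0.
by rewrite ler_pdivlMr// -mulrA -exprSr.
Qed.

Lemma is_derive_pseries c x : subexp c -> `|x| < 1 ->
  is_derive x (1:R) (fun x => limn (pseries c x)) (limn (pseries (pseries_diffs c) x)).
Proof.
move=> sc x1; pose K := (1 + `|x|) / 2.
have xK : `|x| < K by rewrite /K ltr_pdivlMr//; have := x1; lra.
have K1 : K < 1 by rewrite /K ltr_pdivrMr//; have := x1; lra.
have K0 : 0 < K by exact: le_lt_trans xK.
have aK : `|K| < 1 by rewrite gtr0_norm.
have cvgK c' : subexp c' -> cvgn (pseries c' K).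
  by move=> sc'; apply: normed_cvg; exact: subexp_cvg.
apply: (@pseries_snd_diffs _ c K x); [exact: cvgK|exact/cvgK/subexp_diffs| |].
- exact/cvgK/subexp_diffs/subexp_diffs.
- by rewrite (gtr0_norm K0).
Qed.

End series.

(** * The theta function and its product formulas *)

Section theta.
Context {R : realType}.
Implicit Types (q x : R).

(** [theta x] is 1 + 2 (x + x^4 + x^9 + ...), presented as a power series so that
    it can be differentiated and so that it makes sense at 0 and at negative
    arguments. *)
Definition theta_coef m : R := \sum_(0 <= j < m.+1) (j * j == m)%:R * sqmult j.
Definition theta x : R := limn (pseries theta_coef x).
Definition dtheta x : R := limn (pseries (pseries_diffs theta_coef) x).

Lemma sqmult_ge0 j : 0 <= sqmult j :> R. Proof. by rewrite /sqmult; case: ifP. Qed.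
Lemma sqmult_le2 j : sqmult j <= 2 :> R.
Proof. by rewrite /sqmult; case: ifP => // _; rewrite ler1n. Qed.

Lemma subexp_theta_coef : subexp theta_coef.
Proof.
move=> r r01; exists (2 * (1 - r)^-1) => m.
have r0 : 0 <= r by case/andP: r01 => /ltW.
apply: (@le_trans _ _ ((2 * m.+1%:R) * r ^+ m)); last first.
  by rewrite -mulrA ler_wpM2l// ler_natM_expr.
rewrite ler_wpM2r ?exprn_ge0//.
rewrite ger0_norm; last by apply: sumr_ge0 => j _; rewrite mulr_ge0 ?sqmult_ge0.
rewrite mulr_natr -[X in _ *+ X](subn0 m.+1) -sumr_const_nat.
by apply: ler_sum => j _; case: (_ == _); rewrite ?mul1r ?mul0r ?sqmult_le2.
Qed.

Lemma theta_partial x n :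
  pseries theta_coef x (n * n)%N = \sum_(0 <= j < n) sqmult j * x ^+ (j * j).
Proof.
rewrite /pseries /series/=.
transitivity (\sum_(0 <= m < n * n) \sum_(0 <= j < n * n) (j * j == m)%:R * (sqmult j * x ^+ (j * j))).
  rewrite big_nat_cond [RHS]big_nat_cond; apply: eq_bigr => m /andP[/andP[_ mn] _].
  rewrite [RHS](big_cat_nat _ (n := m.+1))//= [X in _ + X]big_nat_cond.
  rewrite [X in _ + X]big1 ?addr0; last first.
    move=> j /andP[/andP[mj _] _]; rewrite (_ : (_ == _) = false) ?mul0r//.
    by apply/negbTE/eqP; nia.
  rewrite /theta_coef mulr_suml; apply: eq_bigr => j _; rewrite mulrA.
  case: (eqVneq (j * j)%N m) => [E|_]; last by rewrite !mul0r. by rewrite E.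
rewrite exchange_big_nat/=.
rewrite (big_cat_nat _ (n := n))//=; last by nia.
rewrite [X in _ + X]big_nat_cond [X in _ + X]big1 ?addr0; last first.
  move=> j /andP[/andP[nj _] _]; rewrite big_nat_cond big1// => m /andP[/andP[_ mn] _].
  rewrite (_ : (_ == _) = false) ?mul0r//; apply/negbTE/eqP; nia.
rewrite big_nat_cond [RHS]big_nat_cond; apply: eq_bigr => j /andP[/andP[_ jn] _].
rewrite -mulr_suml -[RHS]mul1r; congr (_ * _).
have jj : (j * j < n * n)%N by nia.
rewrite big_mkord (bigD1 (Ordinal jj))//= eqxx big1 ?addr0// => m /eqP h.
rewrite (_ : (_ == _) = false)//; apply/negbTE/eqP => h'; apply: h.
by apply/val_inj.
Qed.

Lemma cvg_sqr_index (u : R^nat) (l : R) : u n @[n --> \oo] --> l -> u (n * n)%N @[n --> \oo] --> l.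
Proof.
move=> ul; apply: (@cvg_comp _ _ _ (fun n : nat => (n * n)%N) u \oo \oo (nbhs l)) => //.
by move=> A [N _ HN]; exists N => // n /= Nn; apply: HN => /=; nia.
Qed.

Lemma theta_cvg x : `|x| < 1 -> \sum_(0 <= j < n) sqmult j * x ^+ (j * j) @[n --> \oo] --> theta x.
Proof.
move=> x1; under eq_fun do rewrite -theta_partial.
apply: cvg_sqr_index; apply: normed_cvg; exact: subexp_cvg subexp_theta_coef x1.
Qed.

Lemma theta_normed x : `|x| < 1 -> cvgn (series (fun j => `|sqmult j * x ^+ (j * j)|)).
Proof.
move=> x1; rewrite (_ : (fun j => _) = (fun j => sqmult j * `|x| ^+ (j * j))).
  by apply/cvg_ex; exists (theta `|x|); apply: theta_cvg; rewrite normr_id.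
by apply/funext => j; rewrite normrM normrX ger0_norm// sqmult_ge0.
Qed.

Lemma is_derive_theta x : `|x| < 1 -> is_derive x (1:R) theta (dtheta x).
Proof. exact: is_derive_pseries subexp_theta_coef. Qed.

Lemma pseries_at0 (c : R^nat) : limn (pseries c 0) = c 0%N.
Proof.
apply/cvg_lim => //; apply: (@cvg_near_cst _ _ (c 0%N)).
exists 1%N => // -[//|n] _ /=; rewrite /pseries /series/= big_nat_recl//= expr0 mulr1.
by rewrite big1 ?addr0// => j _; rewrite exprS mul0r mulr0.
Qed.

Lemma theta0 : theta 0 = 1.
Proof. by rewrite /theta pseries_at0 /theta_coef big_nat1 /sqmult/= mul1r. Qed.

Lemma dtheta0 : dtheta 0 = 2.
Proof.
rewrite /dtheta pseries_at0 /pseries_diffs mul1r /theta_coef big_mkord.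
by rewrite !big_ord_recl big_ord0 /sqmult/= mul0r add0r mul1r addr0.
Qed.

Lemma theta_continuous x : `|x| < 1 -> {for x, continuous theta}.
Proof.
move=> x1; apply: differentiable_continuous; apply/derivable1_diffP.
by have [] := is_derive_theta x1.
Qed.

Lemma dtheta_continuous x : `|x| < 1 -> {for x, continuous dtheta}.
Proof.
move=> x1; apply: differentiable_continuous; apply/derivable1_diffP.
by have [] := is_derive_pseries (subexp_diffs subexp_theta_coef) x1.
Qed.

Lemma cvg_double (u : R^nat) (l : R) : u n @[n --> \oo] --> l -> u (2 * n)%N @[n --> \oo] --> l.
Proof.
move=> ul; apply: (@cvg_comp _ _ _ (fun n : nat => (2 * n)%N) u \oo \oo (nbhs l)) => //.
by move=> A [N _ HN]; exists N => // n /= Nn; apply: HN => /=; nia.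
Qed.

(** Limit of [triple_product_finite] by Tannery's theorem: each q-binomial
    coefficient is bounded by the inverse square of the infinite product, and
    converges to its inverse. *)
Lemma theta_triple_product q (b : bool) : 0 < q -> q < 1 ->
  \prod_(i < n) (1 + (-1) ^+ b * q ^+ (2 * i).+1) ^+ 2 @[n --> \oo] -->
  (qinf (q ^+ 2))^-1 * theta ((-1) ^+ b * q).
Proof.
move=> q0 q1; have q20 : 0 < q ^+ 2 by rewrite exprn_gt0.
have q21 : q ^+ 2 < 1 by rewrite exprn_ilt1// ltW.
have eq1 : `|(-1) ^+ b * q| < 1 by rewrite normrM normrX normrN1 expr1n mul1r gtr0_norm.
have p0 := qinf_gt0 q20 q21; have pn := lt0r_neq0 p0.
under eq_fun do rewrite triple_product_finite//.
under eq_fun do under eq_bigr do rewrite (mulrC (sqmult _)) -mulrA.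
have -> : theta ((-1) ^+ b * q) = limn (series (fun j => sqmult j * ((-1) ^+ b * q) ^+ (j * j))).
  by apply/esym/cvg_lim => //; exact: theta_cvg.
apply: (@tannery _ (fun n j => qbin (q ^+ 2) (2 * n) (n + j)) _ (qinf (q ^+ 2) ^- 2)).
- move=> n j; rewrite /qbin.
  have h i : 0 < qpoch (q ^+ 2) i by exact: qpoch_gt0.
  rewrite ger0_norm; last by rewrite divr_ge0 ?mulr_ge0 ?ltW.
  rewrite -[leRHS]mul1r; apply: ler_pM; rewrite ?invr_ge0 ?mulr_ge0 ?(ltW (h _))//.
    by rewrite -(qpoch0 (q ^+ 2)); exact: qpoch_nincr.
  rewrite lef_pV2 ?posrE ?mulr_gt0 ?exprn_gt0// expr2.
  by apply: ler_pM; rewrite ?(ltW p0)//; exact: qinf_le.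
- move=> j; have cP := qpoch_cvg q20 q21.
  have c1 : qpoch (q ^+ 2) (2 * n) @[n --> \oo] --> qinf (q ^+ 2) by exact: cvg_double.
  have c2 : qpoch (q ^+ 2) (n + j) @[n --> \oo] --> qinf (q ^+ 2).
    by rewrite (cvg_shiftn j (qpoch (q ^+ 2))).
  have c3 : qpoch (q ^+ 2) (2 * n - (n + j)) @[n --> \oo] --> qinf (q ^+ 2).
    apply: (@cvg_comp _ _ _ (fun n : nat => (2 * n - (n + j))%N) (qpoch (q ^+ 2)) \oo \oo (nbhs (qinf (q ^+ 2)))) => //.
    by move=> A [N _ HN]; exists (N + j)%N => // n /= Nn; apply: HN => /=; lia.
  have -> : (qinf (q ^+ 2))^-1 = qinf (q ^+ 2) / (qinf (q ^+ 2) * qinf (q ^+ 2)) by field.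
  by apply: cvgM => //; apply: cvgV; [rewrite mulf_neq0|exact: cvgM].
- exact: theta_normed.
Qed.

Lemma qpoch_odd q n : 0 < q -> q < 1 ->
  \prod_(i < n) (1 - q ^+ (2 * i).+1) = qpoch q (2 * n) / qpoch (q ^+ 2) n.
Proof.
move=> q0 q1; have q20 : 0 < q ^+ 2 by rewrite exprn_gt0.
have q21 : q ^+ 2 < 1 by rewrite exprn_ilt1// ltW.
elim: n => [|n IH]; first by rewrite big_ord0 !qpoch0 divr1.
rewrite big_ord_recr/= IH (_ : (2 * n.+1 = (2 * n).+2)%N); last by lia.
rewrite !qpochS -exprM (_ : (2 * n.+1 = (2 * n).+2)%N); last by lia.
have h1 := lt0r_neq0 (qpoch_gt0 q20 q21 n).
have h2 := lt0r_neq0 (subr_exp_gt0 q0 q1 (2 * n).+1).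
by field; rewrite h1 h2.
Qed.

Lemma qpoch_odd_cvg q : 0 < q -> q < 1 ->
  \prod_(i < n) (1 - q ^+ (2 * i).+1) @[n --> \oo] --> qinf q / qinf (q ^+ 2).
Proof.
move=> q0 q1; have q20 : 0 < q ^+ 2 by rewrite exprn_gt0.
have q21 : q ^+ 2 < 1 by rewrite exprn_ilt1// ltW.
under eq_fun do rewrite qpoch_odd//.
apply: cvgM; first by apply: cvg_double; exact: qpoch_cvg.
by apply: cvgV; [rewrite gt_eqF// qinf_gt0|exact: qpoch_cvg].
Qed.

Lemma theta_neg q : 0 < q -> q < 1 -> theta (- q) = qinf q ^+ 2 / qinf (q ^+ 2).
Proof.
move=> q0 q1; have q20 : 0 < q ^+ 2 by rewrite exprn_gt0.
have q21 : q ^+ 2 < 1 by rewrite exprn_ilt1// ltW.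
have h := @theta_triple_product q true q0 q1; rewrite expr1 mulN1r in h.
have h' : \prod_(i < n) (1 + -1 * q ^+ (2 * i).+1) ^+ 2 @[n --> \oo] --> (qinf q / qinf (q ^+ 2)) ^+ 2.
  under eq_fun do under eq_bigr do rewrite mulN1r.
  under eq_fun do rewrite prodrXl.
  apply: (@cvg_comp _ _ _ _ (fun x => x ^+ 2) _ _ _ (qpoch_odd_cvg q0 q1)).
  exact: exprn_continuous.
have := cvg_unique _ h h'; move=> /(_ (@Rhausdorff R)) E.
have n1 := lt0r_neq0 (qinf_gt0 q20 q21).
by rewrite -[LHS](mulVKf n1) E; field.
Qed.

(** Uses 1 + z = (1 - z^2)/(1 - z) for each odd power z of q. *)
Lemma theta_pos q : 0 < q -> q < 1 ->
  theta q = qinf (q ^+ 2) ^+ 5 / (qinf q ^+ 2 * qinf (q ^+ 4) ^+ 2).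
Proof.
move=> q0 q1; have q20 : 0 < q ^+ 2 by rewrite exprn_gt0.
have q21 : q ^+ 2 < 1 by rewrite exprn_ilt1// ltW.
have q4 : q ^+ 4 = (q ^+ 2) ^+ 2 by rewrite -exprM.
have q40 : 0 < q ^+ 4 by rewrite exprn_gt0.
have q41 : q ^+ 4 < 1 by rewrite exprn_ilt1// ltW.
have n0 := lt0r_neq0 (qinf_gt0 q0 q1).
have n1 := lt0r_neq0 (qinf_gt0 q20 q21).
have n2 := lt0r_neq0 (qinf_gt0 q40 q41).
have h := @theta_triple_product q false q0 q1; rewrite expr0 mul1r in h.
have h' : \prod_(i < n) (1 + 1 * q ^+ (2 * i).+1) ^+ 2 @[n --> \oo] -->
    ((qinf (q ^+ 2) / qinf (q ^+ 4)) / (qinf q / qinf (q ^+ 2))) ^+ 2.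
  have E n : \prod_(i < n) (1 + 1 * q ^+ (2 * i).+1) ^+ 2 =
     (\prod_(i < n) (1 - (q ^+ 2) ^+ (2 * i).+1) / \prod_(i < n) (1 - q ^+ (2 * i).+1)) ^+ 2.
    rewrite prodrXl; congr (_ ^+ 2); rewrite -[RHS]prodf_div; apply: eq_bigr => i _.
    have d := lt0r_neq0 (subr_exp_gt0 q0 q1 (2 * i)).
    have -> : (q ^+ 2) ^+ (2 * i).+1 = (q ^+ (2 * i).+1) ^+ 2 by rewrite -[LHS]exprM -[RHS]exprM mulnC.
    rewrite mul1r; move: (q ^+ _) d => z d.
    by field.
  under eq_fun do rewrite E.
  have c : \prod_(i < n) (1 - (q ^+ 2) ^+ (2 * i).+1) / \prod_(i < n) (1 - q ^+ (2 * i).+1)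
      @[n --> \oo] --> (qinf (q ^+ 2) / qinf (q ^+ 4)) / (qinf q / qinf (q ^+ 2)).
    apply: cvgM; first by rewrite q4; exact: qpoch_odd_cvg.
    by apply: cvgV; [rewrite mulf_neq0// invr_neq0|exact: qpoch_odd_cvg].
  apply: (@cvg_comp _ _ _ _ (fun x => x ^+ 2) _ _ _ c).
  exact: exprn_continuous.
have := cvg_unique _ h h'; move=> /(_ (@Rhausdorff R)) E.
rewrite -[LHS](mulVKf n1) E; field.
by rewrite n0 n1 n2.
Qed.

End theta.

(** * Quadratic identities between theta series *)

Section theta_squares.
Context {R : realType}.
Implicit Types (q x : R).

(** Odd powers cancel, and the square of 2 n is 4 n^2. *)
Lemma theta_even q : 0 < q -> q < 1 -> theta q + theta (- q) = 2 * theta (q ^+ 4).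
Proof.
move=> q0 q1.
have n1 : `|q| < 1 by rewrite gtr0_norm.
have n2 : `|- q| < 1 by rewrite normrN gtr0_norm.
have n4 : `|q ^+ 4| < 1 by rewrite normrX exprn_ilt1.
have h1 := cvg_double (theta_cvg n1).
have h2 := cvg_double (theta_cvg n2).
have H : \sum_(0 <= j < 2 * n) sqmult j * q ^+ (j * j) + \sum_(0 <= j < 2 * n) sqmult j * (- q) ^+ (j * j)
    @[n --> \oo] --> theta q + theta (- q) by exact: cvgD.
have H' : \sum_(0 <= j < 2 * n) sqmult j * q ^+ (j * j) + \sum_(0 <= j < 2 * n) sqmult j * (- q) ^+ (j * j)
    @[n --> \oo] --> 2 * theta (q ^+ 4).
  have E n : \sum_(0 <= j < 2 * n) sqmult j * q ^+ (j * j) + \sum_(0 <= j < 2 * n) sqmult j * (- q) ^+ (j * j)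
     = 2 * \sum_(0 <= j < n) sqmult j * (q ^+ 4) ^+ (j * j).
    elim: n => [|n IH]; first by rewrite !big_geq// addr0 mulr0.
    rewrite (_ : (2 * n.+1 = (2 * n).+2)%N); last by lia.
    rewrite !big_nat_recr//= [RHS]mulrDr -IH.
    have -> : (- q) ^+ (2 * n * (2 * n)) = q ^+ (2 * n * (2 * n)).
      by rewrite -mulnA exprM sqrrN -exprM.
    have -> : (- q) ^+ ((2 * n).+1 * (2 * n).+1) = - q ^+ ((2 * n).+1 * (2 * n).+1).
      rewrite (_ : ((2 * n).+1 * (2 * n).+1 = (2 * (2 * n * n + 2 * n)).+1)%N); last by lia.
      by rewrite !exprS exprM sqrrN -exprM mulNr.
    have -> : (q ^+ 4) ^+ (n * n) = q ^+ (2 * n * (2 * n)).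
      by rewrite -exprM; congr (_ ^+ _); lia.
    have -> : sqmult (2 * n) = sqmult n :> R by rewrite /sqmult; case: n {IH}.
    ring.
  under eq_fun do rewrite E.
  by apply: cvgM; [exact: cvg_cst|exact: theta_cvg].
exact: (cvg_unique (@Rhausdorff R) H H').
Qed.

Lemma esumZl (T : choiceType) (S : set T) (a : T -> \bar R) (c : R) : 0 < c ->
  (forall i, (0 <= a i)%E) ->
  (\esum_(i in S) (c%:E * a i) = c%:E * (\esum_(i in S) a i))%E.
Proof.
move=> c0 a0.
have le (b : T -> \bar R) (d : R) : 0 < d -> (forall i, (0 <= b i)%E) ->
    (d%:E * (\esum_(i in S) b i) <= \esum_(i in S) (d%:E * b i))%E.
  move=> d0 b0; rewrite muleC -lee_pdivlMr//; apply: ge_ereal_sup => _ [X [finX XS] <-].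
  rewrite lee_pdivlMr// muleC; apply: ereal_sup_ubound; exists X => //.
  by rewrite ge0_mule_fsumr.
apply/eqP; rewrite eq_le le// andbT.
have V0 : 0 < c^-1 by rewrite invr_gt0.
rewrite muleC -lee_pdivrMr// muleC; apply: le_trans (le _ _ V0 _) _.
  by move=> i; rewrite mule_ge0// lee_fin ltW.
apply: le_esum => i _; rewrite muleA -EFinM mulVf ?gt_eqF// mul1e//.
Qed.

Lemma dvdz2B (a b : int) : (2 %| a - b)%Z = ((2 %| a)%Z == (2 %| b)%Z).
Proof. lia. Qed.

(** The change of lattice behind [theta_sqr]. *)
Lemma set_bij_sum_diff : set_bij ([set: int] `*` [set: int])
  [set k : int * int | (2 %| k.1 - k.2)%Z] (fun k => (k.1 + k.2, k.1 - k.2)).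
Proof.
split=> [[m n] _|[m n] [m' n'] _ _ /= [h1 h2]|[a b] /= h].
- by rewrite /=; apply/dvdzP; exists n; ring.
- by congr pair; lia.
- have := divzK h; move: (_ %/ _)%Z => m E.
  by exists (b + m, m) => //=; congr pair; lia.
Qed.

Definition absz_sqr (n : int) : nat := absz (n * n)%R.

Lemma absz_sqrE n : (absz_sqr n)%:Z = n * n.
Proof. by rewrite /absz_sqr gez0_abs// -expr2 sqr_ge0. Qed.

(** Bilateral theta series restricted to S. *)
Definition zsum x (S : set int) : \bar R := (\esum_(n in S) (x ^+ absz_sqr n)%:E)%E.

Lemma zsum_theta x : 0 < x -> x < 1 -> zsum x setT = (theta x)%:E.
Proof.
move=> x0 x1; have xn : `|x| < 1 by rewrite gtr0_norm.
pose s : R := (theta x + 1) / 2.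
have p0 n : (0 <= (x ^+ (n * n))%:E)%E by rewrite lee_fin exprn_ge0// ltW.
have hs : \sum_(0 <= j < n) x ^+ (j * j) @[n --> \oo] --> s.
  have H : (\sum_(0 <= j < n.+1) sqmult j * x ^+ (j * j) + 1) / 2 @[n --> \oo] --> s.
    apply: cvgM; last exact: cvg_cst.
    apply: cvgD; last exact: cvg_cst.
    by rewrite (cvg_shiftS (fun n => \sum_(0 <= j < n) sqmult j * x ^+ (j * j))); exact: theta_cvg.
  rewrite -(cvg_shiftS (fun n => \sum_(0 <= j < n) x ^+ (j * j)))/=.
  rewrite (_ : (fun n => _) = (fun n => (\sum_(0 <= j < n.+1) sqmult j * x ^+ (j * j) + 1) / 2))//.
  apply/funext => n; rewrite big_nat_recl//= [in RHS]big_nat_recl//= /sqmult/= expr0 mul1r.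
  by rewrite -mulr_sumr; field.
have E1 : (\esum_(j in [set: nat]) (x ^+ (j * j))%:E = s%:E)%E.
  rewrite -nneseries_esumT//; apply/cvg_lim => //.
  under eq_fun do rewrite sumEFin.
  by apply: cvg_EFin => //; exact: nearW.
have E2 : (\esum_(j in [set: nat]) (x ^+ (j.+1 * j.+1))%:E = (s - 1)%:E)%E.
  rewrite -nneseries_esumT//; apply/cvg_lim => //.
  under eq_fun do rewrite sumEFin.
  apply: cvg_EFin; first exact: nearW.
  rewrite (_ : _ \o _ = (fun n => \sum_(0 <= j < n.+1) x ^+ (j * j) - 1)).
    apply: cvgB; last exact: cvg_cst.
    by rewrite (cvg_shiftS (fun n => \sum_(0 <= j < n) x ^+ (j * j))).
  by apply/funext => n /=; rewrite [in RHS]big_nat_recl//= expr0 addrC addKr.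
have z0 n : (0 <= (x ^+ absz_sqr n)%:E)%E by rewrite lee_fin exprn_ge0// ltW.
rewrite /zsum (esumID [set n : int | 0 <= n])// !setTI.
rewrite (@reindex_esum R _ _ [set: nat] _ Posz); last first.
  split=> [n _ //|n m _ _ [] //|n /= n0]; exists `|n|%N => //; exact: gez0_abs.
rewrite [X in (_ + X)%E](@reindex_esum R _ _ [set: nat] _ Negz); last first.
  by split=> [n _ //|n m _ _ [] //|[n /= n0|n _]]; [exfalso; exact: n0|exists n].
rewrite (eq_esum (b := fun j => (x ^+ (j * j))%:E)); last first.
  by move=> j _; congr ((_ ^+ _)%:E); apply/eqP; rewrite -eqz_nat absz_sqrE.
rewrite E1 [X in (_ + X)%E](eq_esum (b := fun j => (x ^+ (j.+1 * j.+1))%:E)); last first.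
  by move=> j _; congr ((_ ^+ _)%:E); apply/eqP; rewrite -eqz_nat absz_sqrE NegzE mulrNN.
by rewrite E2 -EFinD; congr (_%:E); rewrite /s; field.
Qed.

Lemma zsum_square x (S : set int) (s : R) : 0 < x -> 0 < s -> zsum x S = s%:E ->
  (\esum_(k in S `*` S) (x ^+ (absz_sqr k.1 + absz_sqr k.2))%:E = (s * s)%:E)%E.
Proof.
move=> x0 s0 Es.
have z0 n : (0 <= (x ^+ n)%:E)%E by rewrite lee_fin exprn_ge0// ltW.
rewrite (_ : S `*` S = S `*`` (fun=> S))//.
rewrite -(esum_esum (a := fun i j => (x ^+ (absz_sqr i + absz_sqr j))%:E))//.
rewrite (eq_esum (b := fun i => (s%:E * (x ^+ absz_sqr i)%:E)%E)); last first.
  move=> i _; rewrite -Es muleC -esumZl ?exprn_gt0//.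
  by apply: eq_esum => j _; rewrite exprD EFinM.
by rewrite esumZl// -/(zsum x S) Es EFinM.
Qed.

Lemma theta_gt0 q : 0 < q -> q < 1 -> 0 < theta q.
Proof.
move=> q0 q1; have h n : 0 < qinf (q ^+ n.+1).
  by apply: qinf_gt0; rewrite ?exprn_gt0// exprn_ilt1// ltW.
rewrite (theta_pos q0 q1); apply: divr_gt0; first by apply: exprn_gt0; exact: (h 1%N).
apply: mulr_gt0; apply: exprn_gt0; last exact: (h 3%N).
exact: (qinf_gt0 q0 q1).
Qed.

Definition evenz : set int := [set n | (2 %| n)%Z].

Lemma zsum_even q : 0 < q -> q < 1 -> zsum q evenz = (theta (q ^+ 4))%:E.
Proof.
move=> q0 q1; rewrite -zsum_theta ?exprn_gt0 ?exprn_ilt1 ?(ltW q0)//.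
rewrite /zsum (@reindex_esum R _ _ [set: int] _ (fun n : int => (n + n)%R)); last first.
  split=> [n _|n m _ _|n /= n2]; rewrite /evenz/=; [lia|lia|].
  by exists (n %/ 2)%Z => //; have := divzK n2; lia.
apply: eq_esum => n _; congr (_%:E); rewrite -exprM; congr (_ ^+ _).
by apply/eqP; rewrite -eqz_nat PoszM !absz_sqrE; apply/eqP; ring.
Qed.

Lemma zsum_odd q : 0 < q -> q < 1 -> zsum q (~` evenz) = (theta q - theta (q ^+ 4))%:E.
Proof.
move=> q0 q1; have z0 n : (0 <= (q ^+ n)%:E)%E by rewrite lee_fin exprn_ge0// ltW.
have := zsum_theta q0 q1; rewrite /zsum (esumID evenz)// !setTI -/(zsum q evenz) zsum_even//.
by move=> E; rewrite EFinB -E addeAC subee ?add0e.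
Qed.

Lemma theta_lt q : 0 < q -> q < 1 -> theta (q ^+ 4) < theta q.
Proof.
move=> q0 q1; rewrite -subr_gt0 -lte_fin -zsum_odd//.
apply: (@lt_le_trans _ _ q%:E); first by rewrite lte_fin.
apply: esum_ge; exists [set 1 : int]; last by rewrite fsbig_set1.
by split=> // _ ->.
Qed.

(** (m + n)^2 + (m - n)^2 = 2 (m^2 + n^2), and (m + n, m - n) runs over the pairs
    of integers of equal parity: both even, or both odd. *)
Lemma theta_sqr q : 0 < q -> q < 1 ->
  theta (q ^+ 4) ^+ 2 + (theta q - theta (q ^+ 4)) ^+ 2 = theta (q ^+ 2) ^+ 2.
Proof.
move=> q0 q1.
have q20 : 0 < q ^+ 2 by rewrite exprn_gt0.
have q21 : q ^+ 2 < 1 by rewrite exprn_ilt1// ltW.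
have q40 : 0 < q ^+ 4 by rewrite exprn_gt0.
have q41 : q ^+ 4 < 1 by rewrite exprn_ilt1// ltW.
have z0 n : (0 <= (q ^+ n)%:E)%E by rewrite lee_fin exprn_ge0// ltW.
have Eev := zsum_even q0 q1; have Eod := zsum_odd q0 q1.
have u0 : 0 < theta (q ^+ 4) by exact: theta_gt0.
have v0 : 0 < theta q - theta (q ^+ 4) by rewrite subr_gt0 theta_lt.
have E1 := zsum_square q0 u0 Eev.
have E2 := zsum_square q0 v0 Eod.
have t0 : 0 < theta (q ^+ 2) by exact: theta_gt0.
have E3 := zsum_square q20 t0 (zsum_theta q20 q21).
apply/eqP; rewrite -eqe EFinD !expr2 -E1 -E2 -E3; apply/eqP.
pose Q := [set k : int * int | (2 %| k.1 - k.2)%Z].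
rewrite [RHS](_ : _ = \esum_(k in Q) (q ^+ (absz_sqr k.1 + absz_sqr k.2))%:E)%E; last first.
  rewrite [RHS](reindex_esum _ _ _ _ set_bij_sum_diff).
  apply: eq_esum => -[m n] _ /=; congr (_%:E); rewrite -exprM; congr (_ ^+ _).
  by apply/eqP; rewrite -eqz_nat PoszM !PoszD !absz_sqrE; apply/eqP; ring.
rewrite [RHS](esumID (evenz `*` [set: int]))//; congr (_ + _)%E; congr (esum _ _).
  apply/seteqP; split=> -[a b]; rewrite /Q /evenz/= dvdz2B.
    by move=> [-> ->].
  by move=> [/eqP <- [-> _]].
apply/seteqP; split=> -[a b]; rewrite /Q /evenz/= dvdz2B.
  by move=> [/negP/negbTE-> /negP/negbTE->]; split => // -[].
move=> [/eqP h1 h2]; have h3 : ~~ (2 %| a)%Z by apply/negP => h; apply: h2.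
by rewrite -h1; split; exact/negP.
Qed.

End theta_squares.

(** * Doubling of the nome *)

Section nome.
Context {R : realType}.
Implicit Types (q x : R).

(** h takes the same value at q, q^2, q^4, ..., which tend to 0. *)
Lemma nome_doubling (h : R -> R) (l : R) :
  (forall q, 0 < q -> q < 1 -> h (q ^+ 2) = h q) ->
  h x @[x --> 0^'+] --> l -> forall q, 0 < q -> q < 1 -> h q = l.
Proof.
move=> hh hl q q0 q1.
have qn n : 0 < q ^+ (2 ^ n) /\ q ^+ (2 ^ n) < 1.
  by rewrite exprn_gt0// exprn_ilt1 ?(ltW q0)// -lt0n expn_gt0.
have hq n : h (q ^+ (2 ^ n)) = h q.
  elim: n => [|n IH]; first by rewrite expr1.
  by rewrite expnSr exprM; have [h1 h2] := qn n; rewrite hh.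
have q20 : q ^+ (2 ^ n) @[n --> \oo] --> (0 : R).
  apply: (@cvg_comp _ _ _ (fun n : nat => (2 ^ n)%N) (fun n => q ^+ n) \oo \oo (nbhs (0 : R))).
    move=> X [N _ HN]; exists N => // n /= Nn; apply: HN => /=.
    by apply: (leq_trans Nn); apply: ltnW; exact: ltn_expl.
  by apply: cvg_expr; rewrite gtr0_norm.
apply/eqP/negPn/negP => hql; have e0 : 0 < `|l - h q| by rewrite normr_gt0 subr_eq0 eq_sym.
move/cvgrPdist_lt : hl => /(_ _ e0) [d /= d0 Hd].
move/cvgrPdist_lt : q20 => /(_ _ d0) [N _ HN].
have [h1 h2] := qn N.
have := Hd (q ^+ (2 ^ N)) (HN N (leqnn N)) h1.
by rewrite hq ltxx.
Qed.

(** The squares of Jacobi's theta_3, theta_4 and theta_2; the last one is given by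
    its product because of the fractional power of q. *)
Definition thA q : R := theta q ^+ 2.
Definition thB q : R := theta (- q) ^+ 2.
Definition thC q : R := 4 * Num.sqrt q * (qinf (q ^+ 4) ^+ 2 / qinf (q ^+ 2)) ^+ 2.

Section doubling.
Variable q : R.
Hypotheses (q0 : 0 < q) (q1 : q < 1).

Let qX0 n : 0 < q ^+ n. Proof. exact: exprn_gt0. Qed.
Let qX1 n : q ^+ n.+1 < 1. Proof. by rewrite exprn_ilt1// ltW. Qed.
Let P0 n : 0 < qinf (q ^+ n.+1). Proof. exact: qinf_gt0. Qed.
Let P00 : 0 < qinf q. Proof. exact: qinf_gt0. Qed.

Lemma thetaN_gt0 : 0 < theta (- q).
Proof. by rewrite (theta_neg q0 q1); apply: divr_gt0; [exact: exprn_gt0|exact: (P0 1)]. Qed.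

Lemma thA_gt0 : 0 < thA q. Proof. exact/exprn_gt0/theta_gt0. Qed.
Lemma thB_gt0 : 0 < thB q. Proof. exact/exprn_gt0/thetaN_gt0. Qed.
Lemma thC_gt0 : 0 < thC q.
Proof.
apply: mulr_gt0; first by rewrite mulr_gt0// sqrtr_gt0.
by apply: exprn_gt0; apply: divr_gt0; [apply: exprn_gt0; exact: (P0 3)|exact: (P0 1)].
Qed.

(** Doubling turns (A, B) into their arithmetic and geometric means. *)
Lemma thA_double : thA (q ^+ 2) = (thA q + thB q) / 2.
Proof.
rewrite /thA /thB -theta_sqr//.
have := theta_even q0 q1; move: (theta q) (theta (- q)) (theta (q ^+ 4)) => x y u E.
have -> : y = 2 * u - x by rewrite -E addrC addKr.
by field.
Qed.

Lemma thB_double : thB (q ^+ 2) ^+ 2 = thA q * thB q.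
Proof.
rewrite /thB /thA theta_neg ?qX0 ?(qX1 1)// theta_neg// theta_pos// -(exprM q).
have n1 := lt0r_neq0 (P0 1); have n3 := lt0r_neq0 (P0 3); have n0 := lt0r_neq0 P00.
by field; rewrite n1 n3 n0.
Qed.

Lemma thC_double : thC q ^+ 2 = 4 * thA (q ^+ 2) * thC (q ^+ 2).
Proof.
rewrite /thC /thA theta_pos ?qX0 ?(qX1 1)// -!(exprM q).
have n1 := lt0r_neq0 (P0 1); have n3 := lt0r_neq0 (P0 3); have n7 := lt0r_neq0 (P0 7).
rewrite sqrtr_sqr (gtr0_norm q0) !exprMn sqr_sqrtr ?(ltW q0)//.
by field; rewrite n1 n3 n7.
Qed.

Lemma thB_lt_thA : thB q < thA q.
Proof.
rewrite /thB /thA ltr_pXn2r// ?nnegrE; [|exact: ltW thetaN_gt0|exact/ltW/theta_gt0].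
have := theta_lt q0 q1; have := theta_even q0 q1.
by move: (theta q) (theta (- q)) (theta (q ^+ 4)) => x y u; lra.
Qed.

End doubling.
End nome.

(** * Behaviour at the cusp *)

Section limits.
Context {R : realType}.
Implicit Types (q x : R).

Lemma near_nome : \forall q \near (0:R)^'+, 0 < q < 1.
Proof.
near=> q; apply/andP; split; near: q; first exact: nbhs_right_gt.
exact: nbhs_right_lt.
Unshelve. all: by end_near.
Qed.

Lemma cvg_right_cont (f : R -> R) (l : R) : {for 0, continuous f} -> f 0 = l -> f x @[x --> 0^'+] --> l.
Proof. by move=> h <-; apply: cvg_at_right_filter; exact: h. Qed.

Lemma continuous0N (f : R -> R) : {for 0, continuous f} -> {for 0, continuous (fun x => f (- x))}.
Proof.
move=> h; apply: (@continuous_comp _ _ _ -%R f); first exact: opp_continuous.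
by rewrite oppr0.
Qed.

Let theta_at0 : {for (0:R), continuous theta}.
Proof. by apply: theta_continuous; rewrite normr0. Qed.

Let dtheta_at0 : {for (0:R), continuous dtheta}.
Proof. by apply: dtheta_continuous; rewrite normr0. Qed.

Lemma theta_cvg0 : theta x @[x --> (0:R)^'+] --> (1:R).
Proof. by apply: cvg_right_cont; [|exact: theta0]. Qed.

Lemma thetaN_cvg0 : theta (- x) @[x --> (0:R)^'+] --> (1:R).
Proof. by apply: cvg_right_cont; [exact: continuous0N|rewrite oppr0; exact: theta0]. Qed.

Lemma dtheta_cvg0 : dtheta x @[x --> (0:R)^'+] --> (2:R).
Proof. by apply: cvg_right_cont; [|exact: dtheta0]. Qed.

Lemma dthetaN_cvg0 : dtheta (- x) @[x --> (0:R)^'+] --> (2:R).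
Proof. by apply: cvg_right_cont; [exact: continuous0N|rewrite oppr0; exact: dtheta0]. Qed.

Lemma thA_cvg0 : thA x @[x --> (0:R)^'+] --> (1:R).
Proof. by have := cvgM theta_cvg0 theta_cvg0; rewrite mulr1; move=> h; exact: h. Qed.

Lemma thB_cvg0 : thB x @[x --> (0:R)^'+] --> (1:R).
Proof. by have := cvgM thetaN_cvg0 thetaN_cvg0; rewrite mulr1; move=> h; exact: h. Qed.

Lemma qinf_cvg0 n : qinf (x ^+ n.+1) @[x --> (0:R)^'+] --> (1:R).
Proof.
pose g (x : R) := expR (- (x ^+ n.+1 / (1 - x ^+ n.+1) ^+ 2)).
apply: (@squeeze_cvgr _ _ _ _ g (fun=> 1)); last exact: cvg_cst.
  near=> x; have /andP[x0 x1] : 0 < x < 1 by near: x; exact: near_nome.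
  have y0 : 0 < x ^+ n.+1 by rewrite exprn_gt0.
  have y1 : x ^+ n.+1 < 1 by rewrite exprn_ilt1// ltW.
  by rewrite /g (qinf_lower y0 y1) (qinf_le1 y0 y1).
apply: cvg_right_cont; last by rewrite /g expr0n/= mul0r oppr0 expR0.
rewrite /g; apply: continuous_comp; last exact: continuous_expR.
have h : {for 0, continuous (fun x : R => x ^+ n.+1)} by exact: exprn_continuous.
apply: cvgN; apply: cvgM; first exact: h.
apply: cvgV; first by rewrite expr0n/= subr0 expr1n oner_neq0.
by apply: cvgM; (apply: cvgB; [exact: cvg_cst|exact: h]).
Unshelve. all: by end_near.
Qed.

(** [thC] without its vanishing factor [sqrt q]. *)
Definition thC_unit (q : R) := 4 * (qinf (q ^+ 4) ^+ 2 / qinf (q ^+ 2)) ^+ 2.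

Lemma thC_unit_cvg0 : thC_unit x @[x --> (0:R)^'+] --> (4:R).
Proof.
have -> : (4:R) = 4 * (1 ^+ 2 / 1) ^+ 2 by rewrite expr1n divr1 expr1n mulr1.
have h : qinf (x ^+ 4) ^+ 2 / qinf (x ^+ 2) @[x --> (0:R)^'+] --> (1 ^+ 2 / 1 : R).
  apply: cvgM; first by apply: cvgM; exact: (qinf_cvg0 3).
  by apply: cvgV; [exact: oner_neq0|exact: (qinf_cvg0 1)].
by apply: cvgM; [exact: cvg_cst|apply: cvgM; exact: h].
Qed.

Lemma thC_unit_gt0 q : 0 < q -> q < 1 -> 0 < thC_unit q.
Proof.
move=> q0 q1; have h n : 0 < qinf (q ^+ n.+1).
  by apply: qinf_gt0; rewrite ?exprn_gt0// exprn_ilt1// ltW.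
apply: mulr_gt0 => //; apply: exprn_gt0; apply: divr_gt0; last exact: (h 1%N).
by apply: exprn_gt0; exact: (h 3%N).
Qed.

Lemma thC_factor q : thC q = Num.sqrt q * thC_unit q.
Proof. rewrite /thC /thC_unit; move: ((_ / _) ^+ 2) (Num.sqrt q) => Z s; ring. Qed.

Lemma thC_cvg0 : thC x @[x --> (0:R)^'+] --> (0:R).
Proof.
under eq_fun do rewrite thC_factor.
have h : Num.sqrt x @[x --> (0:R)^'+] --> (0:R).
  by apply: cvg_right_cont; [exact: sqrt_continuous|exact: sqrtr0].
by have := cvgM h thC_unit_cvg0; rewrite mul0r; move=> h'; exact: h'.
Qed.

(** The derivative at 0 of theta^4(x) - theta^4(-x). *)
Lemma diff_quot_cvg0 : (thA x ^+ 2 - thB x ^+ 2) / x @[x --> (0:R)^'+] --> (16:R).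
Proof.
have n0 : `|0 : R| < 1 by rewrite normr0.
have D1 := is_derive_theta n0.
have D2 : is_derive (0:R) 1 (fun x => theta (- x)) (- dtheta 0).
  have D0 : is_derive (- 0:R) 1 theta (dtheta 0) by rewrite oppr0.
  have := is_derive1_comp (g := -%R) (f := theta) (x := 0) D0 _ .
  by move=> /(_ (-1) _) H; rewrite -mulN1r mulrC; apply: H.
have D : is_derive (0:R) 1 (fun x => thA x ^+ 2 - thB x ^+ 2) 16.
  rewrite /thA /thB; apply: is_derive_eq.
  rewrite oppr0 theta0 dtheta0; rewrite /GRing.scale/=; ring.
have := @ex_derive _ _ _ _ _ _ _ D => /cvg_ex[l hl].
have E : l = 16.
  rewrite -[RHS](@derive_val _ _ _ _ _ _ _ D) /derive; symmetry; apply/cvg_lim => //.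
rewrite E in hl.
have := cvg_dnbhs_at_right hl.
apply: cvg_trans; apply: near_eq_cvg; near=> x.
rewrite /= addr0 /GRing.scale/= mulr1 /thA /thB oppr0 theta0 expr1n subrr subr0.
by rewrite mulrC.
Unshelve. all: by end_near.
Qed.

End limits.

(** * Jacobi's quartic identity and the two periods *)

Section modular.
Context {R : realType}.
Implicit Types (q x : R).

Lemma ln_nome_lt0 q : 0 < q -> q < 1 -> ln q < 0.
Proof. by move=> q0 q1; rewrite ln_lt0// q0. Qed.

Lemma invln_cvg0 : (ln x)^-1 @[x --> (0:R)^'+] --> (0:R).
Proof.
apply/cvgrPdist_lt => e e0; near=> x.
have /andP[x0 x1] : 0 < x < 1 by near: x; exact: near_nome.
have l0 := ln_nome_lt0 x0 x1.
rewrite sub0r normrN normfV ltr0_norm// -[e]invrK ltf_pV2 ?posrE ?invr_gt0 ?oppr_gt0//.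
rewrite ltrNr -(expRK (- e^-1)) ltr_ln ?posrE ?expR_gt0//.
near: x; apply: nbhs_right_lt; exact: expR_gt0.
Unshelve. all: by end_near.
Qed.

(** The quotient D of the two sides satisfies D(q^2) = D(q)^2, so ln D / ln q is
    invariant under doubling; it tends to 0 since D tends to 1. *)
Lemma thC_sqr q : 0 < q -> q < 1 -> thC q ^+ 2 = thA q ^+ 2 - thB q ^+ 2.
Proof.
move=> q0 q1.
pose D (x : R) := thC x ^+ 2 / (thA x ^+ 2 - thB x ^+ 2).
have dpos x : 0 < x -> x < 1 -> 0 < thA x ^+ 2 - thB x ^+ 2.
  move=> x0 x1; rewrite subr_gt0 ltr_pXn2r// ?nnegrE; first exact: thB_lt_thA.
    by apply/ltW/thB_gt0.
  by apply/ltW/thA_gt0.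
have Dpos x : 0 < x -> x < 1 -> 0 < D x.
  by move=> x0 x1; apply: divr_gt0; [apply: exprn_gt0; exact: thC_gt0|exact: dpos].
have D2 x : 0 < x -> x < 1 -> D (x ^+ 2) = D x ^+ 2.
  move=> x0 x1; rewrite /D thB_double// thA_double//.
  have E := thC_double x0 x1; rewrite thA_double// in E.
  have A0 := thA_gt0 x0 x1; have B0 := thB_gt0 x0 x1; have BA := thB_lt_thA x0 x1.
  move: (thA x) (thB x) (thC x) (thC (x ^+ 2)) A0 B0 BA E => a b c c2 A0 B0 BA E.
  have -> : c2 = c ^+ 2 / (2 * (a + b)) by rewrite E; field; lra.
  field; do ?[apply/andP; split]; nra.
have Dl : D x @[x --> (0:R)^'+] --> (1:R).
  have h : (thC_unit x ^+ 2) / ((thA x ^+ 2 - thB x ^+ 2) / x) @[x --> (0:R)^'+] --> (4 * 4 / 16 : R).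
    apply: cvgM; first by apply: cvgM; exact: thC_unit_cvg0.
    by apply: cvgV; [lra|exact: diff_quot_cvg0].
  have E16 : 4 * 4 / 16 = 1 :> R by field.
  rewrite E16 in h; apply: cvg_trans h; apply: near_eq_cvg; near=> x.
  have /andP[x0 x1] : 0 < x < 1 by near: x; exact: near_nome.
  rewrite /D thC_factor (exprMn _ (Num.sqrt x)) sqr_sqrtr ?(ltW x0)// invfM invrK.
  have := dpos x x0 x1; move: (_ - _) (thC_unit x) => d r d0.
  by field; rewrite gt_eqF.
have h q' : 0 < q' -> q' < 1 -> ln (D q') * (ln q')^-1 = 0.
  move=> h0 h1; apply: (@nome_doubling _ (fun x => ln (D x) * (ln x)^-1) _ _ _ _ h0 h1).
    move=> x x0 x1; rewrite (D2 x x0 x1) (lnXn 2 (Dpos x x0 x1)) (lnXn 2 x0).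
    by have := ln_nome_lt0 x0 x1; move: (ln x) (ln (D x)) => l m l0; field; lra.
  have hD : ln (D x) @[x --> (0:R)^'+] --> (ln 1 : R).
    by apply: (cvg_comp _ _ Dl); apply: continuous_ln.
  rewrite ln1 in hD; by have := cvgM hD invln_cvg0; rewrite mulr0; move=> H; exact: H.
have /eqP := h _ q0 q1.
rewrite mulf_eq0 invr_eq0 (lt_eqF (ln_nome_lt0 q0 q1)) orbF (ln_eq0 (Dpos _ q0 q1)) => /eqP e.
by rewrite -[RHS]mul1r -e /D divfK//; apply/lt0r_neq0/dpos.
Unshelve. all: by end_near.
Qed.

Lemma thC_double_sub q : 0 < q -> q < 1 -> thC (q ^+ 2) = (thA q - thB q) / 2.
Proof.
move=> q0 q1; have E := thC_double q0 q1; rewrite thC_sqr// thA_double// in E.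
have A0 := thA_gt0 q0 q1; have B0 := thB_gt0 q0 q1.
apply: (@mulfI _ (2 * (thA q + thB q))); first by lra.
by move: E; move: (thA q) (thB q) (thC _) => a b c E; lra.
Qed.

(** Doubling is an arithmetic-geometric step, which preserves the integral; its
    limit is the integral at A = B = 1. *)
Lemma ellint_AB q : 0 < q -> q < 1 -> ellint (thA q ^+ 2) (thB q ^+ 2) = pi%:E.
Proof.
have bd x : 0 < x -> x < 1 ->
   ((rsqrt (thA x ^+ 2) * pi)%:E <= ellint (thA x ^+ 2) (thB x ^+ 2) <= (rsqrt (thB x ^+ 2) * pi)%:E)%E.
  move=> x0 x1; apply: ellint_near_diag; first by apply: exprn_gt0; exact: thB_gt0.
  rewrite ler_pXn2r// ?nnegrE; apply/ltW; [exact: thB_lt_thA|exact: thB_gt0|exact: thA_gt0].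
have fn x : 0 < x -> x < 1 -> ellint (thA x ^+ 2) (thB x ^+ 2) \is a fin_num.
  move=> x0 x1; have /andP[h1 h2] := bd x x0 x1.
  by rewrite fin_numE -ltNye -ltey (lt_le_trans _ h1) ?ltNyr// (le_lt_trans h2) ?ltry.
move=> q0 q1; rewrite -[LHS]fineK ?fn//; congr (_%:E).
apply: (@nome_doubling _ (fun x => fine (ellint (thA x ^+ 2) (thB x ^+ 2))) _ _ _ _ q0 q1).
  move=> x x0 x1; rewrite (thA_double x0 x1) (thB_double x0 x1).
  by rewrite (ellint_landen (thA_gt0 x0 x1) (thB_gt0 x0 x1)).
have rs (f : R -> R) : f x @[x --> (0:R)^'+] --> (1:R) ->
    rsqrt (f x ^+ 2) * pi @[x --> (0:R)^'+] --> (pi : R).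
  move=> hf; have h : (rsqrt (1 ^+ 2) * pi : R) = pi by rewrite expr1n rsqrt1 mul1r.
  have H : rsqrt (f x ^+ 2) * pi @[x --> (0:R)^'+] --> (rsqrt (1 ^+ 2) * pi : R).
    apply: cvgM; last exact: cvg_cst.
    apply: cvgV; first by rewrite expr1n sqrtr1 oner_neq0.
    apply: (@cvg_comp _ _ _ (fun x => f x ^+ 2) Num.sqrt _ _ _); last exact: sqrt_continuous.
    by apply: cvgM.
  by rewrite h in H.
apply: (@squeeze_cvgr _ _ _ _ (fun x => rsqrt (thA x ^+ 2) * pi) (fun x => rsqrt (thB x ^+ 2) * pi)).
- near=> x; have /andP[x0 x1] : 0 < x < 1 by near: x; exact: near_nome.
  by rewrite -!lee_fin fineK ?fn//; exact: bd.
- exact/rs/thA_cvg0.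
- exact/rs/thB_cvg0.
Unshelve. all: by end_near.
Qed.

(** Doubling turns (A, C) into ((A + B)/2, (A - B)/2), whose arithmetic and
    geometric means are A/2 and C/2: the integral is multiplied by 2, like ln q.
    The logarithmic bounds give the limit of the quotient. *)
Lemma ellint_AC q : 0 < q -> q < 1 -> ellint (thA q ^+ 2) (thC q ^+ 2) = (- ln q)%:E.
Proof.
have bd x (x0 : 0 < x) (x1 : x < 1) := ellint_log_bounds (thA_gt0 x0 x1) (thC_gt0 x0 x1).
have fn x : 0 < x -> x < 1 -> ellint (thA x ^+ 2) (thC x ^+ 2) \is a fin_num.
  move=> x0 x1; have /andP[h1 h2] := bd x x0 x1.
  by rewrite fin_numE -ltNye -ltey (lt_le_trans _ h1) ?ltNyr// (le_lt_trans h2) ?ltry.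
pose L (x : R) := ln ((thA x + thC x) / thC x).
have Lc : L x * (- ln x)^-1 @[x --> (0:R)^'+] --> (2^-1 : R).
  have h0 : ln (thA x + thC x) @[x --> (0:R)^'+] --> (ln 1 : R).
    have h : thA x + thC x @[x --> (0:R)^'+] --> (1 : R).
      have := cvgD (@thA_cvg0 R) (@thC_cvg0 R).
      rewrite addr0; move=> h; exact: h.
    by apply: (cvg_comp _ _ h); apply: continuous_ln.
  rewrite ln1 in h0.
  have h1 : ln (thC_unit x) @[x --> (0:R)^'+] --> (ln 4 : R).
    by apply: (cvg_comp _ _ thC_unit_cvg0); apply: continuous_ln.
  have h2 : (ln (thC_unit x) - ln (thA x + thC x)) * (ln x)^-1 + 2^-1 @[x --> (0:R)^'+] --> (2^-1 : R).
    have := cvgD (cvgM (cvgB h1 h0) (@invln_cvg0)) (cvg_cst (2^-1 : R)).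
    by rewrite mulr0 add0r => h; exact: h.
  apply: cvg_trans h2; apply: near_eq_cvg; near=> x.
  have /andP[x0 x1] : 0 < x < 1 by near: x; exact: near_nome.
  have A0 := thA_gt0 x0 x1; have C0 := thC_gt0 x0 x1; have r0 := thC_unit_gt0 x0 x1.
  have s0 : 0 < Num.sqrt x by rewrite sqrtr_gt0.
  have -> : L x = ln (thA x + thC x) - ln (thC x).
    by rewrite /L ln_div ?posrE//; apply: addr_gt0.
  have -> : ln (thC x) = ln (Num.sqrt x) + ln (thC_unit x).
    by rewrite thC_factor lnM ?posrE.
  have -> : ln (Num.sqrt x) = ln x / 2.
    by rewrite -[in RHS](sqr_sqrtr (ltW x0)) lnXn//; field.
  have := ln_nome_lt0 x0 x1; move: (ln _) (ln _) (ln x) => u v l l0 /=.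
  by field; lra.
move=> q0 q1; have l0 := ln_nome_lt0 q0 q1.
rewrite -[LHS]fineK ?fn//; congr (_%:E).
suff : fine (ellint (thA q ^+ 2) (thC q ^+ 2)) * (- ln q)^-1 = 1.
  by move=> /(congr1 (fun z => z * (- ln q))); rewrite mul1r divfK// oppr_eq0 lt_eqF.
apply: (@nome_doubling _ (fun x => fine (ellint (thA x ^+ 2) (thC x ^+ 2)) * (- ln x)^-1) _ _ _ _ q0 q1).
  move=> x x0 x1.
  have x20 : 0 < x ^+ 2 by rewrite exprn_gt0.
  have x21 : x ^+ 2 < 1 by rewrite exprn_ilt1// ltW.
  rewrite -(ellint_landen (thA_gt0 x20 x21) (thC_gt0 x20 x21)).
  have -> : ((thA (x ^+ 2) + thC (x ^+ 2)) / 2) ^+ 2 = 4^-1 * thA x ^+ 2.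
    by rewrite (thA_double x0 x1) (thC_double_sub x0 x1); move: (thA x) (thB x) => a b; field.
  have -> : thA (x ^+ 2) * thC (x ^+ 2) = 4^-1 * thC x ^+ 2.
    by rewrite (thC_double x0 x1); move: (thA _) (thC _) => a b; field.
  rewrite ellint_scale; last by rewrite invr_gt0.
  have -> : rsqrt (4^-1) = 2 :> R.
    apply: eq_sqr_ge0; rewrite ?rsqrt_ge0// rsqrt_sqr ?invr_ge0// invrK; ring.
  rewrite fineM ?fn// lnXn// /=; have lx := ln_nome_lt0 x0 x1.
  by move: (fine _) (ln x) lx => e l lx; field; lra.
apply: (@squeeze_cvgr _ _ _ _
   (fun x => 2 * rsqrt (thA x * thC x + thA x ^+ 2) * (L x * (- ln x)^-1))
   (fun x => 2 / thA x * (L x * (- ln x)^-1 + pi * (- ln x)^-1))).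
- near=> x; have /andP[x0 x1] : 0 < x < 1 by near: x; exact: near_nome.
  have lx := ln_nome_lt0 x0 x1; have V0 : 0 <= (- ln x)^-1 by rewrite invr_ge0 oppr_ge0 ltW.
  have /andP[h1 h2] := bd x x0 x1.
  by apply/andP; split; rewrite -?mulrDl mulrA ler_wpM2r// -lee_fin fineK ?fn.
- have E : 2 * rsqrt (1 * 0 + 1 * 1) * 2^-1 = 1 :> R.
    by rewrite mulr0 add0r mul1r rsqrt1 mulr1 divff.
  have h : thA x * thC x + thA x ^+ 2 @[x --> (0:R)^'+] --> (1 * 0 + 1 * 1 : R).
    by apply: cvgD; apply: cvgM; (exact: thA_cvg0 || exact: thC_cvg0).
  have H : 2 * rsqrt (thA x * thC x + thA x ^+ 2) * (L x * (- ln x)^-1) @[x --> (0:R)^'+]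
      --> (2 * rsqrt (1 * 0 + 1 * 1) * 2^-1 : R).
    apply: cvgM; last exact: Lc.
    apply: cvgM; first exact: cvg_cst.
    apply: cvgV; first by rewrite mulr0 add0r mul1r sqrtr1 oner_neq0.
    by apply: (cvg_comp _ _ h); exact: sqrt_continuous.
  by rewrite E in H.
- have E : 2 / 1 * (2^-1 + pi * (- 0)) = 1 :> R by field.
  have H : 2 / thA x * (L x * (- ln x)^-1 + pi * (- ln x)^-1) @[x --> (0:R)^'+]
      --> (2 / 1 * (2^-1 + pi * (- 0)) : R).
    apply: cvgM.
      by apply: cvgM; [exact: cvg_cst|apply: cvgV; [exact: oner_neq0|exact: thA_cvg0]].
    apply: cvgD; first exact: Lc.
    apply: cvgM; first exact: cvg_cst.
    by under eq_fun do rewrite invrN; apply: cvgN; exact: invln_cvg0.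
  by rewrite E in H.
Unshelve. all: by end_near.
Qed.

End modular.

(** * Logarithmic derivative of the theta quotient *)

Section dlog.
Context {R : realType}.
Implicit Types (q x : R).

Lemma is_derive_theta_comp (g : R -> R) x (dg : R) : `|g x| < 1 ->
  is_derive x (1:R) g dg -> is_derive x (1:R) (fun y => theta (g y)) (dtheta (g x) * dg).
Proof. by move=> g1 D; exact: (@is_derive1_comp _ theta g x _ _ (is_derive_theta g1) D). Qed.

Lemma is_derive_uniq (f g : R -> R) x (a b : R) : is_derive x (1:R) f a -> is_derive x (1:R) g b ->
  (\near x, f x = g x) -> a = b.
Proof.
move=> Da Db fg; have Da' := near_eq_is_derive fg Da.
by rewrite -(@derive_val _ _ _ _ _ _ _ Da') (@derive_val _ _ _ _ _ _ _ Db).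
Qed.

Lemma near_nome_in x : 0 < x -> x < 1 -> \forall y \near x, 0 < y < 1.
Proof.
move=> x0 x1; near=> y; apply/andP; split; near: y.
  exact: lt_nbhsr.
exact: lt_nbhsl.
Unshelve. all: by end_near.
Qed.

Lemma thetaN_sqr x : 0 < x -> x < 1 -> theta (- x ^+ 2) ^+ 2 = theta x * theta (- x).
Proof.
move=> x0 x1; have := thB_double x0 x1; rewrite /thA /thB -[in RHS]exprMn.
have a0 := theta_gt0 x0 x1; have b0 := thetaN_gt0 x0 x1.
have h : 0 <= theta x * theta (- x) by apply/ltW/mulr_gt0.
by move/eqP; rewrite eqrXn2// ?sqr_ge0// => /eqP.
Qed.

(** The doubling formulas for theta(x) and theta(-x), differentiated. *)
Lemma theta_dlog_double x : 0 < x -> x < 1 ->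
  4 * x * (theta x ^+ 2 + theta (- x) ^+ 2) * dtheta (x ^+ 2)
    = 2 * theta (x ^+ 2) * (theta x * dtheta x - theta (- x) * dtheta (- x))
  /\ 4 * x * (theta x * theta (- x)) * dtheta (- x ^+ 2)
    = theta (- x ^+ 2) * (theta x * dtheta (- x) - theta (- x) * dtheta x).
Proof.
move=> x0 x1.
have n1 : `|x| < 1 by rewrite gtr0_norm.
have n2 : `|- x| < 1 by rewrite normrN gtr0_norm.
have n3 : `|x ^+ 2| < 1 by rewrite normrX exprn_ilt1// ltW.
have n4 : `|- x ^+ 2| < 1 by rewrite normrN.
have dsq : is_derive x (1:R) (fun y : R => y ^+ 2) (2 * x).
  by apply: is_derive_eq; rewrite /GRing.scale/=; ring.
have dN : is_derive x (1:R) (fun y : R => - y) (- 1) by apply: is_derive_eq.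
have dsqN : is_derive x (1:R) (fun y : R => - y ^+ 2) (- (2 * x)).
  by apply: is_derive_eq; rewrite /GRing.scale/=; ring.
have Da := is_derive_theta n1.
have Db := @is_derive_theta_comp (fun y => - y) x (- 1) n2 dN.
have Du := @is_derive_theta_comp (fun y => y ^+ 2) x (2 * x) n3 dsq.
have Dv := @is_derive_theta_comp (fun y => - y ^+ 2) x (- (2 * x)) n4 dsqN.
have F1 : is_derive x (1:R) (fun y => 2 * theta (y ^+ 2) ^+ 2)
    (2 * (2 * theta (x ^+ 2) * (dtheta (x ^+ 2) * (2 * x)))).
  by apply: is_derive_eq; rewrite /GRing.scale/=; ring.
have G1 : is_derive x (1:R) (fun y => theta y ^+ 2 + theta (- y) ^+ 2)
    (2 * theta x * dtheta x + 2 * theta (- x) * (dtheta (- x) * - 1)).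
  by apply: is_derive_eq; rewrite /GRing.scale/=; ring.
have F2 : is_derive x (1:R) (fun y => theta (- y ^+ 2) ^+ 2)
    (2 * theta (- x ^+ 2) * (dtheta (- x ^+ 2) * - (2 * x))).
  by apply: is_derive_eq; rewrite /GRing.scale/=; ring.
have G2 : is_derive x (1:R) (fun y => theta y * theta (- y))
    (theta x * (dtheta (- x) * - 1) + theta (- x) * dtheta x).
  by apply: is_derive_eq; rewrite /GRing.scale/=; ring.
have E1 := is_derive_uniq F1 G1 _.
have E2 := is_derive_uniq F2 G2 _.
have R1 := thA_double x0 x1; have R2 := thetaN_sqr x0 x1.
have u0 : 0 < theta (x ^+ 2) by apply: theta_gt0; rewrite ?exprn_gt0// exprn_ilt1// ltW.
have v0 : 0 < theta (- x ^+ 2) by apply: thetaN_gt0; rewrite ?exprn_gt0// exprn_ilt1// ltW.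
rewrite /thA /thB in R1.
have {}E1 : 2 * (2 * theta (x ^+ 2) * (dtheta (x ^+ 2) * (2 * x))) =
   2 * theta x * dtheta x + 2 * theta (- x) * (dtheta (- x) * - 1).
  apply: E1; near=> y; have /andP[y0 y1] : 0 < y < 1 by near: y; exact: near_nome_in.
  by have := thA_double y0 y1; rewrite /thA /thB => ->; rewrite mulrC divfK.
have {}E2 : 2 * theta (- x ^+ 2) * (dtheta (- x ^+ 2) * - (2 * x)) =
   theta x * (dtheta (- x) * - 1) + theta (- x) * dtheta x.
  apply: E2; near=> y; have /andP[y0 y1] : 0 < y < 1 by near: y; exact: near_nome_in.
  exact: thetaN_sqr.
move: (theta x) (theta (- x)) (theta (x ^+ 2)) (theta (- x ^+ 2))
  (dtheta x) (dtheta (- x)) (dtheta (x ^+ 2)) (dtheta (- x ^+ 2)) R1 R2 E1 E2 u0 v0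
  => a b u v a' b' u' v' R1 R2 E1 E2 u0 v0.
have -> : a ^+ 2 + b ^+ 2 = 2 * u ^+ 2 by rewrite R1; field.
have -> : a * a' - b * b' = 4 * u * u' * x by lra.
rewrite -R2; have -> : a * b' - b * a' = 4 * v * v' * x by lra.
by split; ring.
Unshelve. all: by end_near.
Qed.

(** The quotient of the two sides is invariant under doubling, and its limit at 0
    only involves theta(0), theta'(0) and the leading term of [thC]. *)
Lemma theta_dlog q : 0 < q -> q < 1 ->
  q * (dtheta q / theta q + dtheta (- q) / theta (- q)) = thC q ^+ 2 / 4.
Proof.
move=> q0 q1.
pose w (x : R) := x * (dtheta x / theta x + dtheta (- x) / theta (- x)) / thC x ^+ 2.
suff E : w q = 4^-1.
  have c0 := thC_gt0 q0 q1; rewrite [RHS]mulrC -E /w divfK// gt_eqF// exprn_gt0//.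
apply: (@nome_doubling _ w _ _ _ _ q0 q1) => [x x0 x1|].
  have [E1 E2] := theta_dlog_double x0 x1.
  have a0 := theta_gt0 x0 x1; have b0 := thetaN_gt0 x0 x1.
  have u0 : 0 < theta (x ^+ 2) by apply: theta_gt0; rewrite ?exprn_gt0// exprn_ilt1// ltW.
  have v0 : 0 < theta (- x ^+ 2) by apply: thetaN_gt0; rewrite ?exprn_gt0// exprn_ilt1// ltW.
  have ba := thB_lt_thA x0 x1.
  rewrite /w (thC_double_sub x0 x1) (thC_sqr x0 x1).
  rewrite /thA /thB in ba *.
  move: (theta x) (theta (- x)) (theta (x ^+ 2)) (theta (- x ^+ 2))
    (dtheta x) (dtheta (- x)) (dtheta (x ^+ 2)) (dtheta (- x ^+ 2)) E1 E2 a0 b0 u0 v0 ba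
    => a b u v a' b' u' v' E1 E2 a0 b0 u0 v0 ba.
  have a2 : 0 < a ^+ 2 by exact: exprn_gt0.
  have b2 : 0 < b ^+ 2 by exact: exprn_gt0.
  have ab : 0 < a * b by exact: mulr_gt0.
  have -> : u' / u = (a * a' - b * b') / (2 * x * (a ^+ 2 + b ^+ 2)).
    apply: (mulfI (x := 4 * x * (a ^+ 2 + b ^+ 2))); first by rewrite gt_eqF// mulr_gt0//; lra.
    by rewrite (mulrA _ u') E1; field; rewrite !gt_eqF//; lra.
  have -> : v' / v = (a * b' - b * a') / (4 * x * (a * b)).
    apply: (mulfI (x := 4 * x * (a * b))); first by rewrite gt_eqF// mulr_gt0//; lra.
    by rewrite (mulrA _ v') E2; field; rewrite !gt_eqF.
  field; rewrite !gt_eqF//; [lra|lra|nra].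
have h : (thC_unit x ^+ 2)^-1 * (dtheta x / theta x + dtheta (- x) / theta (- x))
    @[x --> (0:R)^'+] --> ((4 * 4)^-1 * (2 / 1 + 2 / 1) : R).
  apply: cvgM; first by apply: cvgV; [lra|apply: cvgM; exact: thC_unit_cvg0].
  apply: cvgD; apply: cvgM; (exact: dtheta_cvg0 || exact: dthetaN_cvg0 || apply: cvgV).
  - exact: oner_neq0.
  - exact: theta_cvg0.
  - exact: oner_neq0.
  - exact: thetaN_cvg0.
have E16 : (4 * 4)^-1 * (2 / 1 + 2 / 1) = 4^-1 :> R by field.
rewrite E16 in h; apply: cvg_trans h; apply: near_eq_cvg; near=> x.
have /andP[x0 x1] : 0 < x < 1 by near: x; exact: near_nome.
rewrite /w thC_factor (exprMn _ (Num.sqrt x)) sqr_sqrtr ?(ltW x0)//.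
have := thC_unit_gt0 x0 x1; move: (_ + _) (thC_unit x) => d r r0.
by field; rewrite !gt_eqF.
Unshelve. all: by end_near.
Qed.

End dlog.

(** * The moduli as functions of t *)

Section modular_parametrization.
Context {R : realType}.
Notation mu := (@lebesgue_measure R).
Notation I := (`]0%R, +oo[%classic : set R).
Notation mR := (mreal R).
Implicit Types (q x t y : R).

Definition nome t : R := expR (- (pi * t)).

Lemma nome_gt0 t : 0 < nome t. Proof. exact: expR_gt0. Qed.

Lemma nome_lt1 t : 0 < t -> nome t < 1.
Proof. by move=> t0; rewrite /nome -expR0 ltr_expR oppr_lt0 mulr_gt0// pi_gt0. Qed.

Lemma ln_nome t : - ln (nome t) = pi * t. Proof. by rewrite /nome expRK opprK. Qed.

Lemma is_derive_nome t : is_derive t (1:R) nome (- pi * nome t).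
Proof.
have D : is_derive t (1:R) (fun t => - (pi * t)) (- pi).
  by apply: is_derive_eq; rewrite /GRing.scale/=; ring.
have := @is_derive1_comp _ expR (fun t => - (pi * t)) t _ _ (is_derive_expR _) D.
by rewrite mulrC.
Qed.

Lemma nome_surj q : 0 < q -> q < 1 -> exists2 t, 0 < t & nome t = q.
Proof.
move=> q0 q1; have l0 := ln_nome_lt0 q0 q1; exists (- ln q / pi).
  by rewrite divr_gt0 ?pi_gt0// oppr_gt0.
by rewrite /nome mulrC divfK ?gt_eqF ?pi_gt0// opprK lnK.
Qed.

(** theta_2^4/theta_4^4 and theta_2^4/theta_3^4, in the form obtained from the
    quartic identity; [dmodX] and [dmodK] are the opposites of their
    derivatives. *)
Definition modX t : R := thA (nome t) ^+ 2 / thB (nome t) ^+ 2 - 1.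
Definition modK t : R := 1 - thB (nome t) ^+ 2 / thA (nome t) ^+ 2.
Definition dmodX t : R := pi * (thA (nome t) ^+ 2 * thC (nome t) ^+ 2 / thB (nome t) ^+ 2).
Definition dmodK t : R := pi * (thB (nome t) ^+ 2 * thC (nome t) ^+ 2 / thA (nome t) ^+ 2).

Section at_t.
Variable t : R.
Hypothesis t0 : 0 < t.
Let A := thA (nome t).
Let B := thB (nome t).
Let C := thC (nome t).
Let q0 := nome_gt0 t.
Let q1 := nome_lt1 t0.
Let A0 : 0 < A. Proof. exact: thA_gt0. Qed.
Let B0 : 0 < B. Proof. exact: thB_gt0. Qed.
Let C0 : 0 < C. Proof. exact: thC_gt0. Qed.
Let A20 : 0 < A ^+ 2. Proof. exact: exprn_gt0. Qed.
Let B20 : 0 < B ^+ 2. Proof. exact: exprn_gt0. Qed.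
Let C20 : 0 < C ^+ 2. Proof. exact: exprn_gt0. Qed.
Let C2 : C ^+ 2 = A ^+ 2 - B ^+ 2. Proof. exact: thC_sqr. Qed.

Lemma modXE : modX t = C ^+ 2 / B ^+ 2.
Proof. by rewrite /modX -/A -/B C2 mulrBl divff// gt_eqF. Qed.

Lemma modKE : modK t = C ^+ 2 / A ^+ 2.
Proof. by rewrite /modK -/A -/B C2 mulrBl divff// gt_eqF. Qed.

Lemma modX_gt0 : 0 < modX t. Proof. by rewrite modXE; exact: divr_gt0. Qed.
Lemma modK_gt0 : 0 < modK t. Proof. by rewrite modKE; exact: divr_gt0. Qed.
Lemma modK_lt1 : modK t < 1.
Proof. by rewrite /modK ltrBlDr ltrDl; exact: divr_gt0. Qed.

Lemma modK_X : modK t = modX t / (1 + modX t).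
Proof.
rewrite modKE modXE C2; move: A20 B20; move: (A ^+ 2) (B ^+ 2) => a b a0 b0.
have ab : b + (a - b) != 0 by rewrite addrC subrK gt_eqF.
by field; rewrite ab !gt_eqF.
Qed.

Lemma dmodX_gt0 : 0 < dmodX t.
Proof. by apply: mulr_gt0; [exact: pi_gt0|apply: divr_gt0 => //; exact: mulr_gt0]. Qed.
Lemma dmodK_gt0 : 0 < dmodK t.
Proof. by apply: mulr_gt0; [exact: pi_gt0|apply: divr_gt0 => //; exact: mulr_gt0]. Qed.

(** [theta_dlog] along q = exp (- pi t); [modX] and [modK] only involve the fourth
    power of this quotient and of its inverse. *)
Lemma theta_ratio_derive : is_derive t (1:R) (fun t => theta (nome t) / theta (- nome t))
  (- (pi / 4) * (theta (nome t) / theta (- nome t)) * C ^+ 2).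
Proof.
have n1 : `|nome t| < 1 by rewrite gtr0_norm.
have n2 : `|- nome t| < 1 by rewrite normrN gtr0_norm.
have DN : is_derive t (1:R) (fun t => - nome t) (pi * nome t).
  have := is_derive_nome t => D; apply: is_derive_eq; ring.
have Da := @is_derive_theta_comp _ nome t _ n1 (is_derive_nome t).
have Db := @is_derive_theta_comp _ (fun t => - nome t) t _ n2 DN.
have a0 := theta_gt0 q0 q1; have b0 := thetaN_gt0 q0 q1.
have dV := @is_derive1V _ (fun t => theta (- nome t)) t _ Db (lt0r_neq0 b0).
have E := theta_dlog q0 q1; rewrite -/C in E.
apply: is_derive_eq; rewrite /GRing.scale/=.
have -> : C ^+ 2 = 4 * (nome t * (dtheta (nome t) / theta (nome t) + dtheta (- nome t) / theta (- nome t))).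
  by rewrite E; field.
move: (theta (nome t)) (theta (- nome t)) (dtheta (nome t)) (dtheta (- nome t)) (nome t) a0 b0 => a b a' b' q a0 b0.
by field; rewrite !gt_eqF.
Qed.

Lemma is_derive_modX : is_derive t (1:R) modX (- dmodX t).
Proof.
have D := theta_ratio_derive.
have H : is_derive t (1:R) (fun t => (theta (nome t) / theta (- nome t)) ^+ 4 - 1) (- dmodX t).
  apply: is_derive_eq; rewrite /GRing.scale/= /dmodX -/C /thA /thB.
  have a0 := theta_gt0 q0 q1; have b0 := thetaN_gt0 q0 q1.
  move: (theta (nome t)) (theta (- nome t)) a0 b0 => a b a0 b0.
  by field; rewrite !gt_eqF.
apply: near_eq_is_derive H; near=> s.
by rewrite /modX /thA /thB exprMn exprVn -!exprM.
Unshelve. all: by end_near.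
Qed.

Lemma theta_ratio_inv_derive : is_derive t (1:R) (fun t => theta (- nome t) / theta (nome t))
  (pi / 4 * (theta (- nome t) / theta (nome t)) * C ^+ 2).
Proof.
have a0 := theta_gt0 q0 q1; have b0 := thetaN_gt0 q0 q1.
have r0 : theta (nome t) / theta (- nome t) != 0 by apply/lt0r_neq0/divr_gt0.
have dV := @is_derive1V _ _ t _ theta_ratio_derive r0.
have H : is_derive t (1:R) (fun t => (theta (nome t) / theta (- nome t))^-1)
    (pi / 4 * (theta (- nome t) / theta (nome t)) * C ^+ 2).
  apply: is_derive_eq; rewrite /GRing.scale/=.
  move: (theta (nome t)) (theta (- nome t)) a0 b0 => a b a0 b0.
  by field; rewrite !gt_eqF.
apply: near_eq_is_derive H; near=> s; by rewrite invf_div.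
Unshelve. all: by end_near.
Qed.

Lemma is_derive_modK : is_derive t (1:R) modK (- dmodK t).
Proof.
have D := theta_ratio_inv_derive.
have H : is_derive t (1:R) (fun t => 1 - (theta (- nome t) / theta (nome t)) ^+ 4) (- dmodK t).
  apply: is_derive_eq; rewrite /GRing.scale/= /dmodK -/C /thA /thB.
  have a0 := theta_gt0 q0 q1; have b0 := thetaN_gt0 q0 q1.
  move: (theta (nome t)) (theta (- nome t)) a0 b0 => a b a0 b0.
  by field; rewrite !gt_eqF.
apply: near_eq_is_derive H; near=> s.
by rewrite /modK /thA /thB exprMn exprVn -!exprM.
Unshelve. all: by end_near.
Qed.

Lemma ellG_modX : ellG (modX t) = (B * pi)%:E.
Proof.
have E : 1 + modX t = (B ^+ 2)^-1 * A ^+ 2 by rewrite /modX -/A -/B addrC subrK mulrC.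
have E1 : 1 = (B ^+ 2)^-1 * B ^+ 2 by rewrite mulVf// gt_eqF.
rewrite /ellG E {1}E1 ellint_scale ?invr_gt0// ellint_AB// -EFinM; congr (_ * _)%:E.
by rewrite /rsqrt -exprVn sqrtr_sqr gtr0_norm ?invr_gt0// invrK.
Qed.

Lemma ellH_modX : ellH (modX t) = (B * (pi * t))%:E.
Proof.
have E : 1 + modX t = (B ^+ 2)^-1 * A ^+ 2 by rewrite /modX -/A -/B addrC subrK mulrC.
rewrite /ellH E modXE [C ^+ 2 / _]mulrC ellint_scale ?invr_gt0// ellint_AC// ln_nome -EFinM.
by congr (_ * _)%:E; rewrite /rsqrt -exprVn sqrtr_sqr gtr0_norm ?invr_gt0// invrK.
Qed.

Lemma ellint1_modKC : ellint 1 (1 - modK t) = (A * pi)%:E.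
Proof.
have E : 1 - modK t = (A ^+ 2)^-1 * B ^+ 2 by rewrite /modK -/A -/B subKr mulrC.
have E1 : 1 = (A ^+ 2)^-1 * A ^+ 2 by rewrite mulVf// gt_eqF.
rewrite E {1}E1 ellint_scale ?invr_gt0// ellint_AB// -EFinM; congr (_ * _)%:E.
by rewrite /rsqrt -exprVn sqrtr_sqr gtr0_norm ?invr_gt0// invrK.
Qed.

Lemma ellint1_modK : ellint 1 (modK t) = (A * (pi * t))%:E.
Proof.
have E1 : 1 = (A ^+ 2)^-1 * A ^+ 2 by rewrite mulVf// gt_eqF.
rewrite modKE [C ^+ 2 / _]mulrC {1}E1 ellint_scale ?invr_gt0// ellint_AC// ln_nome -EFinM.
by congr (_ * _)%:E; rewrite /rsqrt -exprVn sqrtr_sqr gtr0_norm ?invr_gt0// invrK.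
Qed.

Lemma rsqrt_modX : rsqrt (modX t) = B / C.
Proof. by rewrite modXE -exprVn -exprMn /rsqrt sqrtr_sqr gtr0_norm ?divr_gt0// invf_div. Qed.

Lemma rsqrt_modK : rsqrt (modK t) = A / C.
Proof. by rewrite modKE -exprVn -exprMn /rsqrt sqrtr_sqr gtr0_norm ?divr_gt0// invf_div. Qed.

(** For t < 1 the period pi t of (A^2, C^2) is below the period pi of (A^2, B^2),
    hence C > B; [ellint_ratio] makes the comparison quantitative. This shows
    that [modX] is unbounded near t = 0. *)
Lemma modX_lower : t < 1 -> 1 / t ^+ 2 <= modX t.
Proof.
move=> t1.
have BC : B ^+ 2 <= C ^+ 2.
  rewrite leNgt; apply/negP => /ltW CB; have := le_ellint (A ^+ 2) C20 CB.
  rewrite ellint_AB// ellint_AC// ln_nome lee_fin leNgt.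
  by rewrite gtr_pMr ?pi_gt0// t1.
have := ellint_ratio B20 BC (ltW A20); rewrite ellint_AB// ellint_AC// ln_nome -EFinM lee_fin.
rewrite mulrC ler_pM2l ?pi_gt0// -modXE => h.
have X0 := modX_gt0; have h0 := rsqrt_gt0 X0.
have h2 : rsqrt (modX t) ^+ 2 <= t ^+ 2 by rewrite ler_pXn2r// ?nnegrE ltW.
rewrite rsqrt_sqr ?(ltW X0)// in h2.
by rewrite div1r -[leRHS]invrK lef_pV2// posrE ?invr_gt0// exprn_gt0.
Qed.

End at_t.
End modular_parametrization.

(** * Integration with respect to the moduli *)

Section modular_integrals.
Context {R : realType}.
Notation mu := (@lebesgue_measure R).
Notation I := (`]0%R, +oo[%classic : set R).
Notation mR := (mreal R).
Implicit Types (q x t y k : R).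

Lemma continuous_theta_nome t : 0 < t -> {for t, continuous (fun s => theta (nome s))}.
Proof.
move=> t0; have n1 : `|nome t| < 1 by rewrite gtr0_norm ?nome_gt0 ?nome_lt1.
have h : {for t, continuous (nome : R -> R)}.
  by apply/differentiable_continuous/derivable1_diffP; have [] := is_derive_nome t.
by apply: continuous_comp h _; exact: theta_continuous.
Qed.

Lemma continuous_thetaN_nome t : 0 < t -> {for t, continuous (fun s => theta (- nome s))}.
Proof.
move=> t0; have n1 : `|- nome t| < 1 by rewrite normrN gtr0_norm ?nome_gt0 ?nome_lt1.
have h : {for t, continuous (nome : R -> R)}.
  by apply/differentiable_continuous/derivable1_diffP; have [] := is_derive_nome t.
have h' : {for t, continuous (fun s => - nome s : R)} by apply: cvgN; exact: h.
by apply: (continuous_comp h'); exact: theta_continuous.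
Qed.

Lemma near_pos t : 0 < t -> \forall s \near t, 0 < s.
Proof. exact: lt_nbhsr. Qed.

Lemma continuous_dmodX t : 0 < t -> {for t, continuous (dmodX : R -> R)}.
Proof.
move=> t0; pose g (s : R) := pi * (thA (nome s) ^+ 2 * (thA (nome s) ^+ 2 - thB (nome s) ^+ 2) / thB (nome s) ^+ 2).
have E s : 0 < s -> g s = dmodX s.
  by move=> s0; rewrite /g /dmodX thC_sqr ?nome_gt0 ?nome_lt1.
have hA : {for t, continuous (fun s => thA (nome s) ^+ 2 : R)}.
  by rewrite /thA; apply: cvgM; apply: cvgM; exact: continuous_theta_nome.
have hB : {for t, continuous (fun s => thB (nome s) ^+ 2 : R)}.
  by rewrite /thB; apply: cvgM; apply: cvgM; exact: continuous_thetaN_nome.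
have b0 : 0 < thB (nome t) ^+ 2 by apply: exprn_gt0; apply: thB_gt0; [exact: nome_gt0|exact: nome_lt1].
have h : {for t, continuous g}.
  apply: cvgM; first exact: cvg_cst.
  apply: cvgM; last by apply: cvgV; [exact: lt0r_neq0|exact: hB].
  by apply: cvgM; [exact: hA|apply: cvgB; [exact: hA|exact: hB]].
rewrite /prop_for /continuous_at -E//; apply: cvg_trans h; apply: near_eq_cvg.
by near=> s; rewrite E//; near: s; exact: near_pos.
Unshelve. all: by end_near.
Qed.

Lemma continuous_dmodK t : 0 < t -> {for t, continuous (dmodK : R -> R)}.
Proof.
move=> t0; pose g (s : R) := pi * (thB (nome s) ^+ 2 * (thA (nome s) ^+ 2 - thB (nome s) ^+ 2) / thA (nome s) ^+ 2).
have E s : 0 < s -> g s = dmodK s.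
  by move=> s0; rewrite /g /dmodK thC_sqr ?nome_gt0 ?nome_lt1.
have hA : {for t, continuous (fun s => thA (nome s) ^+ 2 : R)}.
  by rewrite /thA; apply: cvgM; apply: cvgM; exact: continuous_theta_nome.
have hB : {for t, continuous (fun s => thB (nome s) ^+ 2 : R)}.
  by rewrite /thB; apply: cvgM; apply: cvgM; exact: continuous_thetaN_nome.
have a0 : 0 < thA (nome t) ^+ 2 by apply: exprn_gt0; apply: thA_gt0; [exact: nome_gt0|exact: nome_lt1].
have h : {for t, continuous g}.
  apply: cvgM; first exact: cvg_cst.
  apply: cvgM; last by apply: cvgV; [exact: lt0r_neq0|exact: hA].
  by apply: cvgM; [exact: hB|apply: cvgB; [exact: hA|exact: hB]].
rewrite /prop_for /continuous_at -E//; apply: cvg_trans h; apply: near_eq_cvg.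
by near=> s; rewrite E//; near: s; exact: near_pos.
Unshelve. all: by end_near.
Qed.

Lemma modX_surj y : 0 < y -> exists2 t, 0 < t & modX t = y.
Proof.
move=> y0.
have [s [s0 s1] sy] : exists2 s : R, 0 < s /\ s < 1 & y <= modX s.
  have y1 : 1 < y + 1 by rewrite ltrDr.
  exists (y + 1)^-1; first by split; [rewrite invr_gt0; lra|rewrite invf_lt1; lra].
  apply: le_trans (modX_lower _ _); [|rewrite invr_gt0; lra|rewrite invf_lt1; lra].
  by rewrite exprVn div1r invrK; nra.
have [t t0 ty] : exists2 t : R, 0 < t & modX t <= y.
  have h : thA x ^+ 2 / thB x ^+ 2 - 1 @[x --> (0:R)^'+] --> (1 * 1 / (1 * 1) - 1 : R).
    apply: cvgB; last exact: cvg_cst.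
    apply: cvgM; first by apply: cvgM; exact: thA_cvg0.
    by apply: cvgV; [rewrite mulr1 oner_neq0|apply: cvgM; exact: thB_cvg0].
  rewrite mulr1 divr1 subrr in h.
  have [q [/andP[q0 q1] qy]] : exists q : R, 0 < q < 1 /\ thA q ^+ 2 / thB q ^+ 2 - 1 < y.
    apply/(@filter_ex _ (0:R)^'+); near=> q; split; first by near: q; exact: near_nome.
    near: q; move/cvgrPdist_lt : h => /(_ _ y0); apply: filterS => q.
    by rewrite sub0r normrN; apply: le_lt_trans; exact: ler_norm.
  by have [t t0 tq] := nome_surj q0 q1; exists t => //; rewrite /modX tq ltW.
have [ts|st] := ltP t s.
  exfalso; have Dx x : 0 < x -> is_derive x (1:R) (fun t => - modX t) (dmodX x).
    by move=> x0; have D := is_derive_modX x0; apply: is_derive_eq; rewrite opprK.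
  have := cov_lt Dx (@dmodX_gt0 R) t0 ts; rewrite ltrN2 => h.
  by have := lt_le_trans (le_lt_trans sy h) ty; rewrite ltxx.
have Dx x : 0 < x -> is_derive x (1:R) (fun t => - modX t) (dmodX x).
  by move=> x0; have D := is_derive_modX x0; apply: is_derive_eq; rewrite opprK.
have [|c /andP[sc _] /oppr_inj cy] := @cov_IVT _ _ _ Dx (@dmodX_gt0 R) s t (- y) s0 st.
  by rewrite !lerN2 sy.
by exists c => //; exact: lt_le_trans sc.
Unshelve. all: by end_near.
Qed.

Lemma modK_surj k : 0 < k -> k < 1 -> exists2 t, 0 < t & modK t = k.
Proof.
move=> k0 k1; have x0 : 0 < k / (1 - k) by rewrite divr_gt0// subr_gt0.
have [t t0 tE] := modX_surj x0; exists t => //.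
by rewrite modK_X// tE; field; lra.
Qed.

(** At x = [modX t] the factors combine as
    (B/C) (pi B)^2 (pi A^2 C^2 / B^2) = pi^3 C A^2 B. *)
Lemma theta_integral_X (u v : R -> \bar R) (a b : R -> R) :
  measurable_fun setT (u : mR -> \bar R) -> measurable_fun setT (v : mR -> \bar R) ->
  (forall x, (0 <= u x)%E) -> (forall x, (0 <= v x)%E) ->
  (forall t, 0 < t -> u (modX t) = (thB (nome t) * (pi * a t))%:E) ->
  (forall t, 0 < t -> v (modX t) = (thB (nome t) * (pi * b t))%:E) ->
  (\int[mu]_(x in I) ((rsqrt x)%:E * (u x * v x)) =
   \int[mu]_(t in I) (pi ^+ 3 * (thC (nome t) * thA (nome t) ^+ 2 * thB (nome t) * (a t * b t)))%:E)%E.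
Proof.
move=> mf mg f0 g0 fE gE.
rewrite (cov_pos_decreasing (@is_derive_modX R) continuous_dmodX (@dmodX_gt0 R) (@modX_gt0 R)).
- apply: eq_integral_pos => t t0; rewrite (fE t t0) (gE t t0) (rsqrt_modX t0) -!EFinM.
  congr (_%:E); have q0 := nome_gt0 t; have q1 := nome_lt1 t0.
  rewrite /dmodX; move: (thA_gt0 q0 q1) (thB_gt0 q0 q1) (thC_gt0 q0 q1).
  move: (thA (nome t)) (thB (nome t)) (thC (nome t)) (a t) (b t) => A B C x y A0 B0 C0.
  by field; rewrite !gt_eqF.
- by apply: measurable_rsqrtE; exact: emeasurable_funM.
- by move=> y; rewrite !mule_ge0// lee_fin rsqrt_ge0.
- by move=> y /modX_surj h; left.
Qed.

(** At k = [modK t] the factors combine as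
    (A/C) (pi A)^2 (pi B^2 C^2 / A^2) = pi^3 C A B^2. *)
Lemma theta_integral_K (u v : R -> \bar R) (a b : R -> R) :
  measurable_fun setT (u : mR -> \bar R) -> measurable_fun setT (v : mR -> \bar R) ->
  (forall x, (0 <= u x)%E) -> (forall x, (0 <= v x)%E) ->
  (forall t, 0 < t -> u (modK t) = (thA (nome t) * (pi * a t))%:E) ->
  (forall t, 0 < t -> v (modK t) = (thA (nome t) * (pi * b t))%:E) ->
  (\int[mu]_(x in `]0%R, 1%R[) ((rsqrt x)%:E * (u x * v x)) =
   \int[mu]_(t in I) (pi ^+ 3 * (thC (nome t) * thA (nome t) * thB (nome t) ^+ 2 * (a t * b t)))%:E)%E.
Proof.
move=> mf mg f0 g0 fE gE.
have JI : `]0%R, 1%R[ `<=` I by move=> x /=; rewrite !in_itv/= andbT => /andP[].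
rewrite integral_pos_sub//.
rewrite (cov_pos_decreasing (@is_derive_modK R) continuous_dmodK (@dmodK_gt0 R) (@modK_gt0 R)).
- apply: eq_integral_pos => t t0.
  rewrite patchE mem_set; last by rewrite /= in_itv/= modK_gt0// modK_lt1.
  rewrite (fE t t0) (gE t t0) (rsqrt_modK t0) -!EFinM.
  congr (_%:E); have q0 := nome_gt0 t; have q1 := nome_lt1 t0.
  rewrite /dmodK; move: (thA_gt0 q0 q1) (thB_gt0 q0 q1) (thC_gt0 q0 q1).
  move: (thA (nome t)) (thB (nome t)) (thC (nome t)) (a t) (b t) => A B C x y A0 B0 C0.
  by field; rewrite !gt_eqF.
- apply/(measurable_restrictT _ _).1 => //; apply: measurable_funTS.
  by apply: measurable_rsqrtE; exact: emeasurable_funM.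
- by apply: erestrict_ge0 => y _; rewrite !mule_ge0// lee_fin rsqrt_ge0.
- move=> y y0; have [y1|y1] := ltP y 1; first by left; exact: modK_surj.
  right; rewrite patchE memNset// /= in_itv/= => /andP[_]; by rewrite ltNge y1.
Qed.

End modular_integrals.

(** * Relations between the Mellin transforms *)

Section theta_moments.
Context {R : realType}.
Notation mu := (@lebesgue_measure R).
Notation I := (`]0%R, +oo[%classic : set R).
Notation mR := (mreal R).
Implicit Types (q x t y : R).

(** Four times the two cusp forms at i t/4; see [f1_imag] and [f2_imag]. *)
Definition cusp1 t : R := thC (nome t) * thA (nome t) ^+ 2 * thB (nome t).
Definition cusp2 t : R := thC (nome t) * thA (nome t) * thB (nome t) ^+ 2.

Lemma cusp1_gt0 t : 0 < t -> 0 < cusp1 t.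
Proof.
move=> t0; have q0 := nome_gt0 t; have q1 := nome_lt1 t0.
apply: mulr_gt0; [apply: mulr_gt0; [exact: thC_gt0|apply: exprn_gt0; exact: thA_gt0]|exact: thB_gt0].
Qed.

Lemma cusp2_gt0 t : 0 < t -> 0 < cusp2 t.
Proof.
move=> t0; have q0 := nome_gt0 t; have q1 := nome_lt1 t0.
apply: mulr_gt0; [apply: mulr_gt0; [exact: thC_gt0|exact: thA_gt0]|apply: exprn_gt0; exact: thB_gt0].
Qed.

Lemma measurable_pos_continuous (f : R -> R) : (forall t : R, 0 < t -> {for t, continuous f}) ->
  measurable_fun I (f : mR -> mR).
Proof.
move=> h; apply: open_continuous_measurable_fun; first exact: interval_open.
by move=> x; rewrite inE/= in_itv/= andbT => /h.
Qed.

Lemma continuous_thetas t : 0 < t -> [/\ {for t, continuous (fun s => thA (nome s) : R)},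
  {for t, continuous (fun s => thB (nome s) : R)} & {for t, continuous (fun s => thC (nome s) : R)}].
Proof.
move=> t0.
have hA : {for t, continuous (fun s => thA (nome s) : R)}.
  by rewrite /thA; apply: cvgM; exact: continuous_theta_nome.
have hB : {for t, continuous (fun s => thB (nome s) : R)}.
  by rewrite /thB; apply: cvgM; exact: continuous_thetaN_nome.
split => //.
have E s : 0 < s -> Num.sqrt (thA (nome s) ^+ 2 - thB (nome s) ^+ 2) = thC (nome s) :> R.
  move=> s0; rewrite -thC_sqr ?nome_gt0 ?nome_lt1// sqrtr_sqr ger0_norm//.
  by apply/ltW/thC_gt0; [exact: nome_gt0|exact: nome_lt1].
have h : {for t, continuous (fun s => Num.sqrt (thA (nome s) ^+ 2 - thB (nome s) ^+ 2) : R)}.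
  apply: (@continuous_comp _ _ _ (fun s => thA (nome s) ^+ 2 - thB (nome s) ^+ 2) Num.sqrt); last exact: sqrt_continuous.
  by apply: cvgB; apply: cvgM; (exact: hA || exact: hB).
rewrite /prop_for /continuous_at -E//; apply: cvg_trans h; apply: near_eq_cvg.
by near=> s; rewrite E//; near: s; exact: near_pos.
Unshelve. all: by end_near.
Qed.

Lemma continuous_cusp1 n t : 0 < t -> {for t, continuous (fun s => cusp1 s * s ^+ n : R)}.
Proof.
move=> t0; have [hA hB hC] := continuous_thetas t0.
apply: cvgM; last exact: exprn_continuous.
by apply: cvgM; [apply: cvgM; [exact: hC|apply: cvgM; exact: hA]|exact: hB].
Qed.

Lemma continuous_cusp2 n t : 0 < t -> {for t, continuous (fun s => cusp2 s * s ^+ n : R)}.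
Proof.
move=> t0; have [hA hB hC] := continuous_thetas t0.
apply: cvgM; last exact: exprn_continuous.
by apply: cvgM; [apply: cvgM; [exact: hC|exact: hA]|apply: cvgM; exact: hB].
Qed.

(** The substitution t = 4 t0. *)
Lemma integral_pos_scale4 (f : R -> R) (c : R) n : 0 <= c ->
  (forall t : R, 0 < t -> {for t, continuous (fun s : R => f s * s ^+ n)}) ->
  (forall t : R, 0 < t -> 0 < f t) ->
  (\int[mu]_(t in I) (c * (f t * t ^+ n))%:E =
   (c * 4 ^+ n.+2)%:E * \int[mu]_(t in I) (4^-1 * f (4 * t)%R * t ^+ n)%:E)%E.
Proof.
move=> c0 hf f0.
have hg : measurable_fun I (fun t : mR => (f t * t ^+ n)%:E).
  by apply/measurable_EFinP; exact: measurable_pos_continuous hf.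
have h4 (t : R) : 0 < t -> {for t, continuous (fun s : R => 4^-1 * f (4 * s) * s ^+ n)}.
  move=> t0; have t4 : 0 < 4 * t by rewrite mulr_gt0.
  have h : {for t, continuous (fun s : R => (4 ^+ n.+1)^-1 * (f (4 * s) * (4 * s) ^+ n) : R)}.
    apply: cvgM; first exact: cvg_cst.
    apply: (@continuous_comp _ _ _ (fun s : R => 4 * s) (fun s => f s * s ^+ n)); last exact: hf.
    by apply: cvgM; [exact: cvg_cst|exact: cvg_id].
  rewrite (_ : (fun s => _) = (fun s => (4 ^+ n.+1)^-1 * (f (4 * s) * (4 * s) ^+ n)))//.
  apply/funext => s; rewrite exprMn exprS invfM.
  have : 4 ^+ n != 0 :> R by rewrite expf_neq0.
  by move: (4 ^+ n) (f _) (s ^+ n) => a b d a0; field.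
have hm : measurable_fun I (fun t : mR => (4^-1 * f (4 * t) * t ^+ n)%:E).
  by apply/measurable_EFinP; exact: measurable_pos_continuous h4.
under eq_integral do rewrite EFinM.
rewrite ge0_integralZl//; last first.
  move=> x; rewrite /= in_itv/= andbT => x0.
  by rewrite lee_fin mulr_ge0// ?exprn_ge0 ?ltW// f0.
rewrite EFinM -muleA; congr (_ * _)%E.
have D (x : R) : 0 < x -> is_derive x (1:R) (fun x => 4 * x) ((fun=> 4) x).
  by move=> x0; apply: is_derive_eq; rewrite /GRing.scale/=; ring.
have im : (fun x : R => 4 * x) @` I = I.
  apply/seteqP; split=> [_ [x xI <-]|x]; rewrite /= !in_itv/= !andbT.
    by move: xI; rewrite /= in_itv/= andbT => x0; rewrite mulr_gt0.
  move=> x0; exists (x / 4); last by field.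
  by rewrite /= in_itv/= andbT divr_gt0.
transitivity (\int[mu]_(x in I) ((f (4 * x) * (4 * x) ^+ n)%:E * 4%:E))%E.
  apply: (@ge0_cov_increasing _ (fun x => 4 * x) (fun=> 4) I (fun x => (f x * x ^+ n)%:E) D _ _ im hg).
  - by move=> x _; exact: cvg_cst.
  - by [].
  - move=> x; rewrite /= in_itv/= andbT => x0.
    by rewrite lee_fin; apply: mulr_ge0; [exact: ltW (f0 _ x0)|exact: exprn_ge0 (ltW x0)].
rewrite -ge0_integralZl//; last first.
  move=> x; rewrite /= in_itv/= andbT => x0.
  rewrite lee_fin; apply: mulr_ge0; last exact: exprn_ge0 (ltW x0).
  by apply: mulr_ge0; rewrite ?invr_ge0//; apply: ltW; apply: f0; rewrite mulr_gt0.
apply: eq_integral_pos => x x0; rewrite -!EFinM; congr (_%:E).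
rewrite exprMn !exprS; move: (4 ^+ n) (f _) (x ^+ n) => a b d; by field.
Qed.

Definition mellin1 n := (\int[mu]_(t in I) (4^-1 * cusp1 (4 * t)%R * t ^+ n)%:E)%E.
Definition mellin2 n := (\int[mu]_(t in I) (4^-1 * cusp2 (4 * t)%R * t ^+ n)%:E)%E.

Let c n : R := pi ^+ 3 * 4 ^+ n.+2.

Let p30 : 0 <= pi ^+ 3 :> R. Proof. by rewrite exprn_ge0// pi_ge0. Qed.

Lemma moment_mellin1 (u v : R -> \bar R) (a b : R -> R) n :
  measurable_fun setT (u : mR -> \bar R) -> measurable_fun setT (v : mR -> \bar R) ->
  (forall x, (0 <= u x)%E) -> (forall x, (0 <= v x)%E) ->
  (forall t, 0 < t -> u (modX t) = (thB (nome t) * (pi * a t))%:E) ->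
  (forall t, 0 < t -> v (modX t) = (thB (nome t) * (pi * b t))%:E) ->
  (forall t, a t * b t = t ^+ n) ->
  (\int[mu]_(x in I) ((rsqrt x)%:E * (u x * v x)) = (c n)%:E * mellin1 n)%E.
Proof.
move=> mf mg f0 g0 fE gE abn; rewrite (theta_integral_X mf mg f0 g0 fE gE).
rewrite /c /mellin1 -integral_pos_scale4//.
- by apply: eq_integral => t _; rewrite abn.
- exact: continuous_cusp1.
- exact: cusp1_gt0.
Qed.

Lemma moment_mellin2 (u v : R -> \bar R) (a b : R -> R) n :
  measurable_fun setT (u : mR -> \bar R) -> measurable_fun setT (v : mR -> \bar R) ->
  (forall x, (0 <= u x)%E) -> (forall x, (0 <= v x)%E) ->
  (forall t, 0 < t -> u (modK t) = (thA (nome t) * (pi * a t))%:E) ->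
  (forall t, 0 < t -> v (modK t) = (thA (nome t) * (pi * b t))%:E) ->
  (forall t, a t * b t = t ^+ n) ->
  (\int[mu]_(x in `]0%R, 1%R[) ((rsqrt x)%:E * (u x * v x)) = (c n)%:E * mellin2 n)%E.
Proof.
move=> mf mg f0 g0 fE gE abn; rewrite (theta_integral_K mf mg f0 g0 fE gE).
rewrite /c /mellin2 -integral_pos_scale4//.
- by apply: eq_integral => t _; rewrite abn.
- exact: continuous_cusp2.
- exact: cusp2_gt0.
Qed.

Let mG := @measurable_ellG R.
Let mH := @measurable_ellH R.
Let mK : measurable_fun setT (ellint 1 : mR -> \bar R).
Proof. by apply: measurable_ellint; msolve. Qed.
Let mK' : measurable_fun setT ((fun k => ellint 1 (1 - k)) : mR -> \bar R).
Proof. by apply: measurable_ellint; msolve. Qed.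
Let G0 (x : R) : (0 <= ellG x)%E. Proof. exact: ellint_ge0. Qed.
Let H0 (x : R) : (0 <= ellH x)%E. Proof. exact: ellint_ge0. Qed.
Let K0 (x : R) : (0 <= ellint 1 x)%E. Proof. exact: ellint_ge0. Qed.
Let K0' (x : R) : (0 <= ellint 1 (1 - x))%E. Proof. exact: ellint_ge0. Qed.
Let gE t : 0 < t -> ellG (modX t) = (thB (nome t) * (pi * 1))%:E.
Proof. by move=> t0; rewrite mulr1; exact: ellG_modX. Qed.
Let hE := @ellH_modX R.
Let kE := @ellint1_modK R.
Let k'E t : 0 < t -> ellint 1 (1 - modK t) = (thA (nome t) * (pi * 1))%:E.
Proof. by move=> t0; rewrite mulr1; exact: ellint1_modKC. Qed.

Let one_ (t : R) : 1 * 1 = t ^+ 0. Proof. by rewrite mulr1. Qed.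
Let one_t (t : R) : 1 * t = t ^+ 1. Proof. by rewrite mul1r. Qed.
Let t_t (t : R) : t * t = t ^+ 2. Proof. by rewrite expr2. Qed.

Let GG := moment_mellin1 mG mG G0 G0 gE gE one_.
Let GH := moment_mellin1 mG mH G0 H0 gE hE one_t.
Let HH := moment_mellin1 mH mH H0 H0 hE hE t_t.
Let KK := moment_mellin2 mK mK K0 K0 kE kE t_t.
Let K'K := moment_mellin2 mK' mK K0' K0 k'E kE one_t.
Let K'K' := moment_mellin2 mK' mK' K0' K0' k'E k'E one_.

Lemma mellin1_2_0 : ((c 2)%:E * mellin1 2 = (c 0)%:E * mellin1 0)%E.
Proof. exact: etrans (esym HH) (etrans (@moment_HH_GG R) GG). Qed.

Lemma mellin1_1_mellin2_2 : ((c 1)%:E * mellin1 1 = (c 2)%:E * mellin2 2)%E.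
Proof. exact: etrans (esym GH) (etrans (@moment_GH R) KK). Qed.

Lemma mellin1_0_mellin2_1 : ((c 0)%:E * mellin1 0 = 2%:E * ((c 1)%:E * mellin2 1))%E.
Proof.
exact: etrans (esym GG) (etrans (@moment_GG R) (congr1 (fun z => (2%:E * z)%E) K'K)).
Qed.

Lemma mellin2_2_0 : ((c 2)%:E * mellin2 2 = 2%:E * ((c 0)%:E * mellin2 0))%E.
Proof.
exact: etrans (esym KK) (etrans (@ellint_square_moments R) (congr1 (fun z => (2%:E * z)%E) K'K')).
Qed.

(** Holds also at infinite x, where both sides are 0. *)
Lemma fine_scale (r : R) (x : \bar R) : 0 < r -> fine (r%:E * x) = r * fine x.
Proof.
by move=> r0; case: x => [x||] //=; rewrite ?gt0_muley ?gt0_muleNy ?lte_fin//= mulr0.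
Qed.

Lemma mellin_relations : [/\ fine (mellin1 2) = fine (mellin1 0) / 16, fine (mellin2 1) = fine (mellin1 0) / 8,
  fine (mellin2 2) = fine (mellin2 0) / 8 & fine (mellin1 1) = fine (mellin2 0) / 2].
Proof.
have c0 n : 0 < c n by rewrite mulr_gt0// exprn_gt0// pi_gt0.
have p0 : 0 < pi ^+ 3 :> R by rewrite exprn_gt0// pi_gt0.
have E1 := congr1 fine mellin1_2_0; have E2 := congr1 fine mellin1_1_mellin2_2.
have E3 := congr1 fine mellin1_0_mellin2_1; have E4 := congr1 fine mellin2_2_0.
rewrite !fine_scale ?c0// in E1 E2 E3 E4.
move: (fine (mellin1 0)) (fine (mellin1 1)) (fine (mellin1 2)) (fine (mellin2 0)) (fine (mellin2 1)) (fine (mellin2 2))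
  E1 E2 E3 E4 => a0 a1 a2 b0 b1 b2; rewrite /c; move: (pi ^+ 3) p0 => p p0 E1 E2 E3 E4.
by split; apply: (mulfI (x := p)); rewrite ?gt_eqF//; lra.
Qed.

End theta_moments.

Local Open Scope complex_scope.

(** * Eta quotients on the imaginary axis and the L-values *)

Section eta_real.
Context {R : realType}.
Notation mu := (@lebesgue_measure R).
Notation I := (`]0%R, +oo[%classic : set R).
Implicit Types (s t x q : R).

Lemma cexp_real x : cexp x%:C = (expR x)%:C.
Proof. by rewrite /cexp /= cos0 sin0 -[X in _ * X]/(1%:C) mulr1. Qed.

Lemma imag_times x y : ('i * x%:C) * ('i * y%:C) = (- (x * y))%:C :> R[i].
Proof. by rewrite mulrACA -expr2 sqr_i -rmorphM mulN1r rmorphN. Qed.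

Lemma natr_complex n : (n%:R : R[i]) = (n%:R)%:C. Proof. by rewrite rmorph_nat. Qed.

Lemma qparam_imag s : qparam ('i * s%:C) = (expR (- (2 * pi * s)))%:C.
Proof. by rewrite /qparam imag_times cexp_real. Qed.

Lemma cvg_real_complex (u : R^nat) (l : R) : u n @[n --> \oo] --> l ->
  ((u n)%:C : R[i]^o) @[n --> \oo] --> (l%:C : R[i]^o).
Proof.
move=> ul; apply/cvgrPdist_lt => e e0.
have [r r0 ->] : exists2 r : R, 0 < r & e = r%:C.
  by case: e e0 => a b; rewrite ltcE/= => /andP[/eqP-> a0]; exists a.
move/cvgrPdist_lt : ul => /(_ _ r0); apply: filterS => n.
by rewrite -rmorphB normc_def/= expr0n addr0 sqrtr_sqr ltcR.
Qed.

(** The value of eta at i s, a real number. *)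
Definition etaR s : R := expR (- (2 * pi * s) / 24) * qinf (expR (- (2 * pi * s))).

Lemma eta_imag s : 0 < s -> eta ('i * s%:C) = (etaR s)%:C.
Proof.
move=> s0; rewrite /eta /etaR [in RHS]rmorphM; congr (_ * _).
  by rewrite imag_times natr_complex -fmorph_div cexp_real.
set q := expR _; have q0 : 0 < q by exact: expR_gt0.
have q1 : q < 1 by rewrite /q -expR0 ltr_expR oppr_lt0 !mulr_gt0// pi_gt0.
apply: (@cvg_lim (R[i]^o)); first exact: (@norm_hausdorff _ (R[i]^o)).
rewrite qparam_imag -/q; under eq_fun => N.
  rewrite (eq_bigr (fun n => (1 - q ^+ n)%:C)); last first.
    by move=> n _; rewrite rmorphB rmorphXn.
  rewrite -rmorph_prod; over.
exact/cvg_real_complex/qpoch_cvg.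
Qed.

(** The argument is scaled so that exp (- 2 pi s) is the n-th power of the nome;
    exp (- pi t / 6) is the 24th root of that nome. *)
Lemma etaR_nome t n : etaR (n%:R * (2 * t)) = expR (- (pi * t) / 6) ^+ n * qinf (nome (4 * t) ^+ n).
Proof.
rewrite /etaR /nome -!expRM_natl; congr (expR _ * qinf (expR _)); last by ring.
by field.
Qed.

Lemma sqrt_nome t : Num.sqrt (nome (4 * t)) = expR (- (pi * t) / 6) ^+ 12.
Proof.
apply: eq_sqr_ge0; rewrite ?sqrtr_ge0 ?exprn_ge0 ?expR_ge0//.
rewrite sqr_sqrtr ?expR_ge0// /nome -exprM -expRM_natl; congr expR; by field.
Qed.

Lemma imag_scale n t : n%:R * ('i * t%:C) = 'i * (n%:R * t)%:C :> R[i].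
Proof. by rewrite mulrCA natr_complex -rmorphM. Qed.

Section at_t.
Variable t : R.
Hypothesis t0 : 0 < t.
Let q := nome (4 * t).
Let q0 : 0 < q := nome_gt0 _.
Let t4 : 0 < 4 * t. Proof. by rewrite mulr_gt0. Qed.
Let q1 : q < 1 := nome_lt1 t4.
Let P1 : 0 < qinf q. Proof. exact: qinf_gt0. Qed.
Let P2 : 0 < qinf (q ^+ 2).
Proof. by apply: qinf_gt0; rewrite ?exprn_gt0// exprn_ilt1// ltW. Qed.
Let P4 : 0 < qinf (q ^+ 4).
Proof. by apply: qinf_gt0; rewrite ?exprn_gt0// exprn_ilt1// ltW. Qed.

Let eta2 : etaR (2 * t) = expR (- (pi * t) / 6) * qinf q.
Proof. by have := etaR_nome t 1; rewrite mul1r !expr1. Qed.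
Let eta4 : etaR (4 * t) = expR (- (pi * t) / 6) ^+ 2 * qinf (q ^+ 2).
Proof. by rewrite -etaR_nome mulrA -natrM. Qed.
Let eta8 : etaR (8 * t) = expR (- (pi * t) / 6) ^+ 4 * qinf (q ^+ 4).
Proof. by rewrite -etaR_nome mulrA -natrM. Qed.

Lemma f1_imag : f1 ('i * t%:C) = (4^-1 * cusp1 (4 * t))%:C.
Proof.
rewrite /f1 !imag_scale !eta_imag ?mulr_gt0// -!rmorphXn -rmorphM -fmorph_div; congr (_%:C).
rewrite eta2 eta4 eta8 /cusp1 -/q /thC /thA /thB sqrt_nome theta_neg// theta_pos//.
have := expR_gt0 (- (pi * t) / 6); move: (expR _) (qinf q) (qinf (q ^+ 2)) (qinf (q ^+ 4)) P1 P2 P4.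
by move=> p a b c a0 b0 c0 p0; field; rewrite !gt_eqF.
Qed.

Lemma f2_imag : f2 ('i * t%:C) = (4^-1 * cusp2 (4 * t))%:C.
Proof.
rewrite /f2 !imag_scale !eta_imag ?mulr_gt0// -!rmorphXn -rmorphM; congr (_%:C).
rewrite eta2 eta4 /cusp2 -/q /thC /thA /thB sqrt_nome theta_neg// theta_pos//.
have := expR_gt0 (- (pi * t) / 6); move: (expR _) (qinf q) (qinf (q ^+ 2)) (qinf (q ^+ 4)) P1 P2 P4.
by move=> p a b c a0 b0 c0 p0; field; rewrite !gt_eqF.
Qed.

End at_t.

Lemma Lvalue_real (f : R[i] -> R[i]) (g : R -> R) n : (forall t, 0 < t -> f ('i * t%:C) = (g t)%:C) ->
  Lvalue f n.+1 = ((2 * pi) ^+ n.+1 / n`!%:R * fine (\int[mu]_(t in I) (g t * t ^+ n)%:E)%E)%:C.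
Proof.
move=> fg; rewrite /Lvalue /= [in RHS]rmorphM; congr (_ * _).
have fgn t : t \in I -> f ('i * t%:C) * t%:C ^+ n = (g t * t ^+ n)%:C.
  by rewrite inE/= in_itv/= andbT => /fg->; rewrite -rmorphXn -rmorphM.
rewrite /Cintegral /Rintegral.
have -> : (\int[mu]_(t in I) (complex.Re (f ('i * t%:C) * t%:C ^+ n))%:E =
           \int[mu]_(t in I) (g t * t ^+ n)%:E)%E.
  by apply: eq_integral => t /fgn ->.
have -> : (\int[mu]_(t in I) (complex.Im (f ('i * t%:C) * t%:C ^+ n))%:E = 0)%E.
  by rewrite -(integral0 mu I); apply: eq_integral => t /fgn ->.
by [].
Qed.

Lemma Lvalue_f1 n : Lvalue (@f1 R) n.+1 = ((2 * pi) ^+ n.+1 / n`!%:R * fine (@mellin1 R n))%:C.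
Proof. by apply: Lvalue_real => t; exact: f1_imag. Qed.

Lemma Lvalue_f2 n : Lvalue (@f2 R) n.+1 = ((2 * pi) ^+ n.+1 / n`!%:R * fine (@mellin2 R n))%:C.
Proof. by apply: Lvalue_real => t; exact: f2_imag. Qed.

End eta_real.

Theorem theorem4p2 (R : realType) :
  (Lvalue (@f1 R) 3 = (pi / 2)%:C * Lvalue (@f2 R) 2
   /\ (pi / 2)%:C * Lvalue (@f2 R) 2 = (pi ^+ 2 / 8)%:C * Lvalue (@f1 R) 1)
  /\ (Lvalue (@f2 R) 3 = (pi / 4)%:C * Lvalue (@f1 R) 2
   /\ (pi / 4)%:C * Lvalue (@f1 R) 2 = (pi ^+ 2 / 4)%:C * Lvalue (@f2 R) 1).
Proof.
have [E1 E2 E3 E4] := @mellin_relations R.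
rewrite !Lvalue_f1 !Lvalue_f2 E1 E2 E3 E4 -!rmorphM.
move: (fine _) (fine _) => x y; rewrite !factS fact0 !muln1.
by split; split; congr (_%:C); field.
Qed.
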